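(* In the game setting and with the notation of the context, suppose that for every $(x,y,m)\in\mathbb{R}^2\times\mathcal{P}(\mathbb{R})$ the function $V\ni v\mapsto b(x,m,v)y+f(x,m,v)$ admits a minimizer $v=\hat v(x,m,y)$, and suppose that all of the following conditions hold. (A1) The initial values $X_0^i$ are i.i.d. with common law $\mu_0$, and $\int_{\mathbb{R}}|x|^{p'}\mu_0(dx)<\infty$ for some $p'>4$. (A2) $\sigma$ is a positive constant. (A3) The classical partial derivatives $\hat b_x,\hat b_m,\hat b_y,\hat f_y$ and $\hat b_{yy}$ exist and are bounded. (A4) For each $N\in\mathbb{N}$, the $N$-player PDE system of the context with its terminal conditions admits classical solutions $U^{i,N}(t,\mathbf{x})$, $i=1,\dots,N$, continuously differentiable in $t>0$ and twice continuously differentiable in $\mathbf{x}=(x_1,\dots,x_N)\in\mathbb{R}^N$, and there is a constant $K_N>0$ with $$|U^{i,N}_{x_j}(t,\mathbf{x})|\le K_N\Big(1+\sqrt{x_1^2+\dots+x_N^2}\Big),\qquad |U^{i,N}(t,\mathbf{x})|\le K_N\big(1+x_1^2+\dots+x_N^2\big)$$ for all $i,j\in\{1,\dots,N\}$, $t\in[0,T]$, $\mathbf{x}\in\mathbb{R}^N$. (A5) The Master equation of the context with terminal condition $U(T,x,m)=g(x,m)$ admits a solution $U=U(t,x,m)$ whose derivatives $U_t,U_x,U_m,U_{xx},U_{xm},U_{mx},U_{mm},U_{mz_1}$ exist and are continuous under the product topologies on the spaces on which they are defined; the derivatives $U_x,U_m,U_{xx},U_{xm}=U_{mx}$ and $U_{mm}$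 are bounded; and $U_{xmm}$ exists and is bounded. (B1) The classical first order derivatives $\hat f_x,\hat f_m$ exist, and the classical second order derivatives $\hat b_{xy},\hat b_{my},\hat f_{xy},\hat f_{my},\hat f_{yy}$ exist and are bounded. (B2) The derivatives $U^{i,N}_{x_{j_1}x_{j_2}x_{j_3}}$ for $j_1,j_2,j_3\in\{1,\dots,N\}$, and $U^{i,N}_{tx_j},U^{i,N}_{x_jt}$ for $j\in\{1,\dots,N\}$, exist and are continuous in $(t,\mathbf{x})$; the derivatives $U^{i,N}_{x_i}$ are bounded uniformly in $N$ and $i\in\{1,\dots,N\}$; and the derivatives $U^{i,N}_{x_ix_j}$ are bounded (not necessarily uniformly in $N$ and $i$). (B3) The derivatives $U_{xxx}$, $U_{xxm}$, $U_{xmx}$, $U_{mxx}$, $U_{mmx}$, $U_{mxm}$, $U_{xmm}$, $U_{mmm}$, $U_{xmz_1}$, $U_{mz_1x}$, $U_{mxz_1}$, $U_{mz_1z_1}$, $U_{mmz_1}$, $U_{mz_1m}$, $U_{mmz_2}$, as well as $U_{tx},U_{xt},U_{tm},U_{mt}$, exist and are continuous under the product topologies on the spaces on which they are defined; and $U_{mz_1},U_{xxm},U_{xmz_1},U_{mmm},U_{mmz_1},U_{mmz_2}$ are bounded. Then there is a deterministic constant $C>0$ such that, $\mathbb{P}$-almost surely, for all $t\in[0,T]$ and all $N\in\mathbb{N}$, the Nash states $X^{1,N,v^{N,*}},\dots,X^{N,N,v^{N,*}}$ satisfy $$\sum_{i=1}^N\Big\{\hat b\Big(X_t^{i,N,v^{N,*}},\mu_t^{N,v^{N,*}},U^{i,N}_{x_i}\big(t,X_t^{1,N,v^{N,*}},\dots,X_t^{N,N,v^{N,*}}\big)\Big)-\hat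 b\Big(X_t^{i,N,v^{N,*}},\mu_t^{N,v^{N,*}},U_x\big(t,X_t^{i,N,v^{N,*}},\mu_t^{N,v^{N,*}}\big)\Big)\Big\}^2\le\frac{C}{N}.$$
   Context: Measures. $\mathcal{P}(\mathbb{R})$ is the set of Borel probability measures on $\mathbb{R}$ (with finite first moment) equipped with the 1-Wasserstein metric $\mathcal{W}_1(m_1,m_2)=\inf\int_{\mathbb{R}\times\mathbb{R}}|x-y|\,\pi(dx,dy)$, the infimum being over couplings $\pi$ of $m_1,m_2$. For $\mathbf{x}=(x_1,\dots,x_N)$ write $\mu_{\mathbf{x}}^N=\frac1N\sum_{\ell=1}^N\delta_{x_\ell}$. Game setting. Fix $T>0$ and a filtered probability space $(\Omega,\mathcal{F},(\mathcal{F}_t)_{t\in[0,T]},\mathbb{P})$. Let $V\subset\mathbb{R}$, $b:\mathbb{R}\times\mathcal{P}(\mathbb{R})\times V\to\mathbb{R}$ (drift), $f:\mathbb{R}\times\mathcal{P}(\mathbb{R})\times V\to\mathbb{R}$ (running cost), $g:\mathbb{R}\times\mathcal{P}(\mathbb{R})\to\mathbb{R}$ (terminal cost), and $\sigma>0$. Let $(X_0^i)_{i\in\mathbb{N}}$ be independent $\mathcal{F}_0$-measurable random variables with law $\mu_0\in\mathcal{P}(\mathbb{R})$ and $(W^i)_{i\in\mathbb{N}}$ independent standard $\mathcal{F}_t$-Brownian motions, the two sequences being independent. In the $N$-player game player $i$ has state $X_t^{i}=X_0^i+\int_0^tb(X_s^{i},\mu_s,v_s^{i})ds+\sigma W_t^i$,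 where $\mu_s$ is the empirical measure of all $N$ states, and chooses a closed-loop ($V$-valued, function of time and of all current states) control $v^i$ to minimize $\mathbb{E}[\int_0^Tf(X_s^i,\mu_s,v_s^i)ds+g(X_T^i,\mu_T)]$. Optimized coefficients. With $\hat v(x,m,y)$ the minimizer over $v\in V$ of $b(x,m,v)y+f(x,m,v)$, set $\hat b(x,m,y)=b(x,m,\hat v(x,m,y))$ and $\hat f(x,m,y)=f(x,m,\hat v(x,m,y))$. $N$-player PDE system. For $i=1,\dots,N$, on $[0,T]\times\mathbb{R}^N$: $$0=U_t^{i,N}(t,\mathbf{x})+\min_{v\in V}\{b(x_i,\mu^N_{\mathbf{x}},v)U^{i,N}_{x_i}(t,\mathbf{x})+f(x_i,\mu^N_{\mathbf{x}},v)\}+\sum_{j\ne i}U^{i,N}_{x_j}(t,\mathbf{x})\,\hat b\big(x_j,\mu^N_{\mathbf{x}},U^{j,N}_{x_j}(t,\mathbf{x})\big)+\frac{\sigma^2}{2}\sum_{j=1}^NU^{i,N}_{x_jx_j}(t,\mathbf{x}),$$ with terminal conditions $U^{i,N}(T,\mathbf{x})=g(x_i,\mu^N_{\mathbf{x}})$. Nash states. $X^{i,N,v^{N,*}}$, $i=1,\dots,N$, are the states under the closed-loop Nash equilibrium $v_t^{i,N,*}=\hat v(X_t^{i,N,v^{N,*}},\mu_t^{N,v^{N,*}},U^{i,N}_{x_i}(t,X_t^{1,N,v^{N,*}},\dots,X_t^{N,N,v^{N,*}}))$, i.e. they solve $$X_t^{i,N,v^{N,*}}=X_0^i+\int_0^t\hat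 b\Big(X_s^{i,N,v^{N,*}},\mu_s^{N,v^{N,*}},U^{i,N}_{x_i}\big(s,X_s^{1,N,v^{N,*}},\dots,X_s^{N,N,v^{N,*}}\big)\Big)ds+\sigma W_t^i,\qquad t\in[0,T],$$ with $\mu_t^{N,v^{N,*}}=\frac1N\sum_{\ell=1}^N\delta_{X_t^{\ell,N,v^{N,*}}}$. Master equation. On $[0,T]\times\mathbb{R}\times\mathcal{P}(\mathbb{R})$: $$0=U_t(t,x,m)+\min_{v\in V}\{b(x,m,v)U_x(t,x,m)+f(x,m,v)\}+\frac{\sigma^2}{2}U_{xx}(t,x,m)+\int_{\mathbb{R}}U_m(t,x,m,z_1)\,\hat b\big(z_1,m,U_x(t,z_1,m)\big)m(dz_1)+\frac{\sigma^2}{2}\int_{\mathbb{R}}U_{mz_1}(t,x,m,z_1)m(dz_1),$$ with $U(T,x,m)=g(x,m)$. Derivatives. For a function $q$ of $m\in\mathcal{P}(\mathbb{R})$, $\frac{\delta q}{\delta m}(m,z)$ denotes the continuous function (of at most linear growth in $z$, uniformly for $m$ in compact sets) such that $\lim_{h\downarrow0}\frac{q(m+h(m'-m))-q(m)}{h}=\int_{\mathbb{R}}\frac{\delta q}{\delta m}(m,z)(m'-m)(dz)$ for all $m,m'$, normalized by $\int\frac{\delta q}{\delta m}(m,z)m(dz)=0$; the intrinsic derivative is $q_m(m,z)=\partial_z\frac{\delta q}{\delta m}(m,z)$. Each differentiation in $m$ adds a new real argument; these are called $z_1,z_2,\dots$ and are appended after the original arguments. Subscripts denote successive differentiation: for $\hat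 b,\hat f$, the subscripts $x,y$ refer to the first and third arguments; for $U$, the subscripts $t,x$ refer to the first and second arguments; subscripts $z_i$ refer to the added arguments. For instance, $U_{mm}=U_{mm}(t,x,m,z_1,z_2)$, and $U_{mmz_2}$ is its derivative in $z_2$. *)

(* Defs.v *)
From HB Require Import structures.
From mathcomp Require Import all_boot all_order all_algebra.
From mathcomp Require Import all_classical all_reals all_analysis.
From mathcomp Require Import measurable_realfun.

Set Implicit Arguments.
Unset Strict Implicit.
Unset Printing Implicit Defensive.

Import Order.TTheory GRing.Theory Num.Theory.
Import numFieldNormedType.Exports.

Local Open Scope classical_set_scope.
Local Open Scope ring_scope.

Record P1 (R : realType) := MkP1 {
  p1_prob :> probability (measurableTypeR R) R ;
  p1_moment : (\int[p1_prob]_x `|x|%:E < +oo)%E }.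

HB.instance Definition _ (R : realType) := gen_eqMixin (P1 R).
HB.instance Definition _ (R : realType) := gen_choiceMixin (P1 R).

Section wasserstein.
Variable R : realType.

Definition coupling (m1 m2 : P1 R) :
    set (probability (measurableTypeR R * measurableTypeR R)%type R) :=
  [set pi | forall A : set (measurableTypeR R), measurable A ->
     pi (A `*` setT) = m1 A /\ pi (setT `*` A) = m2 A].

Definition W1 (m1 m2 : P1 R) : \bar R :=
  ereal_inf [set (\int[pi]_p `|p.1 - p.2|%:E)%E | pi in coupling m1 m2].

Definition W1_open (O : set (P1 R)) :=
  forall m, O m -> exists2 e : R, 0 < e &
    forall m', (W1 m m' < e%:E)%E -> O m'.

Let W1_openT : W1_open setT.
Proof. by move=> m _; exists 1. Qed.

Let W1_openI : setI_closed W1_open.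
Proof.
move=> A B oA oB m [/oA[e e0 He] /oB[f f0 Hf]].
exists (Order.min e f) => [|m' lt]; first by rewrite lt_min e0 f0.
split; [apply: He | apply: Hf]; apply: (lt_le_trans lt);
  by rewrite lee_fin ge_min lexx ?orbT.
Qed.

Let W1_open_bigU (I : Type) (f : I -> set (P1 R)) :
  (forall i, W1_open (f i)) -> W1_open (\bigcup_i f i).
Proof.
move=> of_ m [i _ /of_[e e0 He]]; exists e => // m' /He fm'; by exists i.
Qed.

(* The topology of the metric W1, given by its open sets so that the triangle
   inequality is not needed to declare the instance. *)
HB.instance Definition _ :=
  isOpenTopological.Build (P1 R) W1_openT W1_openI W1_open_bigU.

End wasserstein.

Section empirical.
Variables (R : realType) (n : nat) (x : 'rV[R]_n.+1).

Let weight_ge0 : 0 <= n.+1%:R^-1 :> R. Proof. by rewrite invr_ge0 ler0n. Qed.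

Definition emp_fun : set (measurableTypeR R) -> \bar R :=
  mscale (NngNum weight_ge0)
    (msum (fun k => \d_(x 0 (inord k) : measurableTypeR R)) n.+1).

HB.instance Definition _ := Measure.on emp_fun.

Let emp_setT : emp_fun setT = 1%E.
Proof.
rewrite /emp_fun /mscale/= /msum.
rewrite (eq_bigr (fun=> 1%:E)); last by move=> i _; exact: diracT.
by rewrite sumEFin sumr_const card_ord -EFinM mulVf// pnatr_eq0.
Qed.

HB.instance Definition _ :=
  Measure_isProbability.Build _ _ _ emp_fun emp_setT.

Let emp_moment : (\int[emp_fun]_y `|y|%:E < +oo)%E.
Proof.
have mabs : measurable_fun [set: R] (fun y : R => `|y|%:E).
  by apply/measurable_EFinP; exact: normr_measurable.
rewrite ge0_integral_mscale// ge0_integral_measure_sum//.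
rewrite lte_mul_pinfty ?lee_fin//; apply: lte_sum_pinfty => i _.
by rewrite integral_dirac// diracT mul1e ltry.
Qed.

(* N = n.+1 points: there is no empirical measure of zero points. *)
Definition emp : P1 R := @MkP1 R emp_fun emp_moment.

End empirical.

Section mixture.
Variables (R : realType) (m m' : P1 R) (h : R).

Let c : R := Num.min 1 (Num.max 0 h).
Let c_ge0 : 0 <= c. Proof. by rewrite /c le_min ler01 le_max lexx. Qed.
Let onem_c_ge0 : 0 <= 1 - c. Proof. by rewrite subr_ge0 /c ge_min lexx. Qed.

Definition mixture_fun : set (measurableTypeR R) -> \bar R :=
  measure_add (mscale (NngNum onem_c_ge0) m) (mscale (NngNum c_ge0) m').

HB.instance Definition _ := Measure.on mixture_fun.

Let mixture_setT : mixture_fun setT = 1%E.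
Proof.
rewrite /mixture_fun measure_addE; transitivity ((1 - c)%:E * 1 + c%:E * 1)%E.
  by congr (_ * _ + _ * _)%E; exact: probability_setT.
by rewrite !mule1 -EFinD subrK.
Qed.

HB.instance Definition _ :=
  Measure_isProbability.Build _ _ _ mixture_fun mixture_setT.

Let mixture_moment : (\int[mixture_fun]_y `|y|%:E < +oo)%E.
Proof.
have mabs : measurable_fun [set: R] (fun y : R => `|y|%:E).
  by apply/measurable_EFinP; exact: normr_measurable.
rewrite ge0_integral_measure_add// !ge0_integral_mscale//.
by rewrite lte_add_pinfty// lte_mul_pinfty ?lee_fin//; exact: p1_moment.
Qed.

(* m + h (m' - m) for 0 <= h <= 1; h is clamped to [0, 1] so that the mixture
   is defined for every real h. *)
Definition mixture : P1 R := @MkP1 R mixture_fun mixture_moment.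

End mixture.

Section measure_derivative.
Variable R : realType.
Implicit Types (q : P1 R -> R) (d : P1 R -> R -> R).

Definition is_flat_derivative q d :=
  [/\ continuous (fun p : P1 R * R => d p.1 p.2),
      forall K : set (P1 R), compact K -> exists C : R,
        forall m z, K m -> `|d m z| <= C * (1 + `|z|),
      forall m m' : P1 R, (q (mixture m m' h) - q m) / h @[h --> 0^'+] -->
        \int[m']_z d m z - \int[m]_z d m z
    & forall m : P1 R, \int[m]_z d m z = 0].

(* The normalization makes the flat derivative unique when it exists. *)
Definition flat_derivative q : P1 R -> R -> R :=
  xget (fun _ _ => 0) [set d | is_flat_derivative q d].

Definition mderivable q := exists2 d, is_flat_derivative q d &
  forall m z, derivable (d m) z 1.

Definition mderive q (m : P1 R) (z : R) : R := derive1 (flat_derivative q m) z.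

End measure_derivative.

Section time_derivative.
Variables (R : realType) (T : R).

(* Difference quotients within [0, T]: one-sided at the endpoints. *)
Definition tderivable (f : R -> R) (t : R) :=
  cvg ((f s - f t) / (s - t) @[s --> within `[0, T] (t^')]).

Definition tderive (f : R -> R) (t : R) : R :=
  lim ((f s - f t) / (s - t) @[s --> within `[0, T] (t^')]).

End time_derivative.

Section mfields.
Variables (R : realType) (T : R).

(* Functions of (t, x, m, z_1, ..., z_k). *)
Definition mfield k := R -> R -> P1 R -> 'rV[R]_k -> R.

Definition mfield0 (U : R -> R -> P1 R -> R) : mfield 0 := fun t x m _ => U t x m.

Definition dt k (F : mfield k) : mfield k :=
  fun t x m z => tderive T (fun s => F s x m z) t.
Definition dx k (F : mfield k) : mfield k :=
  fun t x m z => derive1 (fun y => F t y m z) x.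
(* The new argument is appended, in last position. *)
Definition dm k (F : mfield k) : mfield k.+1 :=
  fun t x m z =>
    mderive (fun m' => F t x m' (col' ord_max z)) m (z 0 ord_max).
Definition dz k (i : 'I_k.+1) (F : mfield k.+1) : mfield k.+1 :=
  fun t x m z => 'D_(delta_mx 0 i) (F t x m) z.

Definition ex_dt k (F : mfield k) := forall t x m z, t \in `[0, T] ->
  tderivable T (fun s => F s x m z) t.
Definition ex_dx k (F : mfield k) := forall t x m z, t \in `[0, T] ->
  derivable (fun y => F t y m z) x 1.
Definition ex_dm k (F : mfield k) := forall t x z, t \in `[0, T] ->
  mderivable (fun m => F t x m z).
Definition ex_dz k (i : 'I_k.+1) (F : mfield k.+1) :=
  forall t x m z, t \in `[0, T] ->
  derivable (F t x m) z (delta_mx 0 i).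

Definition mfield_continuous k (F : mfield k) :=
  {within [set p : R * R * P1 R * 'rV[R]_k | p.1.1.1 \in `[0, T]],
    continuous (fun p => F p.1.1.1 p.1.1.2 p.1.2 p.2)}.

Definition mfield_bounded k (F : mfield k) :=
  exists K : R, forall t x m z, t \in `[0, T] -> `|F t x m z| <= K.

(* The derivative exists and is continuous. *)
Definition cdt k (F : mfield k) := ex_dt F /\ mfield_continuous (dt F).
Definition cdx k (F : mfield k) := ex_dx F /\ mfield_continuous (dx F).
Definition cdm k (F : mfield k) := ex_dm F /\ mfield_continuous (dm F).
Definition cdz k (i : 'I_k.+1) (F : mfield k.+1) :=
  ex_dz i F /\ mfield_continuous (dz i F).

End mfields.

Section coefficients.
Variable R : realType.
Implicit Types (F : R -> P1 R -> R -> R) (G : R -> P1 R -> R -> R -> R).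

(* Functions F of (x, m, y). *)
Definition coef_x F : R -> P1 R -> R -> R :=
  fun x m y => derive1 (fun u => F u m y) x.
Definition coef_y F : R -> P1 R -> R -> R :=
  fun x m y => derive1 (F x m) y.
Definition coef_m F : R -> P1 R -> R -> R -> R :=
  fun x m y z1 => mderive (fun m' => F x m' y) m z1.
Definition coef_my F : R -> P1 R -> R -> R -> R :=
  fun x m y z1 => derive1 (fun u => coef_m F x m u z1) y.

Definition ex_coef_x F := forall x m y, derivable (fun u => F u m y) x 1.
Definition ex_coef_y F := forall x m y, derivable (F x m) y 1.
Definition ex_coef_m F := forall x y, mderivable (fun m => F x m y).
Definition ex_coef_my F := ex_coef_m F /\
  forall x m y z1, derivable (fun u => coef_m F x m u z1) y 1.

Definition coef_bounded F := exists K : R, forall x m y, `|F x m y| <= K.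
Definition coefm_bounded G := exists K : R, forall x m y z1, `|G x m y z1| <= K.

Variables (V : set R) (b f : R -> P1 R -> R -> R) (vhat : R -> P1 R -> R -> R).

Definition is_minimizer := forall x m y, V (vhat x m y) /\
  forall v, V v ->
    b x m (vhat x m y) * y + f x m (vhat x m y) <= b x m v * y + f x m v.

(* The infimum is attained, at vhat x m y, under is_minimizer. *)
Definition min_hamiltonian (x : R) (m : P1 R) (y : R) : R :=
  inf [set b x m v * y + f x m v | v in V].

Definition optimized (c : R -> P1 R -> R -> R) : R -> P1 R -> R -> R :=
  fun x m y => c x m (vhat x m y).

Variables bhat fhat : R -> P1 R -> R -> R.

Record coef_regularity : Prop := {
  cr_b_x : ex_coef_x bhat /\ coef_bounded (coef_x bhat) ;
  cr_b_m : ex_coef_m bhat /\ coefm_bounded (coef_m bhat) ;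
  cr_b_y : ex_coef_y bhat /\ coef_bounded (coef_y bhat) ;
  cr_f_y : ex_coef_y fhat /\ coef_bounded (coef_y fhat) ;
  cr_b_yy : ex_coef_y (coef_y bhat) /\ coef_bounded (coef_y (coef_y bhat)) }.

Record coef_higher_regularity : Prop := {
  cr_f_x : ex_coef_x fhat ;
  cr_f_m : ex_coef_m fhat ;
  cr_b_xy : ex_coef_y (coef_x bhat) /\ coef_bounded (coef_y (coef_x bhat)) ;
  cr_b_my : ex_coef_my bhat /\ coefm_bounded (coef_my bhat) ;
  cr_f_xy : ex_coef_y (coef_x fhat) /\ coef_bounded (coef_y (coef_x fhat)) ;
  cr_f_my : ex_coef_my fhat /\ coefm_bounded (coef_my fhat) ;
  cr_f_yy : ex_coef_y (coef_y fhat) /\ coef_bounded (coef_y (coef_y fhat)) }.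

End coefficients.

Section nplayer.
Variables (R : realType) (T sigma : R) (n : nat).
Implicit Types (G : R -> 'rV[R]_n.+1 -> R).

(* Functions of (t, x_1, ..., x_N), with N = n.+1. *)
Definition pd (j : 'I_n.+1) G : R -> 'rV[R]_n.+1 -> R :=
  fun t x => 'D_(delta_mx 0 j) (G t) x.
Definition pt G : R -> 'rV[R]_n.+1 -> R :=
  fun t x => tderive T (fun s => G s x) t.

Definition ex_pd (D : interval R) (j : 'I_n.+1) G :=
  forall t x, t \in D -> derivable (G t) x (delta_mx 0 j).
Definition ex_pt (D : interval R) G :=
  forall t x, t \in D -> tderivable T (fun s => G s x) t.

Definition continuous_on (D : interval R) G :=
  {within [set p : R * 'rV[R]_n.+1 | p.1 \in D],
    continuous (fun p => G p.1 p.2)}.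

Variables (V : set R) (b f : R -> P1 R -> R -> R) (bhat : R -> P1 R -> R -> R).
Variable g : R -> P1 R -> R.
Variable Un : 'I_n.+1 -> R -> 'rV[R]_n.+1 -> R.

(* Time derivatives are only required on ]0, T]; at t = 0 the equation then
   holds in the limit, with the right derivative. *)
Record nplayer_solution : Prop := {
  np_continuous : forall i, continuous_on `[0, T] (Un i) ;
  np_t : forall i, ex_pt `]0, T] (Un i) /\ continuous_on `]0, T] (pt (Un i)) ;
  np_x : forall i j,
    ex_pd `[0, T] j (Un i) /\ continuous_on `[0, T] (pd j (Un i)) ;
  np_xx : forall i j k, ex_pd `[0, T] k (pd j (Un i)) /\
    continuous_on `[0, T] (pd k (pd j (Un i))) ;
  np_pde : forall i t x, t \in `]0, T] ->
    0 = pt (Un i) t x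
      + min_hamiltonian V b f (x 0 i) (emp x) (pd i (Un i) t x)
      + \sum_(j | j != i)
          pd j (Un i) t x * bhat (x 0 j) (emp x) (pd j (Un j) t x)
      + sigma ^+ 2 / 2 * \sum_j pd j (pd j (Un i)) t x ;
  np_terminal : forall i x, Un i T x = g (x 0 i) (emp x) }.

Definition nplayer_growth := exists2 K : R, 0 < K &
  forall i j t x, t \in `[0, T] ->
    `|pd j (Un i) t x| <= K * (1 + Num.sqrt (\sum_l x 0 l ^+ 2)) /\
    `|Un i t x| <= K * (1 + \sum_l x 0 l ^+ 2).

Record nplayer_higher_regularity : Prop := {
  np_xxx : forall i j1 j2 j3,
    ex_pd `[0, T] j3 (pd j2 (pd j1 (Un i))) /\
    continuous_on `[0, T] (pd j3 (pd j2 (pd j1 (Un i)))) ;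
  np_tx : forall i j, ex_pd `]0, T] j (pt (Un i)) /\
    continuous_on `]0, T] (pd j (pt (Un i))) ;
  np_xt : forall i j, ex_pt `]0, T] (pd j (Un i)) /\
    continuous_on `]0, T] (pt (pd j (Un i))) ;
  np_xx_bounded : forall i j, exists K : R, forall t x, t \in `[0, T] ->
    `|pd j (pd i (Un i)) t x| <= K }.

End nplayer.

Section master.
Variables (R : realType) (T sigma : R) (V : set R).
Variables (b f bhat : R -> P1 R -> R -> R) (g : R -> P1 R -> R).
Variable U : R -> R -> P1 R -> R.

Let u := mfield0 U.
Let z1 : 'I_1 := ord0.
Let z1of2 : 'I_2 := ord0.
Let z2of2 : 'I_2 := ord_max.

Definition master_equation :=
  (forall t x (m : P1 R), t \in `[0, T] ->
    0 = dt T u t x m 0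
      + min_hamiltonian V b f x m (dx u t x m 0)
      + sigma ^+ 2 / 2 * dx (dx u) t x m 0
      + \int[m]_z (dm u t x m (const_mx z) * bhat z m (dx u t z m 0))
      + sigma ^+ 2 / 2 * \int[m]_z dz z1 (dm u) t x m (const_mx z)) /\
  (forall x m, U T x m = g x m).

Record master_regularity : Prop := {
  me_t : cdt T u ;
  me_x : cdx T u ;
  me_m : cdm T u ;
  me_xx : cdx T (dx u) ;
  me_xm : cdm T (dx u) ;
  me_mx : cdx T (dm u) ;
  me_mm : cdm T (dm u) ;
  me_mz1 : cdz T z1 (dm u) ;
  me_x_bounded : mfield_bounded T (dx u) ;
  me_m_bounded : mfield_bounded T (dm u) ;
  me_xx_bounded : mfield_bounded T (dx (dx u)) ;
  me_xm_bounded : mfield_bounded T (dm (dx u)) ;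
  me_xm_mx : forall t x m z, t \in `[0, T] ->
    dm (dx u) t x m z = dx (dm u) t x m z ;
  me_mm_bounded : mfield_bounded T (dm (dm u)) ;
  me_ex_xmm : ex_dm T (dm (dx u)) ;
  me_xmm_bounded : mfield_bounded T (dm (dm (dx u))) }.

Record master_higher_regularity : Prop := {
  me_xxx : cdx T (dx (dx u)) ;
  me_xxm : cdm T (dx (dx u)) ;
  me_xmx : cdx T (dm (dx u)) ;
  me_mxx : cdx T (dx (dm u)) ;
  me_mmx : cdx T (dm (dm u)) ;
  me_mxm : cdm T (dx (dm u)) ;
  me_xmm : cdm T (dm (dx u)) ;
  me_mmm : cdm T (dm (dm u)) ;
  me_xmz1 : cdz T z1 (dm (dx u)) ;
  me_mz1x : cdx T (dz z1 (dm u)) ;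
  me_mxz1 : cdz T z1 (dx (dm u)) ;
  me_mz1z1 : cdz T z1 (dz z1 (dm u)) ;
  me_mmz1 : cdz T z1of2 (dm (dm u)) ;
  me_mz1m : cdm T (dz z1 (dm u)) ;
  me_mmz2 : cdz T z2of2 (dm (dm u)) ;
  me_tx : cdx T (dt T u) ;
  me_xt : cdt T (dx u) ;
  me_tm : cdm T (dt T u) ;
  me_mt : cdt T (dm u) ;
  me_mz1_bounded : mfield_bounded T (dz z1 (dm u)) ;
  me_xxm_bounded : mfield_bounded T (dm (dx (dx u))) ;
  me_xmz1_bounded : mfield_bounded T (dz z1 (dm (dx u))) ;
  me_mmm_bounded : mfield_bounded T (dm (dm (dm u))) ;
  me_mmz1_bounded : mfield_bounded T (dz z1of2 (dm (dm u))) ;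
  me_mmz2_bounded : mfield_bounded T (dz z2of2 (dm (dm u))) }.

End master.

Section probability_setting.
Variables (R : realType) (T : R) (d : measure_display) (Omega : measurableType d).
Variable P : probability Omega R.
Implicit Types (Ft : R -> set (set Omega)) (Y : Omega -> R).

Definition is_filtration Ft :=
  (forall t, t \in `[0, T] ->
    sigma_algebra setT (Ft t) /\ Ft t `<=` measurable) /\
  (forall s t, 0 <= s -> s <= t -> t <= T -> Ft s `<=` Ft t).

Definition measurable_wrt (H : set (set Omega)) Y :=
  forall B : set (measurableTypeR R), measurable B -> H (Y @^-1` B).

Definition sigma_generated (I : Type) (D : set I) (Y : I -> Omega -> R) :=
  <<s [set A | exists2 i, D i & exists2 B : set (measurableTypeR R),
                 measurable B & A = Y i @^-1` B] >>.

Definition mutually_independent (I : eqType) (H : I -> set (set Omega)) :=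
  forall (s : seq I) (A : I -> set Omega), uniq s ->
    (forall i, i \in s -> H i (A i)) ->
    P (\big[setI/setT]_(i <- s) A i) = (\prod_(i <- s) P (A i))%E.

Definition independent2 (H1 H2 : set (set Omega)) :=
  forall A B, H1 A -> H2 B -> P (A `&` B) = (P A * P B)%E.

Record is_brownian Ft (W : R -> Omega -> R) : Prop := {
  bm_adapted : forall t, t \in `[0, T] -> measurable_wrt (Ft t) (W t) ;
  bm_start : {ae P, forall w, W 0 w = 0} ;
  bm_continuous : {ae P, forall w, {within `[0, T], continuous (W ^~ w)}} ;
  bm_independent : forall s t, 0 <= s -> s < t -> t <= T ->
    independent2 (Ft s) (sigma_generated [set: unit] (fun _ => W t \- W s)) ;
  bm_gaussian : forall s t, 0 <= s -> s < t -> t <= T ->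
    forall B : set (measurableTypeR R), measurable B ->
      P ((W t \- W s) @^-1` B) = normal_prob 0 (Num.sqrt (t - s)) B }.

Record noise_setting Ft (mu0 : P1 R) (X0 : nat -> Omega -> R)
    (W : nat -> R -> Omega -> R) : Prop := {
  ns_X0_F0 : forall i, measurable_wrt (Ft 0) (X0 i) ;
  ns_X0_law : forall i (B : set (measurableTypeR R)), measurable B ->
    P (X0 i @^-1` B) = mu0 B ;
  ns_X0_independent :
    mutually_independent (fun i => sigma_generated [set i] X0) ;
  ns_W_brownian : forall i, is_brownian Ft (W i) ;
  ns_W_independent :
    mutually_independent (fun i => sigma_generated `[0, T] (W i)) ;
  ns_X0_W_independent : independent2 (sigma_generated [set: nat] X0)
    (sigma_generated [set p | p.2 \in `[0, T]] (fun p : nat * R => W p.1 p.2)) }.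

Definition finite_moment_above4 (mu0 : P1 R) :=
  exists2 p : R, 4 < p & (\int[mu0]_x (`|x| `^ p)%:E < +oo)%E.

(* X t w is the row of the states of the n.+1 players at time t. *)
Record nash_states Ft (sigma : R) (bhat : R -> P1 R -> R -> R)
    (X0 : nat -> Omega -> R) (W : nat -> R -> Omega -> R) (n : nat)
    (Un : 'I_n.+1 -> R -> 'rV[R]_n.+1 -> R)
    (X : R -> Omega -> 'rV[R]_n.+1) : Prop := {
  nash_adapted : forall i t, t \in `[0, T] ->
    measurable_wrt (Ft t) (fun w => X t w 0 i) ;
  nash_continuous : {ae P, forall w, forall i,
    {within `[0, T], continuous (fun t => X t w 0 i)}} ;
  nash_sde : {ae P, forall w, forall i t, t \in `[0, T] ->
    let drift s := bhat (X s w 0 i) (emp (X s w)) (pd i (Un i) s (X s w)) in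
    lebesgue_measure.-integrable `[0, t] (EFin \o drift) /\
    X t w 0 i = X0 i w + \int[lebesgue_measure]_(s in `[0, t]) drift s
              + sigma * W i t w} }.

End probability_setting.

(* Main.v *)
(* Everything is proved pointwise, for a fixed number N of players and at every point of
   [0, T] x R^N; the Nash states only enter through the point at which the estimate is taken.

   Let v^i(t, x) = U(t, x_i, mu_x) be the projection of the solution of the master equation,
   D^i = U^{i,N} - v^i and w^i = d_i D^i. The master equation makes v^i a solution of the
   N-player system up to a term of order 1/N, so D^i solves a linear parabolic equation with
   right-hand side of order 1/N + |w^i| + (1/N) sum_j |w^j|. Differentiating it along x_i gives
   an equation for w^i, whose right-hand side contains in addition |d_i w^i| |w^i|,
   |d_j D^i| (1/N + |d_i w^j|) and (1/N) |d_i w^j|. The derivatives of b^ are bounded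
   but not assumed continuous, so the terms of the right-hand side need not be differentiable
   along x_i; their rate of change can still be bounded, which is enough. The minimized
   Hamiltonian is differentiable in y with derivative b^ by the envelope theorem.

   In the energy Phi = sum_i (lam (D^i)^2 + (w^i)^2), with lam large, all first order terms are
   absorbed by the Laplacian, which leaves L Phi + kap Phi >= - c/N. As Phi vanishes at time T and
   grows polynomially, the maximum principle gives sum_i (w^i)^2 <= C/N, and b^ is Lipschitz in y
   while U^{i,N}_{x_i} - U_x(t, x_i, mu_x) = w^i + (1/N) U_m(t, x_i, mu_x, x_i). *)

Require Import Defs.
From HB Require Import structures.
From mathcomp Require Import all_boot all_order all_algebra.
From mathcomp Require Import all_classical all_reals all_analysis.
From mathcomp Require Import measurable_realfun.
From mathcomp Require Import ring lra.

Set Implicit Arguments.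
Unset Strict Implicit.
Unset Printing Implicit Defensive.

Import Order.TTheory GRing.Theory Num.Theory.
Import numFieldNormedType.Exports.

Local Open Scope classical_set_scope.
Local Open Scope ring_scope.

(** * Derivatives along lines *)

Section one_variable.
Variable R : realType.
Implicit Types (f g : R -> R) (c l : R).

(** The key to differentiating without derivatives of b^ along x_i: [difference_equation] holds with
    arbitrary numbers [be j] as transport coefficients. Freezing them at the values of the drift at
    one point x and differentiating along x_i gives exactly the parabolic operator applied to w^i at
    x, and each product of d_j D^i with a drift increment vanishes at x, so that only the local
    Lipschitz constant ([slope]) of the increment enters and the slope of d_j D^i drops out. The
    difference of two Hamiltonians is (w^i + h^i) times a mean slope, with h^i = U_m(t, x_i, mu_x,
    x_i)/N; the mean slope is as Lipschitz as b^.

    The weight lam is forced by the term |w^i| |d_j D^i| |d_i w^j|: as |w^i| <= M uniformly in N,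
    Young's inequality leaves a multiple of |d_j D^i|^2, which the gradient term of lam (D^i)^2 pays
    for. The part in d_i w^j is paid by the energy of player j, so the balance closes only after
    summing over both indices. The inhomogeneity is of order N^-3 for each of N^2 pairs, hence the
    bound of order 1/N. *)

Lemma is_derive_line (V : normedModType R) (F : V -> R) (x v : V) s l :
  is_derive (x + s *: v) v F l <-> is_derive s 1 (fun r => F (x + r *: v)) l.
Proof.
have E : (fun h => h^-1 *: ((F \o shift (x + s *: v)) (h *: v) - F (x + s *: v)))
  = (fun h => h^-1 *: (((fun r => F (x + r *: v)) \o shift s) (h *: (1:R)) - F (x + s *: v))).
  apply/funext => h /=; congr (_ *: (F _ - _)).
  by rewrite [h *: 1]mulr1 addrCA -scalerDl.
split=> -[h1 h2]; split.
- by rewrite /derivable -E.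
- by rewrite /derive -E.
- by rewrite /derivable E.
- by rewrite /derive E.
Qed.

Lemma is_derive_line0 (V : normedModType R) (F : V -> R) (x v : V) l :
  is_derive x v F l <-> is_derive (0 : R) 1 (fun r => F (x + r *: v)) l.
Proof. by rewrite -is_derive_line scale0r addr0. Qed.

Lemma is_derive_continuous f (x l : R) : is_derive x 1 f l -> {for x, continuous f}.
Proof. by move=> [h _]; apply: differentiable_continuous; apply/derivable1_diffP. Qed.

Lemma mean_value f (df : R -> R) (a b : R) :
  (forall x : R, `|x - a| <= `|b - a| -> is_derive x 1 f (df x)) ->
  exists2 c, `|c - a| <= `|b - a| & f b - f a = df c * (b - a).
Proof.
move=> H.
have [ab|ba] := leP a b.
  have [||c cab E] := @MVT_segment R f df a b ab.
  - move=> x; rewrite in_itv/= => /andP[ax xb]; apply: H.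
    by rewrite !ger0_norm ?subr_ge0 // ?lerD2r; apply: ltW.
  - apply: continuous_in_subspaceT => x; rewrite inE/= in_itv/= => /andP[ax xb].
    apply: (@is_derive_continuous f x (df x)); apply: H.
    by rewrite !ger0_norm ?subr_ge0 // ?lerD2r.
  - exists c => //; move: cab; rewrite in_itv/= => /andP[ac cb].
    by rewrite !ger0_norm ?subr_ge0 // ?lerD2r.
have nrm x : b <= x -> x <= a -> `|x - a| <= `|b - a|.
  by move=> bx xa; rewrite !ler0_norm ?subr_le0 ?(ltW ba)// lerN2 lerD2r.
have [||c cab E] := @MVT_segment R f df b a (ltW ba).
- by move=> x; rewrite in_itv/= => /andP[ax xb]; apply: H; apply: nrm; apply: ltW.
- apply: continuous_in_subspaceT => x; rewrite inE/= in_itv/= => /andP[ax xb].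
  by apply: (@is_derive_continuous f x (df x)); apply: H; apply: nrm.
- exists c; last by rewrite -opprB E -mulrN opprB.
  by move: cab; rewrite in_itv/= => /andP[ac cb]; apply: nrm.
Qed.

Lemma near0P (P : set R) :
  (\forall s \near 0, P s) <-> exists2 e : R, 0 < e & forall s, `|s| < e -> P s.
Proof.
split=> [/nbhs_ballP[e e0 H]|[e e0 H]].
  by exists e => // s se; apply: H; rewrite /ball/= sub0r normrN.
by apply/nbhs_ballP; exists e => // s; rewrite /ball/= sub0r normrN; apply: H.
Qed.


Lemma near0I (P Q : set R) :
  (\forall s \near 0, P s) -> (\forall s \near 0, Q s) ->
  exists2 e : R, 0 < e & forall s, `|s| < e -> P s /\ Q s.
Proof. by move=> p q; apply/near0P; apply: filterI. Qed.

Lemma near0S2 (P Q Z : set R) : (forall s, P s -> Q s -> Z s) ->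
  (\forall s \near 0, P s) -> (\forall s \near 0, Q s) ->
  \forall s \near 0, Z s.
Proof. exact: filterS2. Qed.

Lemma near00P (P : set (R * R)) :
  (\forall p \near ((0, 0) : R * R), P p) <->
  exists2 e : R, 0 < e & forall s r, `|s| < e -> `|r| < e -> P (s, r).
Proof.
split=> [/nbhs_ballP[e e0 H]|[e e0 H]].
  by exists e => // s r se re; apply: H; split; rewrite /ball/= sub0r normrN.
apply/nbhs_ballP; exists e => // -[s r] [].
by rewrite /ball/= !sub0r !normrN; apply: H.
Qed.

Lemma is_derive0P f l :
  is_derive (0 : R) 1 f l <->
  (forall e : R, 0 < e -> \forall s \near 0, `|f s - f 0 - l * s| <= e * `|s|).
Proof.
split=> [[/derivable_nbhs H <-] e e0|H].
  move: H => /eqaddoP/(_ e e0); apply: filterS => s /=.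
  change (`|f (s *: (1 : R) + 0) - (f 0 + s * 'D_1 f 0)| <= e * `|s| -> `|f s - f 0 - 'D_1 f 0 * s| <= e * `|s|).
  by rewrite addr0 [s *: 1]mulr1 [s * _]mulrC opprD addrA.
suff C : (fun h => h^-1 *: ((f \o shift 0) (h *: (1:R)) - f 0)) @ 0^' --> l.
  by split; [apply/cvg_ex; exists l|apply/cvg_lim].
apply/cvgrPdist_le => e e0; rewrite near_withinE.
have := H e e0; apply: filterS => s /= Hs s0.
rewrite addr0 [s *: 1]mulr1 [_ *: _]mulrC -[l](@mulfK _ s)// -mulrBl normrM normfV.
by rewrite ler_pdivrMr ?normr_gt0// -normrN opprB.
Qed.

(* [f] has local Lipschitz constant at most [c + e] at 0 for every [e > 0]. *)
Definition slope f c :=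
  forall e : R, 0 < e -> \forall s \near 0, `|f s - f 0| <= (c + e) * `|s|.

Lemma is_derive_slope f l : is_derive (0 : R) 1 f l -> slope f `|l|.
Proof.
move=> /is_derive0P H e e0; have := H e e0; apply: filterS => s Hs.
rewrite mulrDl -normrM -(subrK (l * s) (f s - f 0)) addrC.
by rewrite (le_trans (ler_normD _ _))// lerD2l.
Qed.

Lemma slope_le f c c' : c <= c' -> slope f c -> slope f c'.
Proof.
move=> cc H e e0; have := H e e0; apply: filterS => s /le_trans; apply.
by apply: ler_wpM2r => //; rewrite lerD2r.
Qed.

(** The way back from slopes to derivatives: a sum that is differentiable as a whole gets a bound on
    its derivative from the slopes of summands that need not be differentiable. *)
Lemma slope_derive_le f l c : is_derive (0 : R) 1 f l -> slope f c -> `|l| <= c.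
Proof.
move=> /is_derive0P H S; apply/ler_addgt0Pr => e e0.
have e20 : 0 < e / 2 by rewrite divr_gt0.
have [d d0 K] := near0I (H _ e20) (S _ e20).
have d20 : 0 < d / 2 by rewrite divr_gt0.
have [|/= K1 K2] := K (d / 2); first by rewrite gtr0_norm// gtr_pMr// invf_lt1// ltr1n.
rewrite -(ler_pM2r (_ : 0 < `|d / 2|)) ?normr_gt0 ?gt_eqF// -normrM.
have -> : l * (d / 2) = (f (d / 2) - f 0) - (f (d / 2) - f 0 - l * (d / 2)) by ring.
rewrite (le_trans (ler_normB _ _))// (le_trans (lerD K2 K1))// -mulrDl.
by apply: ler_wpM2r => //; lra.
Qed.

Lemma slope_ge0 f c : slope f c -> 0 <= c.
Proof.
move=> S; apply/ler_addgt0Pr => e e0.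
have /near0P[d d0 K] := S e e0.
have d20 : 0 < d / 2 by rewrite divr_gt0.
have /K : `|d / 2| < d by rewrite gtr0_norm// gtr_pMr// invf_lt1// ltr1n.
move=> /= K1; have := le_trans (normr_ge0 _) K1; rewrite pmulr_lge0// normr_gt0 gt_eqF//.
Qed.

Lemma slope_cst (a : R) : slope (fun=> a) 0.
Proof. by move=> e e0; near=> s; rewrite subrr normr0 mulr_ge0// add0r ltW.
Unshelve. all: by end_near. Qed.

Lemma slopeD f g c d : slope f c -> slope g d -> slope (fun s => f s + g s) (c + d).
Proof.
move=> F G e e0; have e20 : 0 < e / 2 by rewrite divr_gt0.
apply: (near0S2 _ (F _ e20) (G _ e20)) => s H1 H2.
rewrite opprD addrACA (le_trans (ler_normD _ _))// (le_trans (lerD H1 H2))//.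
by rewrite -mulrDl ler_wpM2r//; lra.
Qed.

Lemma slopeN f c : slope f c -> slope (fun s => - f s) c.
Proof.
move=> F e e0; have := F _ e0; apply: filterS => s.
by rewrite -opprD normrN.
Qed.

Lemma slopeB f g c d : slope f c -> slope g d -> slope (fun s => f s - g s) (c + d).
Proof. by move=> F G; apply: slopeD => //; apply: slopeN. Qed.

Lemma slope_sum (I : Type) (r : seq I) (P : pred I) (F : I -> R -> R) (c : I -> R) :
  (forall i, P i -> slope (F i) (c i)) ->
  slope (fun s => \sum_(i <- r | P i) F i s) (\sum_(i <- r | P i) c i).
Proof.
move=> H; elim: r => [|i r IH].
  rewrite big_nil (_ : (fun _ => _) = fun=> 0); first exact: slope_cst.
  by apply/funext => s; rewrite big_nil.
rewrite big_cons (_ : (fun _ => _) = fun s =>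
  if P i then F i s + \sum_(j <- r | P j) F j s else \sum_(j <- r | P j) F j s).
  by case: ifPn => // Pi; apply: slopeD => //; apply: H.
by apply/funext => s; rewrite big_cons.
Qed.

Lemma slope_cvg f c : slope f c -> f @ 0 --> f 0.
Proof.
move=> S; apply/cvgrPdist_le => e e0.
have c0 := slope_ge0 S; have /near0P[d d0 K] := S 1 ltr01.
apply/near0P; exists (Num.min d (e / (c + 1))); first by rewrite lt_min d0 divr_gt0// ltr_wpDl.
move=> s; rewrite lt_min => /andP[sd se]; rewrite -normrN opprB (le_trans (K _ sd))//.
by rewrite mulrC -ler_pdivlMr ?ltr_wpDl// ltW.
Qed.

Lemma slopeM f g c d : slope f c -> slope g d ->
  slope (fun s => f s * g s) (`|f 0| * d + c * `|g 0|).
Proof.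
move=> F G e e0.
have c0 := slope_ge0 F; have d0 := slope_ge0 G.
(* [M] dominates the factor of [h] in the cross terms, so [h = min 1 (e / M)] keeps them below
   [e]. *)
set M := `|f 0| + `|g 0| + c + d + 2.
have M0 : 0 < M by rewrite /M ltr_wpDl// !addr_ge0.
set h := Num.min 1 (e / M); have h0 : 0 < h by rewrite lt_min ltr01 divr_gt0.
have cf := slope_cvg F.
refine (filterS3 _ _ (F h h0) (G h h0) (@cvgr_dist_le _ _ _ _ _ f _ cf h h0)) => s H1 H2 H3.
have -> : f s * g s - f 0 * g 0 = f s * (g s - g 0) + (f s - f 0) * g 0 by ring.
rewrite (le_trans (ler_normD _ _))// !normrM.
have fs : `|f s| <= `|f 0| + h.
  rewrite -[f s](subrK (f 0)) addrC (le_trans (ler_normD _ _))// lerD2l.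
  by rewrite -normrN opprB.
have hM : h * M <= e by rewrite -ler_pdivlMr// ge_min lexx orbT.
have h1 : h <= 1 by rewrite ge_min lexx.
have A : `|f s| * `|g s - g 0| <= (`|f 0| + h) * ((d + h) * `|s|).
  by apply: ler_pM.
have B : `|f s - f 0| * `|g 0| <= (c + h) * `|s| * `|g 0| by apply: ler_wpM2r.
apply: (le_trans (lerD A B)).
rewrite [X in X <= _](_ : _ = ((`|f 0| + h) * (d + h) + (c + h) * `|g 0|) * `|s|); last by ring.
apply: ler_wpM2r => //.
suff : h * h <= h by move: hM; rewrite /M; nra.
by rewrite ger_pMr.
Qed.

(** Replaces the chain rule when the outer function is merely Lipschitz. *)
Lemma slope_Lip (I : Type) (r : seq I) (K : I -> R) (F : I -> R -> R) (c : I -> R) f :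
  (forall i, 0 <= K i) -> (forall i, slope (F i) (c i)) ->
  (forall s, `|f s - f 0| <= \sum_(i <- r) K i * `|F i s - F i 0|) ->
  slope f (\sum_(i <- r) K i * c i).
Proof.
move=> K0 H L.
have S : slope (fun s => \sum_(i <- r) K i * `|F i s - F i 0|) (\sum_(i <- r) K i * c i).
  apply: slope_sum => i _.
  have A : slope (fun s => `|F i s - F i 0|) (c i).
    move=> e e0; have := H i e e0; apply: filterS => s.
    by rewrite subrr normr0 subr0 normr_id.
  have := slopeM (slope_cst (K i)) A.
  by rewrite mul0r addr0 ger0_norm.
move=> e e0; have := S e e0; apply: filterS => s; apply: le_trans.
rewrite (le_trans (L s))// [X in _ <= `|_ - X|]big1 ?subr0 ?ler_norm//.
by move=> i _; rewrite subrr normr0 mulr0.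
Qed.


Lemma continuous00P (f : R -> R -> R) (e : R) :
  {for (0 : R, 0 : R), continuous (fun p => f p.1 p.2)} -> 0 < e ->
  exists2 d : R, 0 < d &
    forall s r, `|s| < d -> `|r| < d -> `|f 0 0 - f s r| <= e.
Proof.
move=> C e0.
have N : \forall p \near ((0, 0) : R * R), `|f 0 0 - f p.1 p.2| <= e.
  exact: (@cvgr_dist_le _ _ _ _ _ _ _ C).
by have [d d0 H] := iffLR (near00P _) N; exists d.
Qed.

Lemma schwarz (f f1 f2 f12 f21 : R -> R -> R) (d : R) : 0 < d ->
  (forall s r : R, `|s| < d -> `|r| < d ->
    [/\ is_derive s 1 (f ^~ r) (f1 s r), is_derive r 1 (f s) (f2 s r),
        is_derive r 1 (f1 s) (f12 s r) & is_derive s 1 (f2 ^~ r) (f21 s r)]) ->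
  {for (0 : R, 0 : R), continuous (fun p => f12 p.1 p.2)} ->
  {for (0 : R, 0 : R), continuous (fun p => f21 p.1 p.2)} ->
  f12 0 0 = f21 0 0.
Proof.
move=> d0 H C12 C21; apply/eqP; rewrite -subr_eq0 -normr_le0.
apply/ler_addgt0Pr => e e0; rewrite add0r.
have e20 : 0 < e / 2 by rewrite divr_gt0.
have [d1 d10 H1] := continuous00P C12 e20.
have [d2 d20 H2] := continuous00P C21 e20.
pose h : R := Num.min d (Num.min d1 d2) / 2.
have h0 : 0 < h by rewrite divr_gt0// !lt_min d0 d10.
have [hd hd1 hd2] : [/\ h < d, h < d1 & h < d2].
  have : h < Num.min d (Num.min d1 d2) by rewrite gtr_pMr ?invf_lt1 ?ltr1n// !lt_min d0 d10.
  by rewrite !lt_min => /and3P[].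
have lth (x y : R) : `|x - 0| <= `|h - 0| -> h < y -> `|x| < y.
  by rewrite !subr0 (gtr0_norm h0); exact: le_lt_trans.
have ltz (y : R) : 0 < y -> `|0 : R| < y by rewrite normr0.
have gh (y : R) : h < y -> `|h| < y by rewrite gtr0_norm.
(* the second difference over the square [0, h]^2, by the mean value theorem in both orders *)
have [|a ah Ea] := @mean_value (fun s => f s h - f s 0) (fun s => f1 s h - f1 s 0) 0 h.
  move=> s sh; have [? _ _ _] := H s h (lth _ _ sh hd) (gh _ hd).
  by have [? _ _ _] := H s 0 (lth _ _ sh hd) (ltz _ d0); exact: is_deriveB.
have [|b bh Eb] := @mean_value (f1 a) (f12 a) 0 h.
  by move=> r rh; have [_ _ ? _] := H a r (lth _ _ ah hd) (lth _ _ rh hd).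
have [|a' ah' Ea'] := @mean_value (fun r => f h r - f 0 r) (fun r => f2 h r - f2 0 r) 0 h.
  move=> r rh; have [_ ? _ _] := H h r (gh _ hd) (lth _ _ rh hd).
  by have [_ ? _ _] := H 0 r (ltz _ d0) (lth _ _ rh hd); exact: is_deriveB.
have [|b' bh' Eb'] := @mean_value (f2 ^~ a') (f21 ^~ a') 0 h.
  by move=> s sh; have [_ _ _ ?] := H s a' (lth _ _ sh hd) (lth _ _ ah' hd).
have E : f12 a b = f21 b' a'.
  have hh : h * h != 0 by rewrite mulf_neq0// gt_eqF.
  apply: (mulIf hh); rewrite !subr0 /= in Ea Eb Ea' Eb'.
  by rewrite Eb in Ea; rewrite Eb' in Ea'; lra.
have B1 := H1 a b (lth _ _ ah hd1) (lth _ _ bh hd1).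
have B2 := H2 b' a' (lth _ _ bh' hd2) (lth _ _ ah' hd2).
rewrite /= in B1 B2.
have -> : f12 0 0 - f21 0 0 = (f12 0 0 - f12 a b) - (f21 0 0 - f21 b' a').
  by rewrite E; ring.
by rewrite (le_trans (ler_normB _ _))// (le_trans (lerD B1 B2))// -splitr.
Qed.

(* Chain rule along the diagonal: only the first partial derivative has to be
   continuous. *)
Lemma is_derive_diag (f f1 : R -> R -> R) (l : R) :
  (forall s r : R, is_derive s 1 (f ^~ r) (f1 s r)) ->
  is_derive (0 : R) 1 (f 0) l ->
  {for (0 : R, 0 : R), continuous (fun p => f1 p.1 p.2)} ->
  is_derive (0 : R) 1 (fun s => f s s) (f1 0 0 + l).
Proof.
move=> H1 /is_derive0P H2 C; apply/is_derive0P => e e0.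
have e20 : 0 < e / 2 by rewrite divr_gt0.
have [d d0 K] := continuous00P C e20.
have N : \forall s \near (0 : R), `|s| < d by apply/near0P; exists d.
apply: (near0S2 _ (H2 _ e20) N) => s A sd.
have [c cs E] := @mean_value (f ^~ s) (f1 ^~ s) 0 s (fun x _ => H1 x s).
rewrite !subr0 in cs E.
have /= B := K c s (le_lt_trans cs sd) sd.
have -> : f s s - f 0 0 - (f1 0 0 + l) * s =
   (f 0 s - f 0 0 - l * s) - (f1 0 0 - f1 c s) * s.
  rewrite -[f s s](subrK (f 0 s)) E; ring.
rewrite (le_trans (ler_normB _ _))//.
have -> : e * `|s| = e / 2 * `|s| + e / 2 * `|s| by rewrite -mulrDl -splitr.
by rewrite lerD// normrM; apply: ler_wpM2r.
Qed.

(** One-sided on purpose: in the time direction the maximum point may be the initial time of the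
    interval. *)
Lemma first_derivative_test (f : R -> R) (l : R) :
  is_derive (0 : R) 1 f l -> (\forall s \near 0, 0 <= s -> f s <= f 0) -> l <= 0.
Proof.
move=> /is_derive0P H M; apply/ler_addgt0Pr => e e0; rewrite add0r.
have [d d0 K] := near0I (H _ e0) M.
have d20 : 0 < d / 2 by rewrite divr_gt0.
have /K[] : `|d / 2| < d by rewrite gtr0_norm// gtr_pMr// invf_lt1// ltr1n.
move=> /= A /(_ (ltW d20)) B.
rewrite -(ler_pM2r d20); move: A; rewrite (gtr0_norm d20) ler_norml => /andP[A _].
by lra.
Qed.

(** A positive [l] would make [f1] positive just to the right of 0, and [f] would exceed [f 0] there
    by the mean value theorem. *)
Lemma second_derivative_test (f f1 : R -> R) (l : R) :
  (\forall s \near (0 : R), is_derive (s : R) 1 f (f1 s)) -> is_derive (0 : R) 1 f1 l ->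
  (\forall s \near 0, f s <= f 0) -> f1 0 = 0 /\ l <= 0.
Proof.
move=> H1 H2 M.
have D0 : is_derive (0 : R) 1 f (f1 0) by apply: nbhs_singleton H1.
have f10 : f1 0 = 0.
  apply/eqP; rewrite eq_le; apply/andP; split.
    by apply: first_derivative_test D0 _; apply: filterS M.
  (* The reflection [s |-> - s] gives the reverse inequality. *)
  rewrite -oppr_le0; apply: (@first_derivative_test (fun s => f (- s)) (- f1 0)).
    apply/is_derive0P => e e0; have /is_derive0P/(_ e e0)/near0P[d d0 K] := D0.
    apply/near0P; exists d => // s sd; have := K (- s); rewrite normrN => /(_ sd).
    by rewrite mulrN mulNr oppr0.
  have /near0P[d d0 K] := M.
  by apply/near0P; exists d => // s sd _; rewrite oppr0; apply: K; rewrite normrN.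
split=> //; rewrite leNgt; apply/negP => l0.
have l20 : 0 < l / 2 by rewrite divr_gt0.
have /is_derive0P/(_ _ l20) A := H2.
have [d d0 K] := near0I (filterI H1 M) A.
have d20 : 0 < d / 2 by rewrite divr_gt0.
have dd : `|d / 2| < d by rewrite gtr0_norm// gtr_pMr// invf_lt1// ltr1n.
have le_d (x : R) : `|x| <= `|d / 2| -> `|x| < d by move=> /le_lt_trans; apply.
have [||c cd E] := @MVT R f f1 0 (d / 2) d20.
- move=> x; rewrite in_itv/= => /andP[x0 xd].
  have hx : `|x| <= `|d / 2| by rewrite !gtr0_norm// ltW.
  by have [[? _] _] := K x (le_d _ hx).
- apply: continuous_in_subspaceT => x; rewrite inE/= in_itv/= => /andP[x0 xd].
  have hx : `|x| <= `|d / 2| by rewrite !ger0_norm// ltW.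
  by have [[/is_derive_continuous ? _] _] := K x (le_d _ hx).
move: cd; rewrite in_itv/= => /andP[c0 cd].
have [|[_ _] /= B] := K c; first by apply: le_d; rewrite !gtr0_norm// ltW.
have [[_ /= M1] _] := K _ dd.
move: B; rewrite f10 subr0 (gtr0_norm c0) ler_norml => /andP[B _].
have : 0 < f1 c * (d / 2 - 0) by rewrite subr0 mulr_gt0//; nra.
by rewrite -E subr_gt0 ltNge M1.
Qed.

End one_variable.

(** * A maximum principle on R^n *)

Section derivation_rules.
Variables (R : realType) (V : normedModType R).
Implicit Types (f g : V -> R) (x v : V).

Lemma derive_add f g x v a b : is_derive x v f a -> is_derive x v g b ->
  is_derive x v (fun y => f y + g y) (a + b).
Proof. by move=> *; apply: is_deriveD. Qed.

Lemma derive_sub f g x v a b : is_derive x v f a -> is_derive x v g b ->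
  is_derive x v (fun y => f y - g y) (a - b).
Proof. by move=> *; apply: is_deriveB. Qed.

Lemma derive_mul f g x v a b : is_derive x v f a -> is_derive x v g b ->
  is_derive x v (fun y => f y * g y) (f x * b + a * g x).
Proof.
move=> F G; apply: is_derive_eq (is_deriveM F G) _.
by rewrite [_ *: _]/(_ * _) [g x *: _]mulrC.
Qed.

Lemma derive_scale (c : R) f x v a : is_derive x v f a ->
  is_derive x v (fun y => c * f y) (c * a).
Proof. by move=> *; apply: is_deriveZ. Qed.

Lemma derive_cst (c : R) x v : is_derive x v (fun=> c) 0.
Proof. exact: is_derive_cst. Qed.

Lemma derive_sum (I : Type) (r : seq I) (P : pred I) (F : I -> V -> R) x v
    (a : I -> R) : (forall i, P i -> is_derive x v (F i) (a i)) ->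
  is_derive x v (fun y => \sum_(i <- r | P i) F i y) (\sum_(i <- r | P i) a i).
Proof.
move=> H; elim: r => [|i r IH].
  rewrite big_nil (_ : (fun _ => _) = fun=> 0); first exact: derive_cst.
  by apply/funext => y; rewrite big_nil.
rewrite big_cons (_ : (fun _ => _) = fun y =>
  if P i then F i y + \sum_(j <- r | P j) F j y else \sum_(j <- r | P j) F j y).
  by case: ifPn => // Pi; apply: derive_add => //; apply: H.
by apply/funext => y; rewrite big_cons.
Qed.

Lemma derive_sqr f x v a : is_derive x v f a ->
  is_derive x v (fun y => f y ^+ 2) (2 * f x * a).
Proof.
move=> H; rewrite (_ : (fun _ => _) = fun y => f y * f y).
  by apply: is_derive_eq (derive_mul H H) _; ring.
by apply/funext => y; rewrite expr2.
Qed.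

End derivation_rules.

Section within_continuity.
Variables (R : realType) (X : topologicalType) (A : set X).
Implicit Types f g : X -> R.

Lemma within_cst (c : R) : {within A, continuous (fun=> c : R)}.
Proof. by apply/subspace_continuousP => p _; exact: cvg_cst. Qed.

Lemma within_add f g : {within A, continuous f} -> {within A, continuous g} ->
  {within A, continuous (fun p => f p + g p)}.
Proof.
move=> /subspace_continuousP F /subspace_continuousP G; apply/subspace_continuousP.
by move=> p pA; apply: cvgD; [exact: F|exact: G].
Qed.

Lemma within_mul f g : {within A, continuous f} -> {within A, continuous g} ->
  {within A, continuous (fun p => f p * g p)}.
Proof.
move=> /subspace_continuousP F /subspace_continuousP G; apply/subspace_continuousP.
by move=> p pA; apply: cvgM; [exact: F|exact: G].
Qed.

Lemma within_opp f : {within A, continuous f} ->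
  {within A, continuous (fun p => - f p)}.
Proof.
move=> /subspace_continuousP F; apply/subspace_continuousP.
by move=> p pA; apply: cvgN; exact: F.
Qed.

Lemma within_sum (I : Type) (r : seq I) (P : pred I) (F : I -> X -> R) :
  (forall i, P i -> {within A, continuous (F i)}) ->
  {within A, continuous (fun p => \sum_(i <- r | P i) F i p)}.
Proof.
move=> H; elim: r => [|i r IH].
  rewrite (_ : (fun _ => _) = fun=> 0); first exact: within_cst.
  by apply/funext => y; rewrite big_nil.
rewrite (_ : (fun _ => _) = fun y =>
  if P i then F i y + \sum_(j <- r | P j) F j y else \sum_(j <- r | P j) F j y).
  by case Pi : (P i) => //; apply: within_add => //; exact: H.
by apply/funext => y; rewrite big_cons.
Qed.

Lemma within_sqr f : {within A, continuous f} ->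
  {within A, continuous (fun p => f p ^+ 2)}.
Proof.
move=> F; rewrite (_ : (fun _ => _) = fun p => f p * f p); first exact: within_mul.
by apply/funext => y; rewrite expr2.
Qed.

End within_continuity.

Lemma derive_expR_lin (R : realType) (a t : R) :
  is_derive t 1 (fun s : R => expR (a * s)) (a * expR (a * t)).
Proof.
have H : is_derive t 1 (fun s : R => a * s) (a * 1).
  by apply: derive_scale; exact: is_derive_id.
apply: is_derive_eq (@is_derive1_comp R expR _ t _ _ (is_derive_expR _) H) _.
by rewrite mulr1 mulrC.
Qed.

Section row_vectors.
Variables (R : realType) (n : nat).
Implicit Types (x : 'rV[R]_n.+1) (j l : 'I_n.+1).

Lemma derive_coord x j l :
  is_derive x (delta_mx 0 j) (fun y : 'rV[R]_n.+1 => y 0 l) (l == j)%:R.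
Proof.
apply/is_derive_line0/is_derive0P => e e0; apply/near0P; exists 1 => // s _.
rewrite scale0r addr0 !mxE eqxx /= (_ : x 0 l + s * (l == j)%:R - x 0 l - (l == j)%:R * s = 0).
  by rewrite normr0 mulr_ge0// ltW.
by ring.
Qed.

(** A smooth substitute for the norm; being at least 1, it has increasing powers. *)
Definition rho x : R := 1 + \sum_l x 0 l ^+ 2.

Lemma rho_ge1 x : 1 <= rho x.
Proof. by rewrite lerDl sumr_ge0// => l _; rewrite sqr_ge0. Qed.

Lemma sqr_le_rho x l : x 0 l ^+ 2 <= rho x.
Proof.
rewrite /rho (bigD1 l)//= addrCA lerDl addr_ge0// sumr_ge0// => k _.
exact: sqr_ge0.
Qed.

Lemma derive_rho x j : is_derive x (delta_mx 0 j) rho (2 * x 0 j).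
Proof.
rewrite (_ : 2 * x 0 j = 0 + \sum_l 2 * x 0 l * (l == j)%:R).
  apply: (@derive_add _ _ (fun=> 1)).
  apply: (@derive_sum R 'rV[R]_n.+1 _ _ xpredT (fun l (y : 'rV[R]_n.+1) => y 0 l ^+ 2) x
    (delta_mx 0 j) (fun l => 2 * x 0 l * (l == j)%:R)) => l _.
  exact: (derive_sqr (derive_coord x j l)).
rewrite add0r (bigD1 j)//= eqxx mulr1 big1 ?addr0// => l /negPf ->.
by rewrite mulr0.
Qed.

Lemma derive_rho3 x j :
  is_derive x (delta_mx 0 j) (fun y => rho y ^+ 3) (6 * (rho x ^+ 2 * x 0 j)).
Proof.
rewrite (_ : (fun _ => _) = fun y => rho y * rho y ^+ 2).
  apply: is_derive_eq (derive_mul (derive_rho x j) (derive_sqr (derive_rho x j))) _.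
  ring.
by apply/funext => y; rewrite exprS.
Qed.

Lemma derive2_rho3 x j :
  is_derive x (delta_mx 0 j) (fun y => 6 * (rho y ^+ 2 * y 0 j))
    (6 * rho x ^+ 2 + 24 * rho x * x 0 j ^+ 2).
Proof.
have := derive_scale 6 (derive_mul (derive_sqr (derive_rho x j)) (derive_coord x j j)).
by move=> H; apply: is_derive_eq H _; rewrite eqxx mulr1n /=; ring.
Qed.

Lemma rho_continuous : continuous rho.
Proof.
have -> : rho = (fun=> 1) + \sum_l (fun y : 'rV[R]_n.+1 => y 0 l ^+ 2).
  by apply/funext => y; rewrite /rho fctE fct_sumE.
move=> x; apply: continuousD; first exact: cst_continuous.
elim/big_ind : _ => [|f g F G|l _].
- exact: cst_continuous.
- exact: continuousD.
- rewrite (_ : (fun _ => _) = fun y : 'rV[R]_n.+1 => y 0 l * y 0 l).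
    by apply: continuousM; apply: coord_continuous.
  by apply/funext => y; rewrite expr2.
Qed.

End row_vectors.

Section maximum_principle.
Variables (R : realType) (n : nat) (T sigma kap c K : R).
Let N : R := n.+1%:R.
Variable b : 'I_n.+1 -> R -> 'rV[R]_n.+1 -> R.
Variables Phi Phit : R -> 'rV[R]_n.+1 -> R.
Variables Phi1 Phi2 : 'I_n.+1 -> R -> 'rV[R]_n.+1 -> R.
Hypotheses (kap0 : 0 <= kap) (c0 : 0 <= c) (K0 : 0 <= K).
Hypothesis Phi_cont :
  {within [set p : R * 'rV[R]_n.+1 | p.1 \in `]0, T]],
    continuous (fun p => Phi p.1 p.2)}.
Hypothesis Phi_t : forall (t : R) x, t \in `]0, T[ ->
  is_derive t 1 (Phi ^~ x) (Phit t x).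
Hypothesis Phi_x : forall j (t : R) x, t \in `]0, T[ ->
  is_derive x (delta_mx 0 j) (Phi t) (Phi1 j t x).
Hypothesis Phi_xx : forall j (t : R) x, t \in `]0, T[ ->
  is_derive x (delta_mx 0 j) (Phi1 j t) (Phi2 j t x).
Hypothesis Phi_growth : forall (t : R) x, t \in `]0, T] ->
  Phi t x <= K * rho x ^+ 2.
Hypothesis b_growth : forall j (t : R) x, t \in `]0, T[ ->
  b j t x ^+ 2 <= K * rho x.
Hypothesis Phi_pde : forall (t : R) x, t \in `]0, T[ ->
  - (kap * Phi t x) - c <= Phit t x + sigma ^+ 2 / 2 * \sum_j Phi2 j t x
    + \sum_j b j t x * Phi1 j t x.
Hypothesis Phi_T : forall x, Phi T x <= 0.

(** For each of the [N] coordinates, [15 * sigma ^+ 2] comes from the second derivative of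
    [rho ^+ 3], at most [30 * rho ^+ 3], and [3 + 3 * K] from [6 b x_j <= 3 b^2 + 3 x_j^2]. The
    final 1 provides the strict inequality at the maximum point. *)
Let K' : R := N * (15 * sigma ^+ 2 + 3 + 3 * K) + 1.

(* The growth of [rho ^+ 3] beats that of [Phi], so that [Psi] attains its maximum; [K'] makes
   the contribution of the barrier have the right sign. *)
Let Psi (e : R) (t : R) (x : 'rV[R]_n.+1) : R :=
  expR (kap * t) * Phi t x - c * expR (kap * T) * (T - t)
  - e * (expR (- K' * t) * rho x ^+ 3).

Let barrier_drift t x : t \in `]0, T[ ->
  \sum_j (sigma ^+ 2 / 2 * (6 * rho x ^+ 2 + 24 * rho x * x 0 j ^+ 2)
          + b j t x * (6 * (rho x ^+ 2 * x 0 j))) <= (K' - 1) * rho x ^+ 3.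
Proof.
move=> t0T; have r1 := rho_ge1 x.
have s2 : 0 <= sigma ^+ 2 by exact: sqr_ge0.
set r := rho x in r1 *.
have H j : sigma ^+ 2 / 2 * (6 * r ^+ 2 + 24 * r * x 0 j ^+ 2)
          + b j t x * (6 * (r ^+ 2 * x 0 j)) <=
          (15 * sigma ^+ 2 + 3 + 3 * K) * r ^+ 3.
  have xr := sqr_le_rho x j; have br := b_growth j x t0T.
  rewrite -/r in xr br.
  have x20 := sqr_ge0 (x 0 j).
  have r0 : 0 <= r by lra.
  have r23 : r ^+ 2 <= r ^+ 3 by rewrite (exprS r 2) ler_peMl ?exprn_ge0.
  have A : 6 * r ^+ 2 + 24 * r * x 0 j ^+ 2 <= 30 * r ^+ 3.
    have : r * x 0 j ^+ 2 <= r * r by apply: ler_wpM2l.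
    by rewrite -expr2; lra.
  have B : b j t x * (6 * (r ^+ 2 * x 0 j)) <= (3 + 3 * K) * r ^+ 3.
    have r20 : 0 <= r ^+ 2 by exact: sqr_ge0.
    have sq : 0 <= (b j t x - x 0 j) ^+ 2 by exact: sqr_ge0.
    have -> : b j t x * (6 * (r ^+ 2 * x 0 j)) = r ^+ 2 * (6 * (b j t x * x 0 j)).
      by ring.
    have -> : (3 + 3 * K) * r ^+ 3 = r ^+ 2 * ((3 + 3 * K) * r) by ring.
    apply: ler_wpM2l => //.
    have e2 : (b j t x - x 0 j) ^+ 2 = b j t x ^+ 2 + x 0 j ^+ 2 - 2 * (b j t x * x 0 j) by ring.
    by rewrite e2 in sq; lra.
  have A' : sigma ^+ 2 / 2 * (6 * r ^+ 2 + 24 * r * x 0 j ^+ 2) <= sigma ^+ 2 / 2 * (30 * r ^+ 3).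
    by apply: ler_wpM2l A; rewrite divr_ge0.
  by apply: le_trans (lerD A' B) _; rewrite le_eqVlt; apply/orP; left; apply/eqP; field.
apply: (le_trans (ler_sum _ (fun j _ => H j))).
by rewrite sumr_const card_ord -[_ *+ _]mulr_natl /K' addrK mulrA.
Qed.

(** Time stays above [t1 > 0] because [Phi] is known to be continuous on []0, T]] only. *)
Let Psi_continuous e t1 M : 0 < t1 -> {within [set p : R * 'rV[R]_n.+1 |
    p.1 \in `[t1, T] /\ forall l, `[- M, M]%classic (p.2 0 l)],
  continuous (fun p => Psi e p.1 p.2)}.
Proof.
move=> t10; apply/subspace_continuousP => p pA.
have cE a : (fun q : R * 'rV[R]_n.+1 => expR (a * q.1)) @ p --> expR (a * p.1).
  apply: (continuous_comp (f := fun q : R * 'rV[R]_n.+1 => a * q.1)).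
    by apply: (@cvgM _ _ _ _ (fun=> a)); [exact: cvg_cst|exact: cvg_fst].
  exact: continuous_expR.
have cr : (fun q : R * 'rV[R]_n.+1 => rho q.2) @ p --> rho p.2.
  by apply: (continuous_comp (f := snd)); [exact: cvg_snd|exact: rho_continuous].
have w (f : R * 'rV[R]_n.+1 -> R) l : f @ p --> l -> f @ within [set p : R * 'rV[R]_n.+1 |
    p.1 \in `[t1, T] /\ forall l, `[- M, M]%classic (p.2 0 l)] (nbhs p) --> l.
  by move=> H; apply: cvg_trans H; apply: cvg_app; exact: cvg_within.
apply: cvgB; last first.
  apply: w; apply: (@cvgM _ _ _ _ (fun=> e)); first exact: cvg_cst.
  apply: cvgM; first exact: cE.
  have -> : (fun x : R * 'rV[R]_n.+1 => rho x.2 ^+ 3) = fun x => rho x.2 * (rho x.2 * rho x.2).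
    by apply/funext => x; rewrite -expr2 -exprS.
  by rewrite exprS expr2; do 2! (apply: cvgM => //).
apply: cvgB; last first.
  apply: w; apply: cvgM; first exact: cvg_cst.
  by apply: cvgB; [exact: cvg_cst|exact: cvg_fst].
apply: cvgM; first by apply: w; exact: cE.
have pB : [set p : R * 'rV[R]_n.+1 | p.1 \in `]0, T]] p.
  by case: pA => + _; rewrite /= !in_itv/= => /andP[/(lt_le_trans t10) -> ->].
have /subspace_continuousP/(_ p pB) := Phi_cont; apply: cvg_trans.
apply: cvg_app; apply: within_subset => q [+ _].
by rewrite /= !in_itv/= => /andP[/(lt_le_trans t10) -> ->].
Qed.

(** If the bound fails at (t, x), [Psi] is positive there for a small [e] and attains a positive
    maximum over [t, T] and a large box. This point is before T and inside the box, and the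
    derivative tests contradict the differential inequality. The growth constant [K] only fixes the
    box and the barrier and is absent from the conclusion, so it may depend on the dimension. *)
Lemma maximum_principle t x : t \in `]0, T] -> Phi t x <= c * expR (kap * T) * T.
Proof.
move=> tT; rewrite leNgt; apply/negP => big.
have := tT; rewrite in_itv/= => /andP[t0 tleT].
have T0 : 0 < T by exact: lt_le_trans tleT.
set E := expR (kap * T); have E1 : 1 <= E.
  by rewrite /E (le_trans _ (expR_ge1Dx _))// lerDl mulr_ge0// ltW.
have E0 : 0 < E by exact: lt_le_trans E1.
have K'1 : 1 <= K'.
  have s2 := sqr_ge0 sigma; rewrite lerDr; apply: mulr_ge0; first exact: ler0n.
  by move: K0; lra.
have D0 : 0 < expR (kap * t) * Phi t x - c * E * (T - t).
  have e1 : 1 <= expR (kap * t).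
    by rewrite (le_trans _ (expR_ge1Dx _))// lerDl mulr_ge0// ltW.
  have cE : 0 <= c * E by rewrite mulr_ge0// ltW.
  have P0 : 0 < Phi t x by apply: le_lt_trans big; rewrite mulr_ge0// ltW.
  have : Phi t x <= expR (kap * t) * Phi t x by rewrite ler_peMl// ltW.
  have : 0 <= c * E * t by rewrite mulr_ge0// ltW.
  by rewrite -/E in big; lra.
set D := _ - _ in D0.
have r1 y := @rho_ge1 R n y.
have r30 (y : 'rV[R]_n.+1) : 0 < rho y ^+ 3 by rewrite exprn_gt0// (lt_le_trans _ (r1 y)).
set B := expR (- K' * t) * rho x ^+ 3.
have B0 : 0 < B by rewrite mulr_gt0// expR_gt0.
(* The barrier then costs exactly half of the excess [D] at (t, x). *)
pose e := D / (2 * B).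
have e0 : 0 < e by rewrite divr_gt0// mulr_gt0.
have Psi0 : 0 < Psi e t x.
  rewrite /Psi -/E -/D -/B /e.
  have -> : D - D / (2 * B) * B = D / 2 by field; rewrite gt_eqF.
  by rewrite divr_gt0.
(* Where [Psi] is positive, the barrier, at least [e * expR (- K' * T) * rho ^+ 3], lies below
   [E * K * rho ^+ 2]; this bounds [rho] by [M]. *)
pose M := K * E / (e * expR (- K' * T)).
have eT0 : 0 < e * expR (- K' * T) by rewrite mulr_gt0// expR_gt0.
have M0 : 0 <= M by apply: divr_ge0; [exact: mulr_ge0 K0 (ltW E0)|exact: ltW].
have F0 s (y : 'rV[R]_n.+1) : 0 < e * (expR (- K' * s) * rho y ^+ 3).
  by apply: mulr_gt0 e0 _; apply: mulr_gt0; [exact: expR_gt0|exact: r30].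
have cET s : s <= T -> 0 <= c * E * (T - s).
  by move=> sT; apply: mulr_ge0; [exact: mulr_ge0 c0 (ltW E0)|rewrite subr_ge0].
have Psi_pos s (y : 'rV[R]_n.+1) : s \in `]0, T] -> 0 < Psi e s y -> rho y < M + 1.
  move=> sT P0; have := sT; rewrite in_itv/= => /andP[s0 sleT].
  have A : e * expR (- K' * T) * rho y ^+ 3 < E * (K * rho y ^+ 2).
    have Phi0 : 0 < Phi s y.
      have : 0 < expR (kap * s) * Phi s y; last by rewrite pmulr_rgt0 ?expR_gt0.
      move: P0; rewrite /Psi -/E.
      have := cET _ sleT.
      have := F0 s y.
      by lra.
    have F1 : expR (kap * s) * Phi s y <= E * (K * rho y ^+ 2).
      apply: ler_pM; rewrite ?expR_ge0 ?ler_expR ?ler_wpM2l ?Phi_growth//.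
      exact: ltW.
    have F2 : e * expR (- K' * T) * rho y ^+ 3 <= e * (expR (- K' * s) * rho y ^+ 3).
      rewrite -[X in X <= _]mulrA (ler_pM2l e0) (ler_pM2r (r30 y)) ler_expR.
      by apply: ler_wnM2l => //; rewrite oppr_le0; apply: le_trans K'1.
    move: P0; rewrite /Psi -/E.
    have := cET _ sleT.
    by lra.
  have r20 : 0 < rho y ^+ 2 by rewrite exprn_gt0// (lt_le_trans _ (r1 y)).
  rewrite ltr_wpDr// /M ltr_pdivlMr// -(ltr_pM2r r20).
  by move: A; rewrite exprS; lra.
pose A := [set p : R * 'rV[R]_n.+1 |
  p.1 \in `[t, T] /\ forall l, `[- (M + 1), M + 1]%classic (p.2 0 l)].
have box (y : 'rV[R]_n.+1) l : rho y < M + 1 -> `|y 0 l| < M + 1.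
  move=> ryM; have := sqr_le_rho y l; rewrite -real_normK ?num_real// => yl.
  rewrite ltNge; apply/negP => ly.
  by have := normr_ge0 (y 0 l); nra.
have sub_t s : s \in `[t, T] -> s \in `]0, T].
  by rewrite !in_itv/= => /andP[/(lt_le_trans t0) -> ->].
have Ax : A (t, x).
  split=> [|l] /=; first by rewrite in_itv/= lexx.
  have := box x l (Psi_pos t x tT Psi0); rewrite in_itv/= ltr_norml.
  by move=> /andP[/ltW -> /ltW ->].
have cA : compact A.
  rewrite (_ : A = `[t, T]%classic `*` [set v : 'rV[R]_n.+1 | forall l, `[- (M + 1), M + 1]%classic (v ord0 l)]).
    apply: compact_setX; first exact: segment_compact.
    by apply: (@rV_compact R n.+1 (fun=> `[- (M + 1), M + 1]%classic)) => l; exact: segment_compact.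
  by apply/seteqP; split.
have [|[s y]] := @compact_EVT_max _ R (fun p => Psi e p.1 p.2) A _ cA (@Psi_continuous e t (M + 1) t0).
  by exists (t, x).
rewrite inE => -[/= stT ybox] max.
have maxs (s' : R) (y' : 'rV[R]_n.+1) : s' \in `[t, T] -> (forall l, `|y' 0 l| <= M + 1) -> Psi e s' y' <= Psi e s y.
  move=> h1 h2; apply: (max (s', y')); rewrite inE; split => //= l.
  by rewrite in_itv/= -ler_norml.
have Psy : 0 < Psi e s y.
  by apply: lt_le_trans Psi0 _; apply: (max (t, x)); rewrite inE.
have sT := sub_t _ stT.
have yM l : `|y 0 l| < M + 1 by apply: box; apply: Psi_pos Psy.
(* At time T both [Phi] and the barrier term make [Psi] nonpositive. *)
have sltT : s < T.
  rewrite ltNge; apply/negP => Ts.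
  have sE : s = T by apply/eqP; rewrite eq_le Ts andbT; move: sT; rewrite in_itv/= => /andP[].
  move: Psy; rewrite /Psi sE subrr mulr0 subr0.
  have : expR (kap * T) * Phi T y <= 0 by rewrite mulr_ge0_le0 ?expR_ge0.
  have := F0 T y.
  by lra.
have s0 : 0 < s by move: sT; rewrite in_itv/= => /andP[].
have sI : s \in `]0, T[ by rewrite in_itv/= s0.
have ts : t <= s by move: stT; rewrite in_itv/= => /andP[].
pose Es := expR (kap * s); pose Fs := expR (- K' * s).
have Psit : is_derive s 1 (Psi e ^~ y) ((Es * Phit s y + kap * Es * Phi s y)
     - c * E * (0 - 1) - e * (- K' * Fs * rho y ^+ 3)).
  rewrite /Psi /=; apply: derive_sub; first apply: derive_sub.
  - by apply: derive_mul; [exact: derive_expR_lin|exact: Phi_t].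
  - apply: derive_scale.
    rewrite (_ : (fun y0 => _) = fun s => rho y ^+ 3 * expR (- K' * s)); last first.
      by apply/funext => r; rewrite mulrC.
    by rewrite [_ * rho y ^+ 3]mulrC; apply: derive_scale; exact: derive_expR_lin.
have Psix j (z : 'rV[R]_n.+1) : is_derive z (delta_mx 0 j) (Psi e s)
    (Es * Phi1 j s z - 0 - e * (Fs * (6 * (rho z ^+ 2 * z 0 j)))).
  rewrite /Psi /=; apply: derive_sub; first apply: derive_sub.
  - by apply: derive_scale; exact: Phi_x.
  - by do 2! apply: derive_scale; exact: derive_rho3.
have Psixx j (z : 'rV[R]_n.+1) : is_derive z (delta_mx 0 j) (fun z => Es * Phi1 j s z - 0 - e * (Fs * (6 * (rho z ^+ 2 * z 0 j))))
    (Es * Phi2 j s z - 0 - e * (Fs * (6 * rho z ^+ 2 + 24 * rho z * z 0 j ^+ 2))).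
  apply: derive_sub; first apply: derive_sub.
  - by apply: derive_scale; exact: Phi_xx.
  - by do 2! apply: derive_scale; exact: derive2_rho3.
(* Only later times are compared, since [s = t] is possible. *)
have Lt : Es * Phit s y + kap * Es * Phi s y + c * E + e * (K' * (Fs * rho y ^+ 3)) <= 0.
  suff : Es * Phit s y + kap * Es * Phi s y - c * E * (0 - 1) - e * (- K' * Fs * rho y ^+ 3) <= 0 by lra.
  apply: (first_derivative_test (iffLR (is_derive_line0 _ _ _ _) Psit)).
  apply/near0P; exists (T - s); first by rewrite subr_gt0.
  move=> r rT r0; rewrite scale0r addr0 [r *: _]mulr1.
  apply: maxs => [|l]; last exact: ltW.
  move: rT; rewrite ger0_norm// in_itv/= (le_trans ts) ?lerDl//= => rT.
  by lra.
(* The maximum point is strictly inside the box, so both directions along x_j are admissible. *)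
have Lx j : Es * Phi1 j s y = e * (Fs * (6 * (rho y ^+ 2 * y 0 j))) /\
    Es * Phi2 j s y - e * (Fs * (6 * rho y ^+ 2 + 24 * rho y * y 0 j ^+ 2)) <= 0.
  have [|||H1 H2] := @second_derivative_test R (fun r => Psi e s (y + r *: delta_mx 0 j))
    (fun r => Es * Phi1 j s (y + r *: delta_mx 0 j) - 0 -
       e * (Fs * (6 * (rho (y + r *: delta_mx 0 j) ^+ 2 * (y + r *: delta_mx 0 j) 0 j))))
    (Es * Phi2 j s y - 0 - e * (Fs * (6 * rho y ^+ 2 + 24 * rho y * y 0 j ^+ 2))).
  - apply/near0P; exists 1 => // r _.
    exact: (iffLR (is_derive_line _ _ _ _ _) (Psix j (y + r *: delta_mx 0 j))).
  - exact: (iffLR (is_derive_line0 _ _ _ _) (Psixx j y)).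
  - have m0 : 0 < M + 1 - `|y 0 j| by rewrite subr_gt0.
    apply/near0P; exists (M + 1 - `|y 0 j|) => // r rM.
    rewrite scale0r addr0; apply: maxs => // l; rewrite !mxE eqxx /=.
    have [->|lj] := eqVneq l j; last by rewrite mulr0 addr0 ltW.
    by rewrite mulr1 (le_trans (ler_normD _ _))//; lra.
  - by move: H1; rewrite scale0r addr0 subr0 => H1; split; lra.
have pde := Phi_pde y sI; have bar := barrier_drift y sI.
have Es0 : 0 < Es by exact: expR_gt0.
have Fs0 : 0 < Fs by exact: expR_gt0.
have EsE : Es <= E by rewrite ler_expR ler_wpM2l// ltW.
have S1 : Es * (sigma ^+ 2 / 2 * \sum_j Phi2 j s y + \sum_j b j s y * Phi1 j s y) <=
   e * Fs * \sum_j (sigma ^+ 2 / 2 * (6 * rho y ^+ 2 + 24 * rho y * y 0 j ^+ 2)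
          + b j s y * (6 * (rho y ^+ 2 * y 0 j))).
  rewrite mulr_sumr -big_split/= !mulr_sumr; apply: ler_sum => j _.
  have [L1 L2] := Lx j.
  have s2 : 0 <= sigma ^+ 2 / 2 by rewrite divr_ge0// sqr_ge0.
  have -> : Es * (sigma ^+ 2 / 2 * Phi2 j s y + b j s y * Phi1 j s y) =
    sigma ^+ 2 / 2 * (Es * Phi2 j s y) + b j s y * (Es * Phi1 j s y) by ring.
  rewrite L1.
  have L3 : Es * Phi2 j s y <= e * (Fs * (6 * rho y ^+ 2 + 24 * rho y * y 0 j ^+ 2)) by lra.
  apply: (le_trans (lerD (ler_wpM2l s2 L3) (lexx _))).
  by rewrite le_eqVlt; apply/orP; left; apply/eqP; ring.
have S2 := ler_wpM2l (ltW (mulr_gt0 e0 Fs0)) bar.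
have S3 := ler_wpM2l (ltW Es0) pde.
have S4 := ler_wpM2l c0 EsE.
have S5 := mulr_gt0 (mulr_gt0 e0 Fs0) (r30 y).
(* Together these leave [c (E - Es) + e Fs rho^3 <= 0], whereas the second term is positive. *)
move: S1 S2 S3 S4 S5 Lt.
set a1 := \sum_j Phi2 j s y; set a2 := \sum_j b j s y * Phi1 j s y; set a3 := \sum_j _.
set r3 := rho y ^+ 3; set p0 := Phi s y; set p1 := Phit s y; set s2 := sigma ^+ 2 / 2.
move: a1 a2 a3 r3 p0 p1 s2 => a1 a2 a3 r3 p0 p1 s2.
by lra.
Qed.

End maximum_principle.

(** * The energy estimate *)

Section energy_constants.
Variables (R : realType) (T sigma C M : R).

(** The solution [lam] of [lam sigma^2 = C + 4 C^2 M^2 / sigma^2]: the right-hand side is the total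
    coefficient of [D1 i j ^+ 2] produced by the cross terms. *)
Definition energy_weight : R := (C + 4 * C ^+ 2 * M ^+ 2 / sigma ^+ 2) / sigma ^+ 2.

(** Dominates the coefficients left in front of [lam D^2] (which is [3 * C]) and of [w^2]; [9 * C]
    covers the [3 * C] of the former and the [6 * C] of the latter. *)
Definition energy_rate : R := 9 * C + 2 * energy_weight * C
  + 4 * C ^+ 2 / sigma ^+ 2 + 4 * C ^+ 2 * M ^+ 2 / sigma ^+ 2.

(** The bound of [maximum_principle] for the inhomogeneity [(lam C + C) / N], with the factor
    [1 / N] taken out. *)
Definition energy_bound : R :=
  (energy_weight * C + C) * expR (energy_rate * T) * T.

End energy_constants.

(** The share [s / 4] is chosen because the gradients of w are charged three times, which stays
    below the available dissipation [s]. *)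
Lemma young (R : realFieldType) (s u v : R) : 0 < s ->
  2 * u * v <= s / 4 * u ^+ 2 + 4 * v ^+ 2 / s.
Proof.
move=> s0; rewrite -subr_ge0.
have -> : s / 4 * u ^+ 2 + 4 * v ^+ 2 / s - 2 * u * v = (s * u - 4 * v) ^+ 2 / (4 * s).
  by field; rewrite gt_eqF.
by rewrite divr_ge0 ?sqr_ge0// mulr_ge0// ltW.
Qed.

Section energy_inequality.
Variables (R : realType) (sigma C M : R) (n : nat).
Hypotheses (sigma0 : 0 < sigma) (C0 : 0 <= C) (M0 : 0 <= M).
Let nu : R := n.+1%:R^-1.
Let lam := energy_weight sigma C M.
Let kap := energy_rate sigma C M.
Variables (D w LD Lw : 'I_n.+1 -> R) (D1 w1 : 'I_n.+1 -> 'I_n.+1 -> R).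
Hypothesis wM : forall i, `|w i| <= M.
Hypothesis LD_le : forall i,
  `|LD i| <= C * \sum_j nu * (nu + `|w i| + `|w j|).
Hypothesis Lw_le : forall i, `|Lw i| <= C * (`|w i| * `|w1 i i|) +
  C * \sum_j (nu * (nu + `|w i| + `|w j|) + `|D1 i j| * (nu + `|w1 j i|)
              + nu * `|w1 j i|).

Let nu0 : 0 < nu. Proof. by rewrite invr_gt0 ltr0n. Qed.
Let nu1 : nu <= 1. Proof. by rewrite invf_le1 ?ltr0n// ler1n. Qed.
Let lam0 : 0 <= lam.
Proof.
apply: divr_ge0; last exact: sqr_ge0.
apply: addr_ge0 => //; apply: divr_ge0; last exact: sqr_ge0.
by rewrite !mulr_ge0 ?sqr_ge0.
Qed.

Let sum_nu (c : R) : \sum_(j < n.+1) nu * c = c.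
Proof. by rewrite sumr_const card_ord -mulrnAl -[nu *+ _]mulr_natl mulfV ?mul1r// pnatr_eq0. Qed.

Let s2 : R := sigma ^+ 2.
Let s20 : 0 < s2. Proof. by rewrite exprn_gt0. Qed.

(** Contribution of the pair (i, j). It uses up the whole dissipation [lam * s2] of [D1 i j] and
    half of that of [w1 j i]. The term [|w i| |D1 i j| |w1 j i|] is cubic; [|w i| <= M] makes it
    quadratic. *)
Let pair_bound i j :
  2 * lam * `|D i| * (C * (nu * (nu + `|w i| + `|w j|)))
  + 2 * `|w i| * (C * (nu * (nu + `|w i| + `|w j|) + `|D1 i j| * (nu + `|w1 j i|)
              + nu * `|w1 j i|)) <=
  nu * (3 * C * lam * D i ^+ 2 + (lam * C + 5 * C + 4 * C ^+ 2 / s2) * w i ^+ 2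
    + (lam * C + C) * w j ^+ 2 + (lam * C + C) * (nu * nu))
  + lam * s2 * D1 i j ^+ 2 + s2 / 2 * w1 j i ^+ 2.
Proof.
have := wM i; rewrite -(real_normK (num_real (D i))) -(real_normK (num_real (w i))).
rewrite -(real_normK (num_real (w j))) -(real_normK (num_real (D1 i j))).
rewrite -(real_normK (num_real (w1 j i))).
have : 0 <= `|D i| by []. have : 0 <= `|w i| by []. have : 0 <= `|w j| by [].
have : 0 <= `|D1 i j| by []. have : 0 <= `|w1 j i| by [].
move: (`|D i|) (`|w i|) (`|w j|) (`|D1 i j|) (`|w1 j i|) => d a b e f f0 e0 b0 a0 d0 aM.
have lC := mulr_ge0 (mulr_ge0 lam0 C0) (ltW nu0).
have Cn := mulr_ge0 C0 (ltW nu0).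
have P1 : 2 * lam * d * (C * (nu * (nu + a + b))) <=
    lam * C * nu * (3 * d ^+ 2 + nu ^+ 2 + a ^+ 2 + b ^+ 2).
  have -> : 2 * lam * d * (C * (nu * (nu + a + b))) =
    lam * C * nu * (2 * d * (nu + a + b)) by ring.
  apply: ler_wpM2l => //; rewrite -subr_ge0.
  have -> : 3 * d ^+ 2 + nu ^+ 2 + a ^+ 2 + b ^+ 2 - 2 * d * (nu + a + b) =
    (d - nu) ^+ 2 + (d - a) ^+ 2 + (d - b) ^+ 2 by ring.
  by rewrite !addr_ge0 ?sqr_ge0.
have P2 : 2 * a * (C * (nu * (nu + a + b))) <=
    C * nu * (4 * a ^+ 2 + nu ^+ 2 + b ^+ 2).
  have -> : 2 * a * (C * (nu * (nu + a + b))) = C * nu * (2 * a * (nu + a + b)) by ring.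
  apply: ler_wpM2l => //; rewrite -subr_ge0.
  have -> : 4 * a ^+ 2 + nu ^+ 2 + b ^+ 2 - 2 * a * (nu + a + b) =
    (a - nu) ^+ 2 + (a - b) ^+ 2 by ring.
  by rewrite !addr_ge0 ?sqr_ge0.
have P3 : 2 * a * (C * (e * nu)) <= C * nu * a ^+ 2 + C * e ^+ 2.
  have A : 2 * a * (C * (e * nu)) <= C * nu * (a ^+ 2 + e ^+ 2).
    have -> : 2 * a * (C * (e * nu)) = C * nu * (2 * a * e) by ring.
    apply: ler_wpM2l => //; rewrite -subr_ge0.
    have -> : a ^+ 2 + e ^+ 2 - 2 * a * e = (a - e) ^+ 2 by ring.
    by rewrite sqr_ge0.
  have B : C * nu * e ^+ 2 <= C * e ^+ 2.
    by rewrite ler_wpM2r ?sqr_ge0// ler_piMr.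
  by move: A; rewrite mulrDr; lra.
have P4 : 2 * a * (C * (e * f)) <= s2 / 4 * f ^+ 2 + 4 * C ^+ 2 * M ^+ 2 / s2 * e ^+ 2.
  have A : 2 * a * (C * (e * f)) <= 2 * f * (C * M * e).
    have -> : 2 * a * (C * (e * f)) = 2 * (C * (e * f)) * a by ring.
    have -> : 2 * f * (C * M * e) = 2 * (C * (e * f)) * M by ring.
    by apply: ler_wpM2l => //; rewrite !mulr_ge0.
  apply: (le_trans A); apply: (le_trans (young _ _ s20)).
  by rewrite le_eqVlt; apply/orP; left; apply/eqP; field; rewrite gt_eqF.
have P5 : 2 * a * (C * (nu * f)) <= s2 / 4 * f ^+ 2 + nu * (4 * C ^+ 2 / s2 * a ^+ 2).
  have -> : 2 * a * (C * (nu * f)) = 2 * f * (C * nu * a) by ring.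
  apply: (le_trans (young _ _ s20)); rewrite lerD2l.
  have -> : 4 * (C * nu * a) ^+ 2 / s2 = nu * (nu * (4 * C ^+ 2 / s2 * a ^+ 2)).
    by field; rewrite gt_eqF.
  rewrite ler_pM2l// ler_piMl//.
  by rewrite mulr_ge0 ?sqr_ge0// divr_ge0 ?(ltW s20)// mulr_ge0 ?sqr_ge0.
have E : lam * s2 * e ^+ 2 = C * e ^+ 2 + 4 * C ^+ 2 * M ^+ 2 / s2 * e ^+ 2.
  by rewrite /lam /energy_weight -/s2; field; rewrite gt_eqF.
rewrite E; move: P1 P2 P3 P4 P5; rewrite !mulrDr !expr2.
by lra.
Qed.

(** The right-hand side is the parabolic operator applied to the energy: by the product rule a
    square [h^2] yields [2 h L h + sigma^2 |grad h|^2], and the gradient squares absorb the first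
    order terms. The remaining constants are [nu^3] for each of [N^2] pairs, in total a multiple of
    [nu]. *)
Lemma energy_inequality :
  - (kap * (lam * \sum_i D i ^+ 2 + \sum_i w i ^+ 2)) - (lam * C + C) * nu <=
  \sum_i (lam * (2 * D i * LD i + s2 * \sum_j D1 i j ^+ 2)
          + (2 * w i * Lw i + s2 * \sum_j w1 i j ^+ 2)).
Proof.
pose SD := \sum_i D i ^+ 2; pose Sw := \sum_i w i ^+ 2.
pose SD1 := \sum_i \sum_j D1 i j ^+ 2; pose Sw1 := \sum_i \sum_j w1 i j ^+ 2.
pose P i j := nu * (nu + `|w i| + `|w j|).
pose Q i j := P i j + `|D1 i j| * (nu + `|w1 j i|) + nu * `|w1 j i|.
have A i : - (2 * lam * D i * LD i + 2 * w i * Lw i) <=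
    \sum_j (2 * lam * `|D i| * (C * P i j) + 2 * `|w i| * (C * Q i j))
    + (s2 / 4 * w1 i i ^+ 2 + 4 * C ^+ 2 * M ^+ 2 / s2 * w i ^+ 2).
  have A1 : - (2 * lam * D i * LD i) <= 2 * lam * `|D i| * (C * \sum_j P i j).
    rewrite -mulrN; apply: (le_trans (ler_norm _)).
    have l2 : 0 <= 2 * lam by apply: mulr_ge0 lam0.
    rewrite normrM normrN normrM (ger0_norm l2).
    by apply: ler_wpM2l (LD_le i); apply: mulr_ge0 l2 _.
  have A2 : - (2 * w i * Lw i) <= 2 * `|w i| * (C * (`|w i| * `|w1 i i|))
       + 2 * `|w i| * (C * \sum_j Q i j).
    rewrite -mulrDr -mulrN; apply: (le_trans (ler_norm _)).
    rewrite !normrM normrN (ger0_norm (_ : 0 <= 2 :> R))//.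
    by apply: ler_wpM2l (Lw_le i); rewrite !mulr_ge0.
  (* The diagonal term takes a further quarter of the dissipation of w. *)
  have A3 : 2 * `|w i| * (C * (`|w i| * `|w1 i i|)) <=
      s2 / 4 * w1 i i ^+ 2 + 4 * C ^+ 2 * M ^+ 2 / s2 * w i ^+ 2.
    have B : 2 * `|w i| * (C * (`|w i| * `|w1 i i|)) <= 2 * `|w1 i i| * (C * M * `|w i|).
      have -> : 2 * `|w i| * (C * (`|w i| * `|w1 i i|)) = 2 * (C * (`|w i| * `|w1 i i|)) * `|w i| by ring.
      have -> : 2 * `|w1 i i| * (C * M * `|w i|) = 2 * (C * (`|w i| * `|w1 i i|)) * M by ring.
      by apply: ler_wpM2l (wM i); rewrite !mulr_ge0.
    apply: (le_trans B); apply: (le_trans (young _ _ s20)).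
    rewrite !exprMn !real_normK ?num_real// le_eqVlt; apply/orP; left; apply/eqP.
    by field; rewrite gt_eqF.
  have -> : \sum_j (2 * lam * `|D i| * (C * P i j) + 2 * `|w i| * (C * Q i j)) =
    2 * lam * `|D i| * (C * \sum_j P i j) + 2 * `|w i| * (C * \sum_j Q i j).
    by rewrite big_split/= !mulr_sumr.
  by lra.
have B : - (\sum_i (2 * lam * D i * LD i + 2 * w i * Lw i)) <=
   3 * C * lam * SD + (2 * lam * C + 6 * C + 4 * C ^+ 2 / s2 + 4 * C ^+ 2 * M ^+ 2 / s2) * Sw
   + (lam * C + C) * nu + lam * s2 * SD1 + s2 / 2 * Sw1 + s2 / 4 * Sw1.
  rewrite -sumrN; apply: (le_trans (ler_sum _ (fun i _ => A i))).
  rewrite big_split/=.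
  have B1 : \sum_i (s2 / 4 * w1 i i ^+ 2 + 4 * C ^+ 2 * M ^+ 2 / s2 * w i ^+ 2) <=
      s2 / 4 * Sw1 + 4 * C ^+ 2 * M ^+ 2 / s2 * Sw.
    rewrite big_split/= -!mulr_sumr lerD2r ler_wpM2l ?divr_ge0 ?(ltW s20)//.
    apply: ler_sum => i _; rewrite (bigD1 i)//= lerDl sumr_ge0// => j _.
    exact: sqr_ge0.
  have B2 : \sum_i \sum_j (2 * lam * `|D i| * (C * P i j) + 2 * `|w i| * (C * Q i j)) <=
    3 * C * lam * SD + (2 * lam * C + 6 * C + 4 * C ^+ 2 / s2) * Sw
    + (lam * C + C) * nu + lam * s2 * SD1 + s2 / 2 * Sw1.
    apply: (le_trans (ler_sum _ (fun i _ => ler_sum _ (fun j _ => pair_bound i j)))).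
    pose be := lam * C + 5 * C + 4 * C ^+ 2 / s2; pose ga := lam * C + C.
    have row i : \sum_j (nu * (3 * C * lam * D i ^+ 2 + be * w i ^+ 2 + ga * w j ^+ 2
          + ga * (nu * nu)) + lam * s2 * D1 i j ^+ 2 + s2 / 2 * w1 j i ^+ 2) =
        (3 * C * lam * D i ^+ 2 + be * w i ^+ 2) + nu * (ga * Sw + ga * nu)
        + lam * s2 * (\sum_j D1 i j ^+ 2) + s2 / 2 * \sum_j w1 j i ^+ 2.
      rewrite !big_split/= -!mulr_sumr; congr (_ + _ + _).
      rewrite mulr_sumr.
      transitivity (\sum_j (nu * (3 * C * lam * D i ^+ 2 + be * w i ^+ 2)
          + nu * ga * w j ^+ 2 + nu * (ga * (nu * nu)))); first by apply: eq_bigr => j _; ring.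
      by rewrite !big_split/= !sum_nu -mulr_sumr -/Sw; ring.
    rewrite (eq_bigr _ (fun i _ => row i)) !big_split/= -!mulr_sumr -/SD -/Sw -/SD1.
    (* Each row was charged with the gradients [w1 j i] of the other players; the transposition
       disappears in the double sum. *)
    rewrite [X in _ + s2 / 2 * X]exchange_big/= -/Sw1.
    have -> : nu * (\sum_(i < n.+1) (ga * Sw + ga * nu)) = ga * Sw + ga * nu.
      by rewrite mulr_sumr sum_nu.
    rewrite /be /ga le_eqVlt; apply/orP; left; apply/eqP; ring.
  by lra.
have E : \sum_i (lam * (2 * D i * LD i + s2 * \sum_j D1 i j ^+ 2)
          + (2 * w i * Lw i + s2 * \sum_j w1 i j ^+ 2)) =
  \sum_i (2 * lam * D i * LD i + 2 * w i * Lw i) + lam * s2 * SD1 + s2 * Sw1.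
  rewrite /SD1 /Sw1 !mulr_sumr -!big_split/=; apply: eq_bigr => i _; ring.
rewrite E.
have Sw10 : 0 <= Sw1 by do 2! apply: sumr_ge0 => ? _; exact: sqr_ge0.
have S1 : 0 <= s2 / 4 * Sw1 by rewrite mulr_ge0 ?divr_ge0 ?(ltW s20).
have Sw0 : 0 <= Sw by apply: sumr_ge0 => ? _; exact: sqr_ge0.
have SD0 : 0 <= lam * SD by rewrite mulr_ge0//; apply: sumr_ge0 => ? _; exact: sqr_ge0.
have q0 : 0 <= 4 * C ^+ 2 / s2 by rewrite divr_ge0 ?(ltW s20)// mulr_ge0 ?sqr_ge0.
have q1 : 0 <= 4 * C ^+ 2 * M ^+ 2 / s2 by rewrite divr_ge0 ?(ltW s20)// !mulr_ge0 ?sqr_ge0.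
have kapE : kap = 9 * C + 2 * (lam * C) + 4 * C ^+ 2 / s2 + 4 * C ^+ 2 * M ^+ 2 / s2.
  by rewrite mulrA.
have lC := mulr_ge0 lam0 C0.
move: kapE q0 q1 B; set r0 := 4 * C ^+ 2 / s2; set r1 := 4 * C ^+ 2 * M ^+ 2 / s2.
clearbody r0 r1; move=> kapE q0 q1 B.
have K1 : 3 * C * (lam * SD) <= kap * (lam * SD).
  by apply: ler_wpM2r => //; rewrite kapE; move: C0; lra.
have K2 : (2 * lam * C + 6 * C + r0 + r1) * Sw <= kap * Sw.
  by apply: ler_wpM2r => //; rewrite kapE; move: C0; lra.
rewrite -/SD -/Sw mulrDr; lra.
Qed.

End energy_inequality.

Section gradient_estimate.
Variables (R : realType) (n : nat) (T sigma C M K : R).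
Hypotheses (sigma0 : 0 < sigma) (C0 : 0 <= C) (M0 : 0 <= M) (K0 : 0 <= K).
Let nu : R := n.+1%:R^-1.
Variable b : 'I_n.+1 -> R -> 'rV[R]_n.+1 -> R.
Variables D Dt w wt : 'I_n.+1 -> R -> 'rV[R]_n.+1 -> R.
Variables D1 D2 w1 w2 : 'I_n.+1 -> 'I_n.+1 -> R -> 'rV[R]_n.+1 -> R.
Let dom := [set p : R * 'rV[R]_n.+1 | p.1 \in `]0, T]].
Hypothesis D_cont : forall i, {within dom, continuous (fun p => D i p.1 p.2)}.
Hypothesis w_cont : forall i, {within dom, continuous (fun p => w i p.1 p.2)}.
Hypothesis D_t : forall i (t : R) x, t \in `]0, T[ ->
  is_derive t 1 (D i ^~ x) (Dt i t x) /\ is_derive t 1 (w i ^~ x) (wt i t x).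
Hypothesis D_x : forall i j (t : R) x, t \in `]0, T[ ->
  is_derive x (delta_mx 0 j) (D i t) (D1 i j t x) /\
  is_derive x (delta_mx 0 j) (w i t) (w1 i j t x).
Hypothesis D_xx : forall i j (t : R) x, t \in `]0, T[ ->
  is_derive x (delta_mx 0 j) (D1 i j t) (D2 i j t x) /\
  is_derive x (delta_mx 0 j) (w1 i j t) (w2 i j t x).
Hypothesis D_growth : forall i (t : R) x, t \in `]0, T] -> `|D i t x| <= K * rho x.
Hypothesis w_bound : forall i (t : R) x, t \in `]0, T] -> `|w i t x| <= M.
Hypothesis b_growth : forall j (t : R) x, t \in `]0, T[ -> b j t x ^+ 2 <= K * rho x.
Hypothesis D_T : forall i x, D i T x = 0 /\ w i T x = 0.
Hypothesis LD_le : forall i (t : R) x, t \in `]0, T[ ->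
  `|Dt i t x + sigma ^+ 2 / 2 * \sum_j D2 i j t x + \sum_j b j t x * D1 i j t x|
  <= C * \sum_j nu * (nu + `|w i t x| + `|w j t x|).
Hypothesis Lw_le : forall i (t : R) x, t \in `]0, T[ ->
  `|wt i t x + sigma ^+ 2 / 2 * \sum_j w2 i j t x + \sum_j b j t x * w1 i j t x|
  <= C * (`|w i t x| * `|w1 i i t x|) +
  C * \sum_j (nu * (nu + `|w i t x| + `|w j t x|)
              + `|D1 i j t x| * (nu + `|w1 j i t x|) + nu * `|w1 j i t x|).

(** The differential inequality for [Phi] is [energy_inequality] once the operator is expanded on
    squares. The part of the energy in [D] serves the absorption only and is dropped at the end. *)
Lemma gradient_estimate t x : t \in `]0, T] ->
  \sum_i w i t x ^+ 2 <= energy_bound T sigma C M / n.+1%:R.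
Proof.
move=> tT.
have s2 := sqr_ge0 sigma.
pose lam := energy_weight sigma C M; pose kap := energy_rate sigma C M.
have lam0 : 0 <= lam.
  apply: divr_ge0 => //; apply: addr_ge0 => //; apply: divr_ge0 => //.
  by rewrite !mulr_ge0 ?sqr_ge0.
have kap0 : 0 <= kap.
  rewrite /kap /energy_rate -/lam; have lC := mulr_ge0 lam0 C0.
  apply: addr_ge0; last by rewrite divr_ge0// !mulr_ge0 ?sqr_ge0.
  apply: addr_ge0; last by rewrite divr_ge0// !mulr_ge0 ?sqr_ge0.
  by move: C0; rewrite -mulrA; lra.
have nu0 : 0 <= nu by rewrite invr_ge0 ler0n.
pose Phi s y := lam * (\sum_i D i s y ^+ 2) + \sum_i w i s y ^+ 2.
(* A common growth constant for [Phi] and for the drift; it depends on the number of players, but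
   the maximum principle does not pass it on. *)
pose K1 := lam * (\sum_(i < n.+1) K ^+ 2) + \sum_(i < n.+1) M ^+ 2 + K.
have K10 : 0 <= K1.
  apply: addr_ge0 => //; apply: addr_ge0; first apply: mulr_ge0 => //.
    by apply: sumr_ge0 => i _; exact: sqr_ge0.
  by apply: sumr_ge0 => i _; exact: sqr_ge0.
suff H : Phi t x <= (lam * C + C) * nu * expR (kap * T) * T.
  apply: le_trans (_ : Phi t x <= _); last first.
    apply: (le_trans H); rewrite /energy_bound -/lam -/kap -/nu.
    by rewrite le_eqVlt; apply/orP; left; apply/eqP; ring.
  by rewrite lerDr mulr_ge0// sumr_ge0// => i _; exact: sqr_ge0.
pose Phi1 j s y := lam * (\sum_i 2 * D i s y * D1 i j s y) + \sum_i 2 * w i s y * w1 i j s y.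
pose Phi2 j s y := lam * (\sum_i (2 * D i s y * D2 i j s y + 2 * D1 i j s y * D1 i j s y))
  + \sum_i (2 * w i s y * w2 i j s y + 2 * w1 i j s y * w1 i j s y).
pose Phit s y := lam * (\sum_i 2 * D i s y * Dt i s y) + \sum_i 2 * w i s y * wt i s y.
have c0 : 0 <= (lam * C + C) * nu.
  by apply: mulr_ge0 => //; apply: addr_ge0 => //; apply: mulr_ge0.
refine (@maximum_principle R n T sigma kap ((lam * C + C) * nu) K1 b Phi Phit Phi1 Phi2
  kap0 c0 K10 _ _ _ _ _ _ _ _ t x tT).
- apply: within_add; last by apply: within_sum => i _; apply: within_sqr; exact: w_cont.
  apply: within_mul; first exact: within_cst.
  by apply: within_sum => i _; apply: within_sqr; exact: D_cont.
- move=> s y sT; apply: derive_add; first apply: derive_scale.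
    by apply: derive_sum => i _; apply: derive_sqr; have [] := D_t i y sT.
  by apply: derive_sum => i _; apply: derive_sqr; have [] := D_t i y sT.
- move=> j s y sT; apply: derive_add; first apply: derive_scale.
    by apply: derive_sum => i _; apply: derive_sqr; have [] := D_x i j y sT.
  by apply: derive_sum => i _; apply: derive_sqr; have [] := D_x i j y sT.
- move=> j s y sT.
  have P (f f1 : R -> 'rV[R]_n.+1 -> R) (f2 : R) : is_derive y (delta_mx 0 j) (f s) (f1 s y) ->
      is_derive y (delta_mx 0 j) (f1 s) f2 ->
      is_derive y (delta_mx 0 j) (fun z => 2 * f s z * f1 s z)
        (2 * f s y * f2 + 2 * f1 s y * f1 s y).
    by move=> F F1; exact: (derive_mul (derive_scale 2 F) F1).
  apply: derive_add; first apply: derive_scale.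
    apply: derive_sum => i _; have [F1 _] := D_x i j y sT; have [F2 _] := D_xx i j y sT.
    exact: (P _ _ _ F1 F2).
  apply: derive_sum => i _; have [_ F1] := D_x i j y sT; have [_ F2] := D_xx i j y sT.
  exact: (P _ _ _ F1 F2).
- move=> s y sT; have r1 := @rho_ge1 R n y.
  have r2 : 1 <= rho y ^+ 2 by rewrite exprn_ege1.
  have E1 : \sum_i D i s y ^+ 2 <= (\sum_(i < n.+1) K ^+ 2) * rho y ^+ 2.
    rewrite mulr_suml; apply: ler_sum => i _.
    by rewrite -exprMn -real_normK ?num_real// lerXn2r ?D_growth// nnegrE ?mulr_ge0// (le_trans ler01).
  have E2 : \sum_i w i s y ^+ 2 <= (\sum_(i < n.+1) M ^+ 2) * rho y ^+ 2.
    apply: le_trans (_ : \sum_(i < n.+1) M ^+ 2 <= _); last first.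
      by rewrite ler_peMr// sumr_ge0// => i _; exact: sqr_ge0.
    apply: ler_sum => i _.
    by rewrite -real_normK ?num_real// lerXn2r ?w_bound// nnegrE.
  have E3 := mulr_ge0 K0 (le_trans ler01 r2).
  have E4 := ler_wpM2l lam0 E1.
  by rewrite /Phi /K1; lra.
- move=> j s y sT; apply: (le_trans (b_growth j y sT)).
  apply: ler_wpM2r; first by rewrite (le_trans ler01)// rho_ge1.
  rewrite lerDr; apply: addr_ge0; first apply: mulr_ge0 => //.
    by apply: sumr_ge0 => i _; exact: sqr_ge0.
  by apply: sumr_ge0 => i _; exact: sqr_ge0.
- move=> s y sT.
  have sT' : s \in `]0, T] by move: sT; rewrite !in_itv/= => /andP[-> /ltW ->].
  have := @energy_inequality R sigma C M n sigma0 C0 M0 (fun i => D i s y) (fun i => w i s y) _ _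
    (fun i j => D1 i j s y) (fun i j => w1 i j s y) (fun i => w_bound i y sT')
    (fun i => LD_le i y sT) (fun i => Lw_le i y sT).
  rewrite -/lam -/kap -/nu /= => /le_trans; apply.
  rewrite /Phit /Phi1 /Phi2 le_eqVlt; apply/orP; left; apply/eqP.
  have E (f ft : 'I_n.+1 -> R) (f1 f2 : 'I_n.+1 -> 'I_n.+1 -> R) :
    \sum_i (2 * f i * (ft i + sigma ^+ 2 / 2 * \sum_j f2 i j + \sum_j b j s y * f1 i j)
       + sigma ^+ 2 * \sum_j f1 i j ^+ 2) =
    \sum_i 2 * f i * ft i + sigma ^+ 2 / 2 * (\sum_j \sum_i (2 * f i * f2 i j + 2 * f1 i j * f1 i j))
    + \sum_j b j s y * (\sum_i 2 * f i * f1 i j).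
    rewrite exchange_big/= mulr_sumr.
    under [X in _ = _ + X]eq_bigr => j _ do rewrite mulr_sumr.
    rewrite [X in _ = _ + X]exchange_big/= -!big_split/=; apply: eq_bigr => i _.
    rewrite !mulrDr !mulr_sumr -!addrA; congr (_ + _).
    rewrite -!big_split/= ; apply: eq_bigr => j _; by field.
  rewrite big_split/= -mulr_sumr.
  rewrite (E (fun i => D i s y) _ (fun i j => D1 i j s y) (fun i j => D2 i j s y)).
  rewrite (E (fun i => w i s y) _ (fun i j => w1 i j s y) (fun i j => w2 i j s y)).
  under [X in _ = _ + _ * X + _]eq_bigr => j _ do rewrite addrC.
  rewrite big_split/= -mulr_sumr.
  under [X in _ = _ + X]eq_bigr => j _ do rewrite mulrDr mulrCA.
  rewrite [X in _ = _ + X]big_split/= -mulr_sumr; ring.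
- move=> y; rewrite /Phi !big1 ?mulr0 ?addr0// => i _.
    by have [_ ->] := D_T i y; rewrite expr0n.
  by have [-> _] := D_T i y; rewrite expr0n.
Qed.

End gradient_estimate.

(** * Functions of an empirical measure *)

Section P1_equality.
Variable R : realType.

(** Different constructions, such as [mixture] at weight 1 and [emp], give the same measure; beyond
    the set function the records contain only proofs. *)
Lemma P1_ext (m m' : P1 R) : (forall A, m A = m' A) -> m = m'.
Proof.
case: m => p hp; case: m' => p' hp' /= E.
have pp' : p = p'.
  case: p hp E => f c hp; case: p' hp' => f' c' hp' /= E.
  have ff' : f = f' by apply/funext.
  subst f'; congr (Probability.Pack _).
  case: c {hp} => -[a1 a2] [a3] [a4] [a5] [a6] [a7] [a8].
  case: c' {hp' E} => -[b1 b2] [b3] [b4] [b5] [b6] [b7] [b8].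
  have -> : b1 = a1 by exact: Prop_irrelevance.
  have -> : b2 = a2 by exact: Prop_irrelevance.
  have -> : b3 = a3 by exact: Prop_irrelevance.
  have -> : b4 = a4 by exact: Prop_irrelevance.
  have -> : b5 = a5 by exact: Prop_irrelevance.
  have -> : b6 = a6 by exact: Prop_irrelevance.
  have -> : b7 = a7 by exact: Prop_irrelevance.
  by have -> : b8 = a8 by exact: Prop_irrelevance.
by subst p'; congr MkP1; exact: Prop_irrelevance.
Qed.

End P1_equality.

(** Passage from nonnegative to real integrands through positive and negative parts; integrability
    is implicit in [I] being real valued. *)
Lemma integral_real (R : realType) d (X : measurableType d)
    (mu : {measure set X -> \bar R}) (f : X -> R) (I : (X -> R) -> R) :
  measurable_fun setT f ->
  (forall g : X -> R, measurable_fun setT g -> (forall z, 0 <= g z) ->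
    (\int[mu]_z (g z)%:E)%E = (I g)%:E) ->
  \int[mu]_z f z = I (fun z => Num.max (f z) 0) - I (fun z => Num.max (- f z) 0).
Proof.
move=> mf H; rewrite /Rintegral integralE.
rewrite (_ : (\int[mu]_x (fun x => (f x)%:E)^\+ x)%E = (I (fun z => Num.max (f z) 0))%:E); last first.
  rewrite -H; first by apply: eq_integral => z _; rewrite funeposE EFin_max.
  - by apply: measurable_funrpos mf.
  - by move=> z; rewrite le_max lexx orbT.
rewrite (_ : (\int[mu]_x (fun x => (f x)%:E)^\- x)%E = (I (fun z => Num.max (- f z) 0))%:E) //.
rewrite -H; first by apply: eq_integral => z _; rewrite funenegE -EFinN EFin_max.
- by apply: measurable_funrneg mf.
- by move=> z; rewrite le_max lexx orbT.
Qed.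

Lemma max0B (R : realDomainType) (a : R) : Num.max a 0 - Num.max (- a) 0 = a.
Proof.
case/orP: (le_total 0 a) => a0.
  by rewrite (max_l a0) max_r ?oppr_le0// subr0.
by rewrite (max_r a0) max_l ?oppr_ge0// sub0r opprK.
Qed.

Section empirical_integrals.
Variables (R : realType) (n : nat).
Implicit Types (x y : 'rV[R]_n.+1) (f : R -> R).
Let nu : R := n.+1%:R^-1.

Lemma emp_ge0_integral x f : measurable_fun setT f -> (forall z, 0 <= f z) ->
  (\int[emp x]_z (f z)%:E)%E = (nu * \sum_k f (x 0 k))%:E.
Proof.
move=> mf f0; rewrite /emp/=.
have mf' : measurable_fun [set: R] (fun z => (f z)%:E) by apply/measurable_EFinP.
have f0' (z : R) : [set: R] z -> (0 <= (f z)%:E)%E by rewrite lee_fin.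
rewrite [LHS]ge0_integral_mscale//= ge0_integral_measure_sum//.
rewrite EFinM -sumEFin; congr (_ * _)%E; apply: eq_bigr => i _.
by rewrite integral_dirac// diracT mul1e inord_val.
Qed.

(** The weight used inside [mixture], given a name. *)
Definition clamp (h : R) : R := Num.min 1 (Num.max 0 h).

Lemma clamp_id h : 0 <= h -> h <= 1 -> clamp h = h.
Proof. by move=> h0 h1; rewrite /clamp max_r// min_r. Qed.

Lemma clamp_ge0 h : 0 <= clamp h.
Proof. by rewrite le_min ler01 le_max lexx. Qed.

Lemma clamp_le1 h : clamp h <= 1.
Proof. by rewrite ge_min lexx. Qed.

Lemma mixture_ge0_integral (m m' : P1 R) (h : R) f :
  measurable_fun setT f -> (forall z, 0 <= f z) ->
  (\int[mixture m m' h]_z (f z)%:E =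
   (1 - clamp h)%:E * \int[m]_z (f z)%:E + (clamp h)%:E * \int[m']_z (f z)%:E)%E.
Proof.
move=> mf f0.
have mf' : measurable_fun [set: R] (fun z => (f z)%:E) by apply/measurable_EFinP.
have f0' (z : R) : [set: R] z -> (0 <= (f z)%:E)%E by rewrite lee_fin.
by rewrite [LHS]ge0_integral_measure_add//= !ge0_integral_mscale.
Qed.

Lemma emp_integral x f : measurable_fun setT f ->
  \int[emp x]_z f z = nu * \sum_k f (x 0 k).
Proof.
move=> mf; pose I (g : R -> R) := nu * \sum_k g (x 0 k).
apply: (etrans (@integral_real R _ _ (emp x) f I mf _)).
  by move=> g mg g0; exact: emp_ge0_integral.
by rewrite /I -mulrBr -sumrB; under eq_bigr do rewrite max0B.
Qed.

Lemma mixture_emp_integral x y h f : measurable_fun setT f ->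
  \int[mixture (emp x) (emp y) h]_z f z =
  (1 - clamp h) * (nu * \sum_k f (x 0 k)) + clamp h * (nu * \sum_k f (y 0 k)).
Proof.
move=> mf; pose I (g : R -> R) :=
  (1 - clamp h) * (nu * \sum_k g (x 0 k)) + clamp h * (nu * \sum_k g (y 0 k)).
apply: (etrans (@integral_real R _ _ (mixture (emp x) (emp y) h) f I mf _)).
  by move=> g mg g0; rewrite mixture_ge0_integral// !emp_ge0_integral.
have E (u : 'rV[R]_n.+1) : \sum_k f (u 0 k) =
    \sum_k Num.max (f (u 0 k)) 0 - \sum_k Num.max (- f (u 0 k)) 0.
  by rewrite -sumrB; apply: eq_bigr => k _; rewrite max0B.
rewrite /I !E; ring.
Qed.

End empirical_integrals.

Lemma mixtureE (R : realType) (m m' : P1 R) (h : R) A : mixture m m' h A =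
  ((1 - clamp h)%:E * m A + (clamp h)%:E * m' A)%E.
Proof. by rewrite /mixture/= /mixture_fun measure_addE. Qed.

Lemma empE (R : realType) n (x : 'rV[R]_n.+1) (A : set R) : emp x A =
  ((n.+1%:R^-1)%:E * \sum_(k < n.+1) \d_(x 0%R (inord k)) A)%E.
Proof. by []. Qed.

Lemma mx_norm_coord (R : realType) n (v : 'rV[R]_n.+1) l : `|v 0 l| <= `|v|.
Proof.
rewrite [leRHS]/Num.norm /= mx_normrE; apply/bigmax_geP; right => /=.
by exists (0, l).
Qed.

(** * Coupling an empirical measure with a mixture *)

Section synchronous_coupling.
Variables (R : realType) (n : nat) (x y : 'rV[R]_n.+1) (h : R).

Let weight_ge0 : 0 <= n.+1%:R^-1 :> R. Proof. by rewrite invr_ge0 ler0n. Qed.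
Let onem_ge0 : 0 <= 1 - clamp h. Proof. by rewrite subr_ge0 clamp_le1. Qed.

Definition diracs (v : 'rV[R]_n.+1) :
    set (measurableTypeR R * measurableTypeR R)%type -> \bar R :=
  mscale (NngNum weight_ge0) (msum (fun k => \d_((x 0 (inord k), v 0 (inord k)) :
    (measurableTypeR R * measurableTypeR R)%type)) n.+1).

HB.instance Definition _ v := Measure.on (diracs v).

(** A fraction [clamp h] of the mass at each [x_k] is sent to [y_k], the rest stays in place. *)
Definition coupling_fun : set (measurableTypeR R * measurableTypeR R)%type -> \bar R :=
  measure_add (mscale (NngNum onem_ge0) (diracs x))
    (mscale (NngNum (clamp_ge0 h)) (diracs y)).

HB.instance Definition _ := Measure.on coupling_fun.

Let diracsE v A : diracs v A =
  ((n.+1%:R^-1)%:E * \sum_(k < n.+1) \d_((x 0%R (inord k), v 0%R (inord k))) A)%E.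
Proof. by []. Qed.

Let couplingE A : coupling_fun A =
  ((1 - clamp h)%:E * diracs x A + (clamp h)%:E * diracs y A)%E.
Proof. by rewrite /coupling_fun measure_addE. Qed.

Let coupling_setT : coupling_fun setT = 1%E.
Proof.
have S (v : 'rV[R]_n.+1) : (\sum_(k < n.+1) \d_((x 0%R (inord k), v 0%R (inord k)))
    [set: measurableTypeR R * measurableTypeR R] = (n.+1%:R : R)%:E)%E.
  rewrite (eq_bigr (fun=> 1%:E)); last by move=> i _; exact: diracT.
  by rewrite sumEFin sumr_const card_ord.
rewrite couplingE !diracsE !S -!EFinM mulVf ?pnatr_eq0// !mulr1.
by rewrite -EFinD subrK.
Qed.

HB.instance Definition _ :=
  Measure_isProbability.Build _ _ _ coupling_fun coupling_setT.

Definition synchronous : probability (measurableTypeR R * measurableTypeR R)%type R :=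
  coupling_fun.

Lemma synchronous_coupling :
  coupling (emp x) (mixture (emp x) (emp y) h) synchronous.
Proof.
have E (u v : 'rV[R]_n.+1) (A B : set R) :
    (\sum_(k < n.+1) \d_((u 0%R (inord k), v 0%R (inord k))) (A `*` B) =
    (\sum_(k < n.+1) (((u 0 (inord k) \in A) && (v 0 (inord k) \in B))%:R : R))%:E)%E.
  rewrite -sumEFin; apply: eq_bigr => k _; rewrite diracE; congr (_ %:R)%:E.
  by congr nat_of_bool; apply/idP/andP; rewrite !inE.
have E1 (u : 'rV[R]_n.+1) (A : set R) :
    (\sum_(k < n.+1) \d_(u 0%R (inord k)) A =
    (\sum_(k < n.+1) ((u 0 (inord k) \in A)%:R : R))%:E)%E.
  by rewrite -sumEFin; apply: eq_bigr => k _; rewrite diracE.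
move=> A mA; split.
  rewrite [LHS]couplingE [RHS]empE !diracsE !E E1 -!EFinM -EFinD; congr EFin.
  rewrite -mulrDl subrK mul1r; congr (_ * _); apply: eq_bigr => k _.
  by rewrite in_setT andbT.
rewrite [LHS]couplingE [RHS]mixtureE !empE !diracsE !E !E1 -!EFinM -!EFinD.
by congr EFin; congr (_ * (_ * _) + _ * (_ * _)); apply: eq_bigr => k _; rewrite in_setT.
Qed.

(** Only the moved mass has a cost, at most [|y - x|]. The bound is uniform in [h]: the whole
    segment from [emp x] to [emp y] is close to [emp x] when [y] is close to [x]. *)
Lemma W1_mixture : (W1 (emp x) (mixture (emp x) (emp y) h) <= `|y - x|%:E)%E.
Proof.
apply: ereal_inf_le; exists (\int[synchronous]_p `|p.1 - p.2|%:E)%E.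
  by exists synchronous => //; exact: synchronous_coupling.
have mf : measurable_fun [set: measurableTypeR R * measurableTypeR R]
    (fun p => `|p.1 - p.2|%:E).
  apply/measurable_EFinP; apply: measurableT_comp; first exact: normr_measurable.
  by apply: measurable_funB; [exact: measurable_fst|exact: measurable_snd].
have I (v : 'rV[R]_n.+1) : (\int[diracs v]_p `|p.1 - p.2|%:E =
   (n.+1%:R^-1 * \sum_(k < n.+1) `|x 0 (inord k) - v 0 (inord k)|)%:E)%E.
  rewrite [LHS]ge0_integral_mscale//= ge0_integral_measure_sum//.
  rewrite EFinM -sumEFin; congr (_ * _)%E; apply: eq_bigr => i _.
  by rewrite integral_dirac// diracT mul1e.
have -> : (\int[synchronous]_p `|p.1 - p.2|%:E = (1 - clamp h)%:E *
    \int[diracs x]_p `|p.1 - p.2|%:E + (clamp h)%:E * \int[diracs y]_p `|p.1 - p.2|%:E)%E.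
  rewrite [LHS]ge0_integral_measure_add//.
  by congr (_ + _)%E; exact: ge0_integral_mscale.
rewrite !I -!EFinM -EFinD lee_fin [X in _ * (_ * X) + _]big1; last first.
  by move=> k _; rewrite subrr normr0.
rewrite !mulr0 add0r; apply: le_trans (_ : 1 * (n.+1%:R^-1 * \sum_(k < n.+1) `|y - x|) <= _).
  apply: ler_pM; rewrite ?clamp_ge0 ?clamp_le1 ?mulr_ge0 ?sumr_ge0//.
  rewrite ler_wpM2l//; apply: ler_sum => k _.
  by rewrite distrC; have := mx_norm_coord (y - x) (inord k); rewrite !mxE.
by rewrite sumr_const card_ord mul1r -[`|_| *+ _]mulr_natr mulrCA mulVf ?mulr1// pnatr_eq0.
Qed.

End synchronous_coupling.

Section empirical_topology.
Variables (R : realType) (n : nat).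
Implicit Types (x y : 'rV[R]_n.+1).

Lemma emp_fin x A : exists a : R, emp x A = a%:E.
Proof.
exists (n.+1%:R^-1 * \sum_(k < n.+1) (x 0 (inord k) \in A)%:R).
rewrite empE EFinM -sumEFin; congr (_ * _)%E.
Qed.

Lemma mixture_emp0 x y : mixture (emp x) (emp y) 0 = emp x.
Proof.
apply: P1_ext => A; rewrite mixtureE clamp_id//.
have [a ->] := emp_fin x A; have [b ->] := emp_fin y A.
by rewrite -!EFinM -EFinD; congr EFin; ring.
Qed.

Lemma mixture_emp1 x y : mixture (emp x) (emp y) 1 = emp y.
Proof.
apply: P1_ext => A; rewrite mixtureE clamp_id//.
have [a ->] := emp_fin x A; have [b ->] := emp_fin y A.
by rewrite -!EFinM -EFinD; congr EFin; ring.
Qed.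

(** The flat derivative only gives right derivatives at the start of a segment. Restarting at an
    interior point towards [emp y] stays on the same segment; restarting towards [emp x], in the
    next lemma, runs it backwards. *)
Lemma mixture_forward x y (h r : R) : 0 <= h <= 1 -> 0 <= r <= 1 ->
  mixture (mixture (emp x) (emp y) h) (emp y) r =
  mixture (emp x) (emp y) (h + r * (1 - h)).
Proof.
move=> /andP[h0 h1] /andP[r0 r1].
have c0 : 0 <= h + r * (1 - h) by nra.
have c1 : h + r * (1 - h) <= 1 by nra.
apply: P1_ext => A; rewrite !mixtureE !clamp_id//.
have [a ->] := emp_fin x A; have [b ->] := emp_fin y A.
by rewrite -!(EFinM, EFinD); congr EFin; ring.
Qed.

Lemma mixture_backward x y (h r : R) : 0 <= h <= 1 -> 0 <= r <= 1 ->
  mixture (mixture (emp x) (emp y) h) (emp x) r =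
  mixture (emp x) (emp y) (h - r * h).
Proof.
move=> /andP[h0 h1] /andP[r0 r1].
have c0 : 0 <= h - r * h by nra.
have c1 : h - r * h <= 1 by nra.
apply: P1_ext => A; rewrite !mixtureE !clamp_id//.
have [a ->] := emp_fin x A; have [b ->] := emp_fin y A.
by rewrite -!(EFinM, EFinD); congr EFin; ring.
Qed.

Lemma mixture_emp_nbhs x A : nbhs (emp x) A -> exists2 e : R, 0 < e &
  forall y h, `|y - x| < e -> A (mixture (emp x) (emp y) h).
Proof.
rewrite nbhsE => -[B [oB Bx] BA].
have [e e0 H] := oB _ Bx; exists e => // y h yx.
by apply/BA/H; apply: (le_lt_trans (W1_mixture _ _ _)); rewrite lte_fin.
Qed.

Lemma emp_continuous : continuous (@emp R n : 'rV[R]_n.+1 -> P1 R).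
Proof.
move=> x A /mixture_emp_nbhs[e e0 H]; apply/nbhs_ballP; exists e => // y.
rewrite mx_norm_ball /ball_/= -normrN opprB => /(H y 1).
by rewrite mixture_emp1.
Qed.

End empirical_topology.

Lemma pair_continuous (X Y : topologicalType) (m : X) : continuous (fun z : Y => (m, z)).
Proof.
move=> z; rewrite /continuous_at.
by apply: (@cvg_pair _ _ _ _ (nbhs m) (nbhs z) _ _ _ (fun=> m) id); [exact: cvg_cst|exact: cvg_id].
Qed.

(** * Derivatives in the measure and their mean value theorem *)

Section flat_derivative_theory.
Variables (R : realType) (q : P1 R -> R).
Hypothesis dq : mderivable q.
Local Notation D := (flat_derivative q).

Lemma flat_derivativeP : is_flat_derivative q D.
Proof. by case: dq => d Hd _; apply: xgetPex; exists d. Qed.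

Lemma flat_continuous m : continuous (D m).
Proof.
have [C _ _ _] := flat_derivativeP; move=> z.
apply: (@continuous_comp _ _ _ (fun z : R => (m, z)) (fun p => D p.1 p.2)).
  exact: pair_continuous.
exact: C.
Qed.

Lemma flat_measurable m : measurable_fun setT (D m).
Proof. by apply: continuous_measurable_fun; exact: flat_continuous. Qed.

(** Testing the direction of a Dirac mass, the empirical measure of one point, isolates the value at
    [z], since the integral against [m] vanishes by normalization. *)
Lemma flat_derivative_unique d : is_flat_derivative q d -> d = D.
Proof.
move=> [Cd _ Ld Nd]; have [_ _ LD ND] := flat_derivativeP.
apply/funext => m; apply/funext => z.
have E : \int[emp (const_mx z : 'rV_1)]_u d m u = \int[emp (const_mx z : 'rV_1)]_u D m u.
  have := cvg_unique _ (Ld m (emp (const_mx z : 'rV_1))) (LD m _).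
  by rewrite Nd ND !subr0; apply => //; exact: Rhausdorff.
have md : measurable_fun setT (d m).
  apply: continuous_measurable_fun => u.
  apply: (@continuous_comp _ _ _ (fun z : R => (m, z)) (fun p => d p.1 p.2)).
    exact: pair_continuous.
  exact: Cd.
move: E; rewrite !emp_integral ?big_ord_recl ?big_ord0 ?mxE ?invr1 ?mul1r ?addr0//.
exact: flat_measurable.
Qed.

Lemma is_derive_flat (m : P1 R) (z : R) : is_derive z 1 (D m) (mderive q m z).
Proof.
case: dq => d Hd Dd; rewrite /mderive derive1E -(flat_derivative_unique Hd).
exact/derivableP/Dd.
Qed.

Lemma flat_right_derivative (m m' : P1 R) e : 0 < e -> exists2 del : R, 0 < del &
  forall r, 0 < r -> r < del ->
  `|q (mixture m m' r) - q m - (\int[m']_z D m z - \int[m]_z D m z) * r| <= e * r.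
Proof.
move=> e0; have [_ _ L _] := flat_derivativeP.
have N : \forall r \near (0 : R), 0 < r ->
    `|(\int[m']_z D m z - \int[m]_z D m z) - (q (mixture m m' r) - q m) / r| <= e.
  exact: (@cvgr_dist_le _ _ _ _ _ _ _ (L m m') e e0).
have [del del0 H] := iffLR (near0P _) N.
exists del => // r r0 rdel.
have rd : `|r| < del by rewrite gtr0_norm.
have := H r rd r0; rewrite -normrN opprB => A.
have -> : q (mixture m m' r) - q m - (\int[m']_z D m z - \int[m]_z D m z) * r =
  ((q (mixture m m' r) - q m) / r - (\int[m']_z D m z - \int[m]_z D m z)) * r.
  by field; rewrite gt_eqF.
by rewrite normrM (gtr0_norm r0) ler_wpM2r// ltW.
Qed.

End flat_derivative_theory.

Section measure_mean_value.
Variables (R : realType) (n : nat) (q : P1 R -> R).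
Hypothesis dq : mderivable q.
Local Notation D := (flat_derivative q).
Variables (x y : 'rV[R]_n.+1).

Let m h := mixture (emp x) (emp y) h.
Let phi h := q (m h).
Let S h (u : 'rV[R]_n.+1) := n.+1%:R^-1 * \sum_k D (m h) (u 0 k).
Let l h := S h y - S h x.

(** Mixing a fraction [r] of [emp y] into [m h] advances the parameter by [r (1 - h)]; hence
    [r = k / (1 - h)] and the tolerance [e (1 - h)]. *)
Let right_slope h e : 0 <= h -> h < 1 -> 0 < e -> exists2 del : R, 0 < del &
  forall k, 0 < k -> k < del -> `|phi (h + k) - phi h - l h * k| <= e * k.
Proof.
move=> h0 h1 e0; have a0 : 0 < 1 - h by lra.
have [del del0 H] := flat_right_derivative dq (m h) (emp y) (mulr_gt0 e0 a0).
exists (Num.min del 1 * (1 - h)); first by rewrite mulr_gt0// lt_min del0 ltr01.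
move=> k k0; rewrite -ltr_pdivrMr// lt_min => /andP[kd k1].
have r0 : 0 < k / (1 - h) by rewrite divr_gt0.
have := H _ r0 kd; rewrite mixture_forward ?h0 ?(ltW h1) ?(ltW r0) ?(ltW k1)//.
rewrite mulfVK ?gt_eqF//.
have mD := flat_measurable dq (m h).
rewrite mixture_emp_integral// emp_integral// clamp_id// ?(ltW h1)//.
rewrite -/(S h x) -/(S h y) => A.
have -> : l h * k = (S h y - ((1 - h) * S h x + h * S h y)) * (k / (1 - h)).
  by rewrite /l; field; rewrite gt_eqF.
apply: (le_trans A).
by rewrite le_eqVlt; apply/orP; left; apply/eqP; field; rewrite gt_eqF.
Qed.

(** Mixing in [emp x] instead moves the parameter back by [r h]. *)
Let left_slope h e : 0 < h -> h <= 1 -> 0 < e -> exists2 del : R, 0 < del &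
  forall k, 0 < k -> k < del -> `|phi (h - k) - phi h + l h * k| <= e * k.
Proof.
move=> h0 h1 e0.
have [del del0 H] := flat_right_derivative dq (m h) (emp x) (mulr_gt0 e0 h0).
exists (Num.min del 1 * h); first by rewrite mulr_gt0// lt_min del0 ltr01.
move=> k k0; rewrite -ltr_pdivrMr// lt_min => /andP[kd k1].
have r0 : 0 < k / h by rewrite divr_gt0.
have := H _ r0 kd; rewrite mixture_backward ?h1 ?(ltW h0) ?(ltW r0) ?(ltW k1)//.
rewrite mulfVK ?gt_eqF//.
have mD := flat_measurable dq (m h).
rewrite mixture_emp_integral// emp_integral// clamp_id// ?(ltW h0)//.
rewrite -/(S h x) -/(S h y) => A.
have -> : l h * k = - ((S h x - ((1 - h) * S h x + h * S h y)) * (k / h)).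
  by rewrite /l; field; rewrite gt_eqF.
apply: (le_trans A).
by rewrite le_eqVlt; apply/orP; left; apply/eqP; field; rewrite gt_eqF.
Qed.

Let phi_derive (h : R) : 0 < h < 1 -> is_derive h 1 phi (l h).
Proof.
move=> /andP[h0 h1]; apply/(is_derive_line0 (V := R^o))/is_derive0P => e e0.
have [d1 d10 H1] := right_slope (ltW h0) h1 e0.
have [d2 d20 H2] := left_slope h0 (ltW h1) e0.
apply/near0P; exists (Num.min d1 d2); first by rewrite lt_min d10.
move=> k; rewrite lt_min => /andP[k1 k2].
rewrite scale0r addr0 [k *: _]mulr1.
have [k0|k0|->] := ltgtP k 0.
- rewrite ltr0_norm// in k2 *; have := H2 (- k); rewrite oppr_gt0 opprK mulrN => /(_ k0 k2).
  by [].
- by rewrite gtr0_norm// in k1 *; apply: H1.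
- by rewrite addr0 subrr mulr0 subrr normr0 mulr0.
Qed.

Let phi_continuous : {within `[0, 1], continuous phi}.
Proof.
have K a : phi a = phi a by [].
have lim1 (f : R -> R) a c (H : forall e, 0 < e -> exists2 del : R, 0 < del &
  forall k, 0 < k -> k < del -> `|f k - a - c * k| <= e * k) :
  forall e, 0 < e -> exists2 del : R, 0 < del & forall k, 0 < k -> k < del -> `|a - f k| <= e.
  move=> e e0; have [del del0 D1] := H 1 ltr01.
  exists (Num.min del (e / (1 + `|c|))); first by rewrite lt_min del0 divr_gt0// ltr_pwDl.
  move=> k k0; rewrite lt_min ltr_pdivlMr ?ltr_pwDl// => /andP[kd ke].
  have := D1 k k0 kd; rewrite mul1r => A; rewrite -normrN opprB.
  have -> : f k - a = (f k - a - c * k) + c * k by rewrite subrK.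
  rewrite (le_trans (ler_normD _ _))// normrM (gtr0_norm k0).
  by rewrite (le_trans (lerD A (lexx _)))//; lra.
apply/continuous_within_itvP; first exact: ltr01.
split.
- move=> h; rewrite in_itv/= => h01; apply: is_derive_continuous; exact: phi_derive.
- apply/cvgrPdist_le => e e0.
  have [del del0 H] := lim1 (fun k => phi (0 + k)) _ _ (fun e => @right_slope 0 e (lexx 0) ltr01) e e0.
  rewrite near_withinE; apply/near0P; exists del => // k kd k0.
  by have := H k k0; rewrite add0r; apply; rewrite gtr0_norm in kd.
- apply/cvgrPdist_le => e e0.
  have Hl e' : 0 < e' -> exists2 del : R, 0 < del &
     forall k, 0 < k -> k < del -> `|phi (1 - k) - phi 1 - (- l 1) * k| <= e' * k.
    move=> e'0; have [del del0 H] := left_slope ltr01 (lexx 1) e'0.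
    by exists del => // k k0 kd; rewrite mulNr opprK; exact: H.
  have [del del0 H] := lim1 (fun k => phi (1 - k)) _ _ Hl e e0.
  rewrite near_withinE; apply/nbhs_ballP; exists del => // k kd k1.
  have := H (1 - k); rewrite subKr subr_gt0; apply => //.
  by move: kd; rewrite /ball/= gtr0_norm// subr_gt0.
Qed.

(** The ordinary mean value theorem for [q] along the segment of mixtures: right and left slopes
    agree inside, and the one-sided slopes give continuity at the ends. *)
Lemma measure_mean_value : exists2 h, 0 <= h <= 1 & q (emp y) - q (emp x) =
  n.+1%:R^-1 * \sum_k (D (mixture (emp x) (emp y) h) (y 0 k)
                        - D (mixture (emp x) (emp y) h) (x 0 k)).
Proof.
have [|h] := @MVT R phi l 0 1 ltr01 _ phi_continuous.
  by move=> h; rewrite in_itv/=; exact: phi_derive.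
rewrite in_itv/= => /andP[h0 h1] E; exists h; first by rewrite !ltW.
move: E; rewrite /phi /m mixture_emp0 mixture_emp1 subr0 mulr1 => ->.
by rewrite /l /S -mulrBr -sumrB.
Qed.

End measure_mean_value.

Lemma mx_norm_le (R : realType) n (v : 'rV[R]_n) (c : R) : 0 <= c ->
  (forall l, `|v 0 l| <= c) -> `|v| <= c.
Proof.
move=> c0 H; rewrite [leLHS]/Num.norm /= mx_normrE; apply/bigmax_leP; split => //= -[i l] _.
by rewrite (ord1 i).
Qed.

Section empirical_derivative.
Variables (R : realType) (n : nat) (q : P1 R -> R).
Hypothesis dq : mderivable q.
Local Notation D := (flat_derivative q).
Implicit Types (x y : 'rV[R]_n.+1).

(** Two mean value theorems in succession: along the segment of measures, then in the space argument
    of the flat derivative at the intermediate measure. *)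
Lemma emp_Lipschitz K x y : (forall m z, `|mderive q m z| <= K) ->
  `|q (emp y) - q (emp x)| <= K * (n.+1%:R^-1 * \sum_k `|y 0 k - x 0 k|).
Proof.
move=> H; have [h _ ->] := measure_mean_value dq x y.
rewrite normrM ger0_norm ?invr_ge0 ?ler0n// mulrCA ler_wpM2l ?invr_ge0 ?ler0n//.
rewrite mulr_sumr (le_trans (ler_norm_sum _ _ _))//; apply: ler_sum => k _.
set m := mixture _ _ _.
have [c _ ->] := mean_value (fun z (_ : `|z - x 0 k| <= `|y 0 k - x 0 k|) => is_derive_flat dq m z).
by rewrite normrM ler_wpM2r.
Qed.

(** Moving one particle of mass [1 / N]. The intermediate measure and the intermediate point of the
    two mean value theorems both tend to [(emp x, x_j)], where the intrinsic derivative is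
    continuous. *)
Lemma derive_emp x j :
  {for (emp x, x 0 j), continuous (fun p => mderive q p.1 p.2)} ->
  is_derive x (delta_mx 0 j) (fun y => q (emp y))
    (n.+1%:R^-1 * mderive q (emp x) (x 0 j)).
Proof.
move=> C; apply/is_derive_line0/is_derive0P => e e0.
have [[A B] [/= nA nB] AB] : \forall p \near (emp x, x 0 j),
  `|mderive q (emp x) (x 0 j) - mderive q p.1 p.2| <= e.
  exact: (@cvgr_dist_le _ _ _ _ _ _ _ C e e0).
have [d1 d10 H1] := mixture_emp_nbhs nA.
have /nbhs_ballP[d2 d20 H2] := nB.
apply/near0P; exists (Num.min d1 d2); first by rewrite lt_min d10.
move=> s; rewrite lt_min => /andP[s1 s2]; rewrite scale0r addr0.
set y := x + s *: delta_mx 0 j.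
have yk k : y 0 k - x 0 k = s * (k == j)%:R.
  by rewrite !mxE eqxx /=; ring.
have [h _ ->] := measure_mean_value dq x y.
set m := mixture _ _ _.
have yx : `|y - x| < d1.
  apply: le_lt_trans s1; apply: mx_norm_le => // k.
  have -> : (y - x) 0 k = s * (k == j)%:R by rewrite -yk !mxE.
  by rewrite normrM; case: eqP => _; rewrite ?normr1 ?mulr1 ?normr0 ?mulr0.
rewrite (bigD1 j)//= big1 ?addr0; last first.
  move=> k /negPf kj; have := yk k; rewrite kj mulr0 => /eqP.
  by rewrite subr_eq0 => /eqP ->; rewrite subrr.
have [c cj ->] := mean_value (fun z (_ : `|z - x 0 j| <= `|y 0 j - x 0 j|) => is_derive_flat dq m z).
rewrite yk eqxx mulr1 in cj *.
have cB : B c by apply: H2; rewrite /ball/= distrC; apply: le_lt_trans cj _.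
have := AB (m, c) (conj (H1 y h yx) cB); rewrite /= => E.
have -> : n.+1%:R^-1 * (mderive q m c * s) - n.+1%:R^-1 * mderive q (emp x) (x 0 j) * s =
  - (n.+1%:R^-1 * (mderive q (emp x) (x 0 j) - mderive q m c) * s) by ring.
rewrite normrN !normrM ler_wpM2r// ger0_norm ?invr_ge0 ?ler0n//.
by apply: le_trans E; rewrite ler_piMl// invf_le1 ?ltr0n// ler1n.
Qed.

End empirical_derivative.

(** * Chain rule for fields at empirical measures *)

Section row_convergence.
Variables (R : realType).

Lemma cvg_row (I : Type) (F : set_system I) (FF : Filter F) k
    (f : I -> 'rV[R]_k) (v : 'rV[R]_k) :
  (forall l, (fun i => f i 0 l) @ F --> v 0 l) -> f @ F --> v.
Proof.
move=> H A [P nP PA].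
have N : \forall i \near F, forall l, P 0 l (f i 0 l).
  by apply: filter_forall => l; exact: (H l _ (nP 0 l)).
by apply: filterS N => i Pi; apply: PA => a l; rewrite (ord1 a).
Qed.

Lemma cvg_coord (I : Type) (F : set_system I) (FF : Filter F) k
    (f : I -> 'rV[R]_k) (v : 'rV[R]_k) l :
  f @ F --> v -> (fun i => f i 0 l) @ F --> v 0 l.
Proof. by move=> H; apply: cvg_trans (@coord_continuous R 1 k 0 l v); exact: cvg_app H. Qed.

Lemma is_derive_dirZ (V : normedModType R) (f : V -> R) x v (c l : R) :
  is_derive x v f l -> is_derive x (c *: v) f (c * l).
Proof.
move=> /is_derive_line0 H; apply/is_derive_line0.
have H0 : is_derive (c * 0) 1 (fun r : R => f (x + r *: v)) l by rewrite mulr0.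
have H1 : is_derive (0 : R) 1 (fun s : R => c * s) (c * 1).
  by apply: derive_scale; exact: is_derive_id.
have := @is_derive1_comp R _ _ _ _ _ H0 H1; rewrite mulr1 mulrC.
by congr is_derive; apply/funext => s /=; rewrite scalerA mulrC.
Qed.

(* Partial derivatives that exist and are continuous determine every
   directional derivative. *)
Lemma is_derive_row k (G : 'rV[R]_k -> R) (Gl : 'I_k -> 'rV[R]_k -> R) z c :
  (forall l u, is_derive u (delta_mx 0 l) G (Gl l u)) ->
  (forall l, {for z, continuous (Gl l)}) ->
  is_derive z (\row_l c l) G (\sum_l c l * Gl l z).
Proof.
move=> H C.
have -> : \row_l c l = \sum_l c l *: delta_mx 0 l.
  by rewrite [LHS]row_sum_delta; apply: eq_bigr => l _; rewrite mxE.
elim: (index_enum _) => [|l r IH]; first by rewrite !big_nil; exact: is_derive0.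
rewrite !big_cons; set v := \sum_(j <- r) _; set w := \sum_(j <- r) _.
apply/is_derive_line0.
have IH' : is_derive (0 : R) 1 (fun s => G (z + s *: v)) w.
  exact: (iffLR (is_derive_line0 _ _ _ _) IH).
(* One coordinate is added at a time: [s] moves along the new direction and [p] along those already
   treated. *)
pose f (s p : R) := G (z + s *: (c l *: delta_mx 0 l) + p *: v).
pose f1 (s p : R) := c l * Gl l (z + s *: (c l *: delta_mx 0 l) + p *: v).
have := @is_derive_diag R f f1 w.
have -> : f1 0 0 = c l * Gl l z by rewrite /f1 !scale0r !addr0.
have -> : (fun s => f s s) = fun s => G (z + s *: (c l *: delta_mx 0 l + v)).
  by apply/funext => s; rewrite /f scalerDr addrA.
apply.
- move=> s p; rewrite /f /f1.
  have E u : z + u *: (c l *: delta_mx 0 l) + p *: v = (z + p *: v) + u *: (c l *: delta_mx 0 l).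
    by rewrite addrAC.
  rewrite E (_ : (fun _ => _) = fun u => G ((z + p *: v) + u *: (c l *: delta_mx 0 l))).
    exact: (iffLR (is_derive_line _ _ _ _ _) (is_derive_dirZ (c l) (H l _))).
  by apply/funext => u; rewrite E.
- by rewrite /f; under eq_fun do rewrite scale0r addr0.
- apply: continuousM; first exact: cst_continuous.
  apply: continuous_comp; last by rewrite /= !scale0r !addr0; exact: C.
  apply: continuousD; first apply: continuousD.
  + exact: cst_continuous.
  + by apply: continuousZr_tmp; exact: cvg_fst.
  + by apply: continuousZr_tmp; exact: cvg_snd.
Qed.

End row_convergence.

Section fields_at_empirical_measures.
Variables (R : realType) (T : R) (n : nat).
Let nu : R := n.+1%:R^-1.

Lemma mfield_cvg k (F : mfield R k) (I : Type) (Phi : set_system I)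
    (FF : Filter Phi) (tau xi : I -> R) (mu : I -> P1 R) (zeta : I -> 'rV[R]_k) t x m z :
  mfield_continuous T F -> t \in `[0, T] ->
  (\forall i \near Phi, tau i \in `[0, T]) -> tau @ Phi --> t ->
  xi @ Phi --> x -> mu @ Phi --> m -> zeta @ Phi --> z ->
  (fun i => F (tau i) (xi i) (mu i) (zeta i)) @ Phi --> F t x m z.
Proof.
move=> /subspace_continuousP C tT tauT Ht Hx Hm Hz W nW.
have P : (fun i => (tau i, xi i, mu i, zeta i)) @ Phi --> (t, x, m, z).
  apply: (@cvg_pair _ _ _ _ (nbhs (t, x, m)) (nbhs z)) => //.
  apply: (@cvg_pair _ _ _ _ (nbhs (t, x)) (nbhs m)) => //.
  exact: (@cvg_pair _ _ _ _ (nbhs t) (nbhs x)).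
have := P _ (C (t, x, m, z) tT W nW).
move: tauT; apply: filterS2 => i ti; exact.
Qed.

Lemma mfield_cvg_fixed k (F : mfield R k) (I : Type) (Phi : set_system I)
    (FF : Filter Phi) (xi : I -> R) (mu : I -> P1 R) (zeta : I -> 'rV[R]_k) t x m z :
  mfield_continuous T F -> t \in `[0, T] ->
  xi @ Phi --> x -> mu @ Phi --> m -> zeta @ Phi --> z ->
  (fun i => F t (xi i) (mu i) (zeta i)) @ Phi --> F t x m z.
Proof.
move=> C tT; apply: (@mfield_cvg _ _ _ _ _ (fun=> t)) => //; last exact: cvg_cst.
exact: nearW.
Qed.

(** Appends in last position, where [dm] places its new argument. *)
Definition snoc k (a : 'I_k -> 'I_n.+1) (j : 'I_n.+1) : 'I_k.+1 -> 'I_n.+1 :=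
  fun l => if unlift ord_max l is Some l' then a l' else j.

Definition select k (a : 'I_k -> 'I_n.+1) (x : 'rV[R]_n.+1) : 'rV[R]_k :=
  \row_l x 0 (a l).

Definition rsnoc k (z : 'rV[R]_k) (c : R) : 'rV[R]_k.+1 :=
  \row_l if unlift ord_max l is Some l' then z 0 l' else c.

Lemma rsnoc_col' k (z : 'rV[R]_k) c : col' ord_max (rsnoc z c) = z.
Proof. by apply/rowP => l; rewrite !mxE liftK. Qed.

Lemma rsnoc_last k (z : 'rV[R]_k) c : rsnoc z c 0 ord_max = c.
Proof. by rewrite mxE unlift_none. Qed.

Lemma select_snoc k (a : 'I_k -> 'I_n.+1) j x :
  select (snoc a j) x = rsnoc (select a x) (x 0 j).
Proof. by apply/rowP => l; rewrite !mxE /snoc; case: unliftP => [l' _|_]; rewrite ?mxE. Qed.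

(* Restriction of a field to [x = x_i], [m = emp x] and [z_l = x_(a l)]. *)
Definition pull k (F : mfield R k) (i : 'I_n.+1) (a : 'I_k -> 'I_n.+1) :
    R -> 'rV[R]_n.+1 -> R :=
  fun t x => F t (x 0 i) (emp x) (select a x).

(** [x_j] acts in three ways: as the player's own state, through its mass [nu] in the empirical
    measure, and as one of the arguments [z_l]. The family [Fz] is a parameter because [dz] makes
    sense only for a positive number of arguments. *)
Definition pull_pd k (F : mfield R k) (Fz : 'I_k -> mfield R k) i a (j : 'I_n.+1) :
    R -> 'rV[R]_n.+1 -> R :=
  fun t x => (i == j)%:R * pull (dx F) i a t x + nu * pull (dm F) i (snoc a j) t x
    + \sum_l (a l == j)%:R * pull (Fz l) i a t x.

Definition mfield_C1 k (F : mfield R k) (Fz : 'I_k -> mfield R k) :=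
  [/\ cdx T F, cdm T F & forall l, (forall t x m z, t \in `[0, T] ->
     is_derive z (delta_mx 0 l) (F t x m) (Fz l t x m z)) /\ mfield_continuous T (Fz l)].

Lemma pull_continuous k (F : mfield R k) i a : mfield_continuous T F ->
  {within [set p : R * 'rV[R]_n.+1 | p.1 \in `[0, T]],
    continuous (fun p => pull F i a p.1 p.2)}.
Proof.
move=> C; apply/subspace_continuousP => p pT.
have cx : (fun q : R * 'rV[R]_n.+1 => q.2) @ within [set p | p.1 \in `[0, T]] (nbhs p) --> p.2.
  by apply: cvg_within_filter; exact: cvg_snd.
apply: mfield_cvg => //.
- exact: withinT.
- by apply: cvg_within_filter; exact: cvg_fst.
- exact: cvg_coord.
- by apply: cvg_comp cx _; exact: emp_continuous.
- by apply: cvg_row => l; rewrite !mxE; under eq_fun do rewrite mxE; exact: cvg_coord.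
Qed.

Lemma derive_mfield_emp k (F : mfield R k) t xi z (x : 'rV[R]_n.+1) j :
  t \in `[0, T] -> cdm T F ->
  is_derive x (delta_mx 0 j) (fun y => F t xi (emp y) z)
    (nu * dm F t xi (emp x) (rsnoc z (x 0 j))).
Proof.
move=> tT [ex C].
have := @derive_emp R n (fun m => F t xi m z) (ex t xi z tT) x j.
rewrite /dm rsnoc_col' rsnoc_last; apply.
have -> : (fun p : P1 R * R => mderive (fun m => F t xi m z) p.1 p.2) =
   fun p => dm F t xi p.1 (rsnoc z p.2).
  by apply/funext => p; rewrite /dm rsnoc_col' rsnoc_last.
apply: (@mfield_cvg_fixed _ _ _ (nbhs (emp x, x 0 j)) _ (fun=> xi) (fun p : P1 R * R => p.1)
  (fun p : P1 R * R => rsnoc z p.2) t xi (emp x) (rsnoc z (x 0 j)) C) => //.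
- exact: cvg_cst.
- exact: cvg_fst.
- apply: cvg_row => l; rewrite mxE; under eq_fun do rewrite mxE.
  by case: unliftP => [l' _|_]; [exact: cvg_cst|exact: cvg_snd].
Qed.

(** The three roles of [x_j] are separated and added one by one with [is_derive_diag]: the arguments
    [z_l] by [is_derive_row], then the measure, then the state. *)
Lemma pull_derive k (F : mfield R k) Fz i a j t x : t \in `[0, T] ->
  mfield_C1 F Fz ->
  is_derive x (delta_mx 0 j) (pull F i a t) (pull_pd F Fz i a j t x).
Proof.
move=> tT [cx cm cz]; apply/is_derive_line0.
pose di : R := (i == j)%:R; pose c l : R := (a l == j)%:R.
pose xs (s : R) : 'rV[R]_n.+1 := x + s *: delta_mx 0 j.
pose zs (s : R) : 'rV[R]_k := select a x + s *: \row_l c l.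
have xsk s l : xs s 0 l = x 0 l + di * 0 + s * (l == j)%:R.
  by rewrite !mxE eqxx /= mulr0 addr0.
have xsi s : xs s 0 i = x 0 i + s * di by rewrite xsk mulr0 addr0.
have zsE s : select a (xs s) = zs s.
  by apply/rowP => l; rewrite !mxE eqxx.
have zs0 : zs 0 = select a x by rewrite /zs scale0r addr0.
have xs0 : xs 0 = x by rewrite /xs scale0r addr0.
have Dz : is_derive (0 : R) 1 (fun s => F t (x 0 i) (emp x) (zs s))
    (\sum_l c l * pull (Fz l) i a t x).
  have := @is_derive_row R k (F t (x 0 i) (emp x)) (fun l => Fz l t (x 0 i) (emp x))
    (select a x) c.
  move=> H; apply: (iffLR (is_derive_line0 _ _ _ _) (H _ _)).
    by move=> l u; have [Dl _] := cz l; exact: Dl.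
  move=> l; have [_ Cl] := cz l.
  have := @mfield_cvg_fixed _ (Fz l) _ (nbhs (select a x)) _ (fun=> x 0 i) (fun=> emp x) id
    t (x 0 i) (emp x) (select a x) Cl tT.
  by apply; [exact: cvg_cst|exact: cvg_cst|exact: cvg_id].
have cvx (p0 : R) : xs @ p0 --> xs p0.
  apply: cvgD; first exact: cvg_cst.
  by apply: cvgZr_tmp; exact: cvg_id.
have cvz (p0 : R) : zs @ p0 --> zs p0.
  apply: cvgD; first exact: cvg_cst.
  by apply: cvgZr_tmp; exact: cvg_id.
have c1 (V : topologicalType) (f : R -> V) : f @ (0 : R) --> f 0 ->
    (fun p : R * R => f p.1) @ nbhs (0 : R, 0 : R) --> f 0.
  by move=> H; apply: cvg_comp H; exact: cvg_fst.
have c2 (V : topologicalType) (f : R -> V) : f @ (0 : R) --> f 0 ->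
    (fun p : R * R => f p.2) @ nbhs (0 : R, 0 : R) --> f 0.
  by move=> H; apply: cvg_comp H; exact: cvg_snd.
have Dm : is_derive (0 : R) 1 (fun s => F t (x 0 i) (emp (xs s)) (zs s))
    (nu * pull (dm F) i (snoc a j) t x + \sum_l c l * pull (Fz l) i a t x).
  pose f1 (s r : R) := nu * dm F t (x 0 i) (emp (xs s)) (rsnoc (zs r) (xs s 0 j)).
  have := @is_derive_diag R (fun s r => F t (x 0 i) (emp (xs s)) (zs r)) f1
    (\sum_l c l * pull (Fz l) i a t x).
  have -> : f1 0 0 = nu * pull (dm F) i (snoc a j) t x.
    by rewrite /f1 xs0 zs0 -select_snoc.
  apply; last first.
  - apply: cvgM; first exact: cvg_cst.
    apply: (@mfield_cvg_fixed _ _ _ (nbhs (0 : R, 0 : R)) _ (fun=> x 0 i) (fun p : R * R => emp (xs p.1))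
      (fun p : R * R => rsnoc (zs p.2) (xs p.1 0 j)) _ _ _ _ cm.2) => //.
    + exact: cvg_cst.
    + apply: (c1 _ (fun s => emp (xs s))).
      by apply: cvg_comp (cvx 0) _; exact: emp_continuous.
    + apply: cvg_row => l; rewrite mxE; under eq_fun do rewrite mxE.
      case: unliftP => [l' _|_].
        by apply: (c2 _ (fun s => zs s 0 l')); apply: cvg_coord; exact: cvz.
      by apply: (c1 _ (fun s => xs s 0 j)); apply: cvg_coord; exact: cvx.
  - by under eq_fun do rewrite xs0.
  - move=> s r.
    exact: (iffLR (is_derive_line (fun y => F t (x 0 i) (emp y) (zs r)) x (delta_mx 0 j) s _)
      (@derive_mfield_emp k F t (x 0 i) (zs r) (xs s) j tT cm)).
pose f1 (s r : R) := di * dx F t (x 0 i + s * di) (emp (xs r)) (zs r).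
have := @is_derive_diag R (fun s r => F t (x 0 i + s * di) (emp (xs r)) (zs r)) f1
  (nu * pull (dm F) i (snoc a j) t x + \sum_l c l * pull (Fz l) i a t x).
have -> : f1 0 0 = di * pull (dx F) i a t x.
  by rewrite /f1 xs0 zs0 mul0r addr0.
rewrite addrA.
rewrite (_ : (fun s => F t (x 0 i + s * di) (emp (xs s)) (zs s)) =
  fun s => pull F i a t (x + s *: delta_mx 0 j)); last first.
  by apply/funext => s; rewrite /pull -zsE -xsi.
apply.
- move=> s r.
  have /derivableP := cx.1 t (x 0 i + s * di) (emp (xs r)) (zs r) tT.
  rewrite -derive1E => H.
  have H1 : is_derive s 1 (fun s : R => x 0 i + s * di) (0 + 1 * di).
    apply: derive_add; rewrite (_ : (fun _ => _) = fun s => di * s).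
      by rewrite mul1r -[X in is_derive _ _ _ X]mulr1; apply: derive_scale; exact: is_derive_id.
    by apply/funext => u; rewrite mulrC.
  have := @is_derive1_comp R (fun u => F t u (emp (xs r)) (zs r)) _ s _ _ H H1.
  by rewrite add0r mul1r mulrC.
- by under eq_fun do rewrite mul0r addr0.
- apply: cvgM; first exact: cvg_cst.
  apply: (@mfield_cvg_fixed _ _ _ (nbhs (0 : R, 0 : R)) _ (fun p : R * R => x 0 i + p.1 * di)
    (fun p : R * R => emp (xs p.2)) (fun p : R * R => zs p.2) _ _ _ _ cx.2) => //.
  + apply: cvgD; first exact: cvg_cst.
    by apply: cvgM; [exact: cvg_fst|exact: cvg_cst].
  + apply: (c2 _ (fun s => emp (xs s))).
    by apply: cvg_comp (cvx 0) _; exact: emp_continuous.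
  + exact: (c2 _ zs).
Qed.

End fields_at_empirical_measures.

(** * Symmetry of derivatives *)

Section symmetry.
Variables (R : realType) (n : nat).
Implicit Types (x : 'rV[R]_n.+1) (i j : 'I_n.+1).

Lemma schwarz_row (G : 'rV[R]_n.+1 -> R) (Gi Gj Gij Gji : 'rV[R]_n.+1 -> R) i j x :
  (forall y, is_derive y (delta_mx 0 i) G (Gi y)) ->
  (forall y, is_derive y (delta_mx 0 j) G (Gj y)) ->
  (forall y, is_derive y (delta_mx 0 j) Gi (Gij y)) ->
  (forall y, is_derive y (delta_mx 0 i) Gj (Gji y)) ->
  {for x, continuous Gij} -> {for x, continuous Gji} -> Gij x = Gji x.
Proof.
move=> Hi Hj Hij Hji Cij Cji.
pose X (s r : R) : 'rV[R]_n.+1 := x + s *: delta_mx 0 i + r *: delta_mx 0 j.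
have X0 : X 0 0 = x by rewrite /X !scale0r !addr0.
have XE s r : X s r = (x + r *: delta_mx 0 j) + s *: delta_mx 0 i by rewrite /X addrAC.
have cX : {for (0 : R, 0 : R), continuous (fun p => X p.1 p.2)}.
  apply: continuousD; first apply: continuousD.
  - exact: cst_continuous.
  - by apply: continuousZr_tmp; exact: cvg_fst.
  - by apply: continuousZr_tmp; exact: cvg_snd.
have D1 (F F' : 'rV[R]_n.+1 -> R) (H : forall y, is_derive y (delta_mx 0 i) F (F' y)) (s r : R) :
    is_derive s 1 (fun s => F (X s r)) (F' (X s r)).
  rewrite XE (_ : (fun _ => _) = fun s => F ((x + r *: delta_mx 0 j) + s *: delta_mx 0 i)).
    exact: (iffLR (is_derive_line _ _ _ _ _) (H _)).
  by apply/funext => u; rewrite XE.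
have D2 (F F' : 'rV[R]_n.+1 -> R) (H : forall y, is_derive y (delta_mx 0 j) F (F' y)) (s r : R) :
    is_derive r 1 (fun r => F (X s r)) (F' (X s r)).
  exact: (iffLR (is_derive_line _ _ _ _ _) (H _)).
have := @schwarz R (fun s r => G (X s r)) (fun s r => Gi (X s r)) (fun s r => Gj (X s r))
  (fun s r => Gij (X s r)) (fun s r => Gji (X s r)) 1 ltr01.
rewrite !X0; apply.
- by move=> s r _ _; split; [exact: D1|exact: D2|exact: D2|exact: D1].
- by apply: continuous_comp => //; rewrite /= X0.
- by apply: continuous_comp => //; rewrite /= X0.
Qed.

(* The last index is the direction differentiated last. *)
Lemma third_derivatives_commute (G : 'rV[R]_n.+1 -> R)
    (G1 : 'I_n.+1 -> 'rV[R]_n.+1 -> R) (G2 : 'I_n.+1 -> 'I_n.+1 -> 'rV[R]_n.+1 -> R)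
    (G3 : 'I_n.+1 -> 'I_n.+1 -> 'I_n.+1 -> 'rV[R]_n.+1 -> R) :
  (forall j y, is_derive y (delta_mx 0 j) G (G1 j y)) ->
  (forall j l y, is_derive y (delta_mx 0 l) (G1 j) (G2 j l y)) ->
  (forall j l p y, is_derive y (delta_mx 0 p) (G2 j l) (G3 j l p y)) ->
  (forall j l, continuous (G2 j l)) -> (forall j l p, continuous (G3 j l p)) ->
  (forall i j x, G2 i j x = G2 j i x) /\ (forall i j x, G3 j j i x = G3 i j j x).
Proof.
move=> H1 H2 H3 C2 C3.
have S i j x : G2 i j x = G2 j i x.
  exact: (schwarz_row (H1 i) (H1 j) (H2 i j) (H2 j i) (@C2 i j x) (@C2 j i x)).
split=> // i j x.
have -> : G3 j j i x = G3 j i j x.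
  exact: (schwarz_row (H2 j j) (H2 j i) (H3 j j i) (H3 j i j) (@C3 j j i x) (@C3 j i j x)).
have E : G2 j i = G2 i j by apply/funext => y; exact: S.
have A := H3 j i j x; rewrite E in A; have B := H3 i j j x.
by rewrite -(@derive_val _ _ _ _ _ _ _ A) -(@derive_val _ _ _ _ _ _ _ B).
Qed.

Lemma schwarz_time (G Gt Gi Gti Git : R -> 'rV[R]_n.+1 -> R) i (d t : R) x : 0 < d ->
  (forall (s : R) y, `|s - t| < d -> is_derive s 1 (G ^~ y) (Gt s y)) ->
  (forall (s : R) y, `|s - t| < d -> is_derive y (delta_mx 0 i) (G s) (Gi s y)) ->
  (forall (s : R) y, `|s - t| < d -> is_derive y (delta_mx 0 i) (Gt s) (Gti s y)) ->
  (forall (s : R) y, `|s - t| < d -> is_derive s 1 (Gi ^~ y) (Git s y)) ->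
  {for (t, x), continuous (fun p => Gti p.1 p.2)} ->
  {for (t, x), continuous (fun p => Git p.1 p.2)} -> Gti t x = Git t x.
Proof.
move=> d0 Ht Hi Hti Hit Cti Cit.
pose X (p : R * R) : R * 'rV[R]_n.+1 := (t + p.1, x + p.2 *: delta_mx 0 i).
have X0 : X (0, 0) = (t, x) by rewrite /X /= scale0r !addr0.
have cX : {for (0 : R, 0 : R), continuous X}.
  rewrite /prop_for /continuous_at X0.
  apply: (@cvg_pair _ _ _ _ (nbhs t) (nbhs x)).
    rewrite -[X in _ --> nbhs X](addr0 t); apply: cvgD; [exact: cvg_cst|exact: cvg_fst].
  rewrite -[X in _ --> nbhs X](addr0 x) -(scale0r (delta_mx 0 i)).
  apply: cvgD; first exact: cvg_cst.
  by apply: cvgZr_tmp; exact: cvg_snd.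
have Dt (F F' : R -> 'rV[R]_n.+1 -> R)
    (H : forall (s : R) y, `|s - t| < d -> is_derive s 1 (F ^~ y) (F' s y)) (s : R) y : `|s| < d ->
    is_derive s 1 (fun s => F (t + s) y) (F' (t + s) y).
  move=> sd; have Hs : `|t + s - t| < d by rewrite addrAC subrr add0r.
  have H1 : is_derive s 1 (fun s : R => t + s) (0 + 1).
    by apply: derive_add; exact: is_derive_id.
  have H2 := H (t + s) y Hs.
  by have := @is_derive1_comp R (F ^~ y) _ s _ _ H2 H1; rewrite add0r mulr1.
have := @schwarz R (fun s r => G (t + s) (x + r *: delta_mx 0 i))
  (fun s r => Gt (t + s) (x + r *: delta_mx 0 i)) (fun s r => Gi (t + s) (x + r *: delta_mx 0 i))
  (fun s r => Gti (t + s) (x + r *: delta_mx 0 i)) (fun s r => Git (t + s) (x + r *: delta_mx 0 i)) d d0.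
rewrite scale0r !addr0; apply.
- move=> s r sd rd; have Hs : `|t + s - t| < d by rewrite addrAC subrr add0r.
  split; [exact: Dt| |  |exact: Dt].
  + exact: (iffLR (is_derive_line _ _ _ _ _) (Hi _ _ Hs)).
  + exact: (iffLR (is_derive_line _ _ _ _ _) (Hti _ _ Hs)).
- apply: (@continuous_comp _ _ _ X (fun p => Gti p.1 p.2)) => //.
  by rewrite /prop_for X0.
- apply: (@continuous_comp _ _ _ X (fun p => Git p.1 p.2)) => //.
  by rewrite /prop_for X0.
Qed.

End symmetry.

Lemma tderivable_is_derive (R : realType) (T t : R) (f : R -> R) :
  t \in `]0, T[ -> tderivable T f t -> is_derive t 1 f (tderive T f t).
Proof.
rewrite in_itv/= => /andP[t0 tT] C.
have {}C : (f s - f t) / (s - t) @[s --> within `[0, T]%classic t^'] --> tderive T f t by [].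
apply/(is_derive_line0 (V := R^o))/is_derive0P => e e0.
have N : \forall s \near t, s != t -> `[0, T]%classic s ->
    `|tderive T f t - (f s - f t) / (s - t)| <= e.
  exact: (@cvgr_dist_le _ _ _ _ _ _ _ C e e0).
have [d d0 H] := iffLR (nbhs_ballP _ _) N.
apply/near0P; exists (Num.min d (Num.min t (T - t))).
  by rewrite !lt_min d0 t0 subr_gt0.
move=> s; rewrite !lt_min => /and3P[sd st sT].
rewrite scale0r addr0 [s *: _]mulr1.
have [->|s0] := eqVneq s 0; first by rewrite addr0 subrr mulr0 subrr normr0 mulr0.
have := H (t + s); rewrite /ball/= opprD addrA subrr sub0r normrN => /(_ sd).
have ne : t + s != t by rewrite -subr_eq0 addrAC subrr add0r.
move=> /(_ ne).
have itv : `[0, T]%classic (t + s).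
  rewrite /= in_itv/=; move: st sT; rewrite !ltr_norml; lra.
move=> /(_ itv) A.
have -> : f (t + s) - f t - tderive T f t * s =
  - ((tderive T f t - (f (t + s) - f t) / (t + s - t)) * s).
  by rewrite [t + s - t]addrAC subrr add0r; field.
by rewrite normrN normrM ler_wpM2r.
Qed.

(** * The minimized Hamiltonian *)

Section empirical_symmetry.
Variables (R : realType) (T : R) (n : nat).

(** The derivative in the measure becomes, up to the factor [nu], a derivative in the position of
    particle [j], so that Schwarz's theorem for two real variables applies. This needs the last
    argument to be a point of the empirical measure, as it is in every [pull]. *)
Lemma dx_dm_emp k (F : mfield R k) t xi (x : 'rV[R]_n.+1) z j :
  t \in `[0, T] -> ex_dx T F -> cdm T F -> cdm T (dx F) -> cdx T (dm F) ->
  dx (dm F) t xi (emp x) (rsnoc z (x 0 j)) = dm (dx F) t xi (emp x) (rsnoc z (x 0 j)).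
Proof.
move=> tT Fx Fm Fxm Fmx.
pose nu : R := n.+1%:R^-1.
have nu0 : nu != 0 by rewrite invr_eq0 pnatr_eq0.
pose xs (r : R) : 'rV[R]_n.+1 := x + r *: delta_mx 0 j.
have xs0 : xs 0 = x by rewrite /xs scale0r addr0.
have D1 k' (G : mfield R k') zz (H : ex_dx T G) (s : R) m :
    is_derive s 1 (fun s => G t (xi + s) m zz) (dx G t (xi + s) m zz).
  have /derivableP := H t (xi + s) m zz tT; rewrite -derive1E => A.
  have B : is_derive s 1 (fun s : R => xi + s) (0 + 1).
    by apply: derive_add; exact: is_derive_id.
  by have := @is_derive1_comp R (fun u => G t u m zz) _ s _ _ A B; rewrite add0r mulr1.
have D2 k' (G : mfield R k') zz (H : cdm T G) u (r : R) :
    is_derive r 1 (fun r => G t u (emp (xs r)) zz)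
      (nu * dm G t u (emp (xs r)) (rsnoc zz (xs r 0 j))).
  exact: (iffLR (is_derive_line (fun y => G t u (emp y) zz) x (delta_mx 0 j) r _)
     (derive_mfield_emp u zz (xs r) j tT H)).
have C k' (G : mfield R k'.+1) zz : mfield_continuous T G ->
    {for (0 : R, 0 : R), continuous (fun p : R * R =>
      nu * G t (xi + p.1) (emp (xs p.2)) (rsnoc zz (xs p.2 0 j)))}.
  move=> cG; apply: continuousM; first exact: cst_continuous.
  have cx2 : (fun p : R * R => xs p.2) @ nbhs (0 : R, 0 : R) --> xs 0.
    apply: cvgD; first exact: cvg_cst.
    by apply: cvgZr_tmp; exact: cvg_snd.
  apply: (@mfield_cvg_fixed _ _ _ G _ (nbhs (0 : R, 0 : R)) _ (fun p : R * R => xi + p.1)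
    (fun p : R * R => emp (xs p.2)) (fun p : R * R => rsnoc zz (xs p.2 0 j)) _ _ _ _ cG tT).
  - by apply: cvgD; [exact: cvg_cst|exact: cvg_fst].
  - by apply: cvg_comp cx2 _; exact: emp_continuous.
  - apply: cvg_row => l; rewrite mxE; under eq_fun do rewrite mxE.
    case: unliftP => [l' _|_]; first exact: cvg_cst.
    by apply: cvg_coord.
have := @schwarz R (fun s r => F t (xi + s) (emp (xs r)) z)
  (fun s r => dx F t (xi + s) (emp (xs r)) z)
  (fun s r => nu * dm F t (xi + s) (emp (xs r)) (rsnoc z (xs r 0 j)))
  (fun s r => nu * dm (dx F) t (xi + s) (emp (xs r)) (rsnoc z (xs r 0 j)))
  (fun s r => nu * dx (dm F) t (xi + s) (emp (xs r)) (rsnoc z (xs r 0 j))) 1 ltr01.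
rewrite xs0 addr0 => H; apply: (mulfI nu0); apply/esym/H.
- move=> s r _ _; split; [exact: D1|exact: D2|exact: D2|].
  by apply: derive_scale; apply: D1; exact: Fmx.1.
- exact: C Fxm.2.
- exact: C Fmx.2.
Qed.

End empirical_symmetry.

(** * Mean slopes *)

Section secant.
Variable R : realType.
Implicit Types (H beta : R -> R).

(** The mean of [beta] over the segment from [a] to [p] when [beta] is the derivative of [H],
    written without an integral; the value at [p = a] is the natural one. *)
Definition secant H beta (p a : R) : R :=
  if p == a then beta a else (H p - H a) / (p - a).

Lemma secantE H beta p a : H p - H a = (p - a) * secant H beta p a.
Proof.
rewrite /secant; case: eqVneq => [->|pa]; first by rewrite !subrr mul0r.
by rewrite mulrCA divff ?mulr1// subr_eq0.
Qed.

(** Writes a mean slope as the increment of a primitive over [0, 1]. Two mean slopes can then be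
    compared by the mean value theorem for the difference of primitives, at one common parameter,
    with [beta] possibly discontinuous. *)
Lemma secant_primitive H beta p a : (forall y : R, is_derive y 1 H (beta y)) ->
  exists2 G : R -> R, (forall th : R, is_derive th 1 G (beta (a + th * (p - a)))) &
    G 1 - G 0 = secant H beta p a.
Proof.
move=> dH; rewrite /secant; case: eqVneq => [->|pa].
  exists (fun th => beta a * th).
    move=> th; rewrite subrr mulr0 addr0 -[X in is_derive _ _ _ X]mulr1.
    by apply: derive_scale; exact: is_derive_id.
  by rewrite mulr1 mulr0 subr0.
have pa0 : p - a != 0 by rewrite subr_eq0.
exists (fun th => (p - a)^-1 * H (a + th * (p - a))).
  move=> th; have A : is_derive th 1 (fun th : R => a + th * (p - a)) (0 + (p - a) * 1).
    apply: derive_add; rewrite (_ : (fun _ => _) = fun u : R => (p - a) * u).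
      by apply: derive_scale; exact: is_derive_id.
    by apply/funext => u; rewrite mulrC.
  have := derive_scale (p - a)^-1 (@is_derive1_comp R H _ th _ _ (dH _) A).
  by move=> A2; apply: is_derive_eq A2 _; rewrite add0r mulr1 mulrCA mulVf// mulr1.
by rewrite mul1r mul0r addr0 subrKC -mulrBr mulrC.
Qed.

Lemma secant_close H beta H' beta' p a p' a' c :
  (forall y : R, is_derive y 1 H (beta y)) -> (forall y : R, is_derive y 1 H' (beta' y)) ->
  (forall th, `|th| <= 1 ->
     `|beta (a + th * (p - a)) - beta' (a' + th * (p' - a'))| <= c) ->
  `|secant H beta p a - secant H' beta' p' a'| <= c.
Proof.
move=> dH dH' hc.
have [G dG <-] := secant_primitive p a dH; have [G' dG' <-] := secant_primitive p' a' dH'.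
have [th th1] := @mean_value R (fun u => G u - G' u)
  (fun th => beta (a + th * (p - a)) - beta' (a' + th * (p' - a'))) 0 1.
rewrite !subr0 normr1 mulr1 in th1 * => E.
have -> : G 1 - G 0 - (G' 1 - G' 0) = G 1 - G' 1 - (G 0 - G' 0) by ring.
by rewrite E; exact: hc.
Qed.

Lemma secant_Lip K H beta H' beta' p a p' a' c : 0 <= K ->
  (forall y : R, is_derive y 1 H (beta y)) -> (forall y : R, is_derive y 1 H' (beta' y)) ->
  (forall y y', `|beta y - beta' y'| <= c + K * `|y - y'|) ->
  `|secant H beta p a - secant H' beta' p' a'| <= c + K * (2 * `|a - a'| + `|p - p'|).
Proof.
move=> K0 dH dH' L; apply: secant_close => // th th1.
apply: (le_trans (L _ _)); rewrite lerD2l ler_wpM2l//.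
have -> : a + th * (p - a) - (a' + th * (p' - a')) =
  (a - a') + th * ((p - p') - (a - a')) by ring.
rewrite (le_trans (ler_normD _ _))// normrM.
have A : `|th| * `|(p - p') - (a - a')| <= 1 * (`|p - p'| + `|a - a'|).
  by apply: ler_pM => //; exact: ler_normB.
by lra.
Qed.

Lemma secant_cst H beta p : secant H beta p p = beta p.
Proof. by rewrite /secant eqxx. Qed.

End secant.

Section hamiltonian.
Variables (R : realType) (V : set R) (b f vhat : R -> P1 R -> R -> R).
Hypothesis vmin : is_minimizer V b f vhat.
Let bhat := optimized vhat b.
Let fhat := optimized vhat f.

Definition hamiltonian x m y := bhat x m y * y + fhat x m y.

Lemma min_hamiltonianE x m y : min_hamiltonian V b f x m y = hamiltonian x m y.
Proof.
have [Vv min] := vmin x m y.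
have lb : lbound [set b x m v * y + f x m v | v in V] (hamiltonian x m y).
  by move=> _ [v Vv' <-]; exact: min.
apply/eqP; rewrite eq_le; apply/andP; split.
  apply: ge_inf; first by exists (hamiltonian x m y).
  by exists (vhat x m y).
apply: lb_le_inf => //.
by exists (hamiltonian x m y); exists (vhat x m y).
Qed.

(* Envelope theorem: [vhat] is optimal for [y] and admissible for [y']. *)
Lemma hamiltonian_le x m y y' :
  hamiltonian x m y' <= hamiltonian x m y + bhat x m y * (y' - y).
Proof.
have [Vv _] := vmin x m y; have [_ /(_ _ Vv)] := vmin x m y'.
rewrite /hamiltonian /bhat /fhat /optimized => /le_trans; apply.
by rewrite le_eqVlt; apply/orP; left; apply/eqP; ring.
Qed.

(** Exchanging the roles of [y] and [y + s] in [hamiltonian_le] traps the increment between [bhat]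
    at [y + s] and [bhat] at [y], each times [s]; their gap is of order [s^2]. *)
Lemma derive_hamiltonian (K : R) (x : R) m (y : R) :
  (forall y y', `|bhat x m y - bhat x m y'| <= K * `|y - y'|) ->
  is_derive y 1 (hamiltonian x m) (bhat x m y).
Proof.
move=> L; apply/(is_derive_line0 (V := R^o))/is_derive0P => e e0.
have K0 : 0 <= K.
  by have := le_trans (normr_ge0 _) (L 1 0); rewrite subr0 normr1 mulr1.
apply/near0P; exists (e / (K + 1)); first by rewrite divr_gt0// ltr_wpDl.
move=> s; rewrite ltr_pdivlMr ?ltr_wpDl// => se.
rewrite scale0r addr0 [s *: _]mulr1.
have A1 := hamiltonian_le x m y (y + s).
have A2 := hamiltonian_le x m (y + s) y.
have ys : y + s - y = s by rewrite addrAC subrr add0r.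
rewrite ys in A1; rewrite opprD addrA subrr add0r mulrN in A2.
have A3 := L (y + s) y; rewrite ys in A3.
have A4 : `|(bhat x m (y + s) - bhat x m y) * s| <= e * `|s|.
  rewrite normrM ler_wpM2r//; apply: (le_trans A3).
  by apply: le_trans (ltW se); rewrite mulrC ler_wpM2l// lerDl.
move: A4; rewrite !ler_norml; set X := bhat x m (y + s) in A1 A2 *.
by move=> /andP[A4 A5]; apply/andP; split; lra.
Qed.

End hamiltonian.

Section bhat_Lipschitz.
Variables (R : realType) (bhat fhat : R -> P1 R -> R -> R).
Hypothesis cr : coef_regularity bhat fhat.

(** The arguments are changed one at a time, each by a mean value theorem. The factor [1 / N] stays
    in the average of displacements, so one constant serves all numbers of players. *)
Lemma bhat_Lipschitz : exists2 K : R, 0 <= K &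
  forall n x x' (y y' : 'rV[R]_n.+1) p p',
  `|bhat x (emp y) p - bhat x' (emp y') p'| <=
  K * (`|x - x'| + n.+1%:R^-1 * (\sum_k `|y 0 k - y' 0 k|) + `|p - p'|).
Proof.
have [Kx Hx] := (cr_b_x cr).2; have [Km Hm] := (cr_b_m cr).2; have [Ky Hy] := (cr_b_y cr).2.
pose K := `|Kx| + `|Km| + `|Ky|.
have K0 : 0 <= K by rewrite !addr_ge0.
exists K => // n x x' y y' p p'.
have -> : bhat x (emp y) p - bhat x' (emp y') p' =
  (bhat x (emp y) p - bhat x' (emp y) p) + (bhat x' (emp y) p - bhat x' (emp y') p)
  + (bhat x' (emp y') p - bhat x' (emp y') p') by ring.
rewrite (le_trans (ler_normD _ _))// mulrDr lerD//.
  rewrite (le_trans (ler_normD _ _))// mulrDr lerD//.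
    have Dx (u : R) : is_derive u 1 (fun u => bhat u (emp y) p) (coef_x bhat u (emp y) p).
      by have /derivableP := (cr_b_x cr).1 u (emp y) p; rewrite -derive1E.
    have [c _ ->] := mean_value (fun u (_ : `|u - x'| <= `|x - x'|) => Dx u).
    rewrite normrM ler_wpM2r// (le_trans (Hx _ _ _))//.
    by rewrite (le_trans (ler_norm _))// /K -addrA lerDl addr_ge0.
  apply: (le_trans (@emp_Lipschitz R n (fun m => bhat x' m p) ((cr_b_m cr).1 x' p) K y' y _)) => //.
  move=> m z; rewrite (le_trans (Hm x' m p z))//.
  by rewrite (le_trans (ler_norm _))// /K addrAC lerDr addr_ge0.
have Dy (u : R) : is_derive u 1 (fun u => bhat x' (emp y') u) (coef_y bhat x' (emp y') u).
  by have /derivableP := (cr_b_y cr).1 x' (emp y') u; rewrite -derive1E.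
have [c _ ->] := mean_value (fun u (_ : `|u - p'| <= `|p - p'|) => Dy u).
rewrite normrM ler_wpM2r// (le_trans (Hy _ _ _))//.
by rewrite (le_trans (ler_norm _))// /K lerDr addr_ge0.
Qed.

End bhat_Lipschitz.

(** * The projection of the solution of the master equation *)

Lemma tderivable_cvg (R : realType) (T t : R) (f : R -> R) :
  tderivable T f t -> f @ within `[0, T]%classic (nbhs t) --> f t.
Proof.
move=> C.
have {}C : (f s - f t) / (s - t) @[s --> within `[0, T]%classic t^'] --> tderive T f t by [].
have N : \forall s \near t, s != t -> `[0, T]%classic s ->
    `|tderive T f t - (f s - f t) / (s - t)| <= 1.
  exact: (@cvgr_dist_le _ _ _ _ _ _ _ C 1 ltr01).
have [d d0 H] := iffLR (nbhs_ballP _ _) N.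
apply/cvgrPdist_le => e e0; set L := tderive T f t in H.
have L0 : 0 < `|L| + 1 by rewrite ltr_wpDl.
rewrite near_withinE; apply/nbhs_ballP; exists (Num.min d (e / (`|L| + 1))).
  by rewrite /= lt_min d0 divr_gt0.
move=> s; rewrite /ball/= lt_min => /andP[sd se] sT.
have [->|st] := eqVneq s t; first by rewrite subrr normr0 ltW.
have A := H s sd st sT.
have st0 : s - t != 0 by rewrite subr_eq0.
have -> : f t - f s = (L - (f s - f t) / (s - t)) * (s - t) - L * (s - t).
  by field.
rewrite (le_trans (ler_normB _ _))// !normrM -mulrDl.
rewrite distrC in se; move: se; rewrite ltr_pdivlMr// => se.
apply: le_trans (ltW se); rewrite mulrC; apply: ler_wpM2l => //.
by rewrite addrC lerD2l.
Qed.

Section derivatives_of_the_projection.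
Variables (R : realType) (T : R) (n : nat) (U : R -> R -> P1 R -> R).
Hypotheses (me : master_regularity T U) (mh : master_higher_regularity T U).
Let nu : R := n.+1%:R^-1.
Let u := mfield0 U.
Let o1 : 'I_1 := ord0.

Definition no_index : 'I_0 -> 'I_n.+1 := fun=> ord0.
Definition one_index (j : 'I_n.+1) := snoc no_index j.
Definition two_indices (j l : 'I_n.+1) := snoc (one_index j) l.

Definition no_partials (l : 'I_0) : mfield R 0 := fun _ _ _ _ => 0.

Lemma one_indexE j l : one_index j l = j.
Proof.
rewrite /one_index /snoc; case: unliftP => // l' _.
by case: l' => k hk; exfalso; rewrite ltn0 in hk.
Qed.

Let C1_0 (F : mfield R 0) : cdx T F -> cdm T F -> mfield_C1 T F no_partials.
Proof. by move=> cx cm; split => // -[k hk]; exfalso; rewrite ltn0 in hk. Qed.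

Let C1_S k (F : mfield R k.+1) : cdx T F -> cdm T F -> (forall l, cdz T l F) ->
  mfield_C1 T F (fun l => dz l F).
Proof.
move=> cx cm cz; split; [exact: cx|exact: cm|move=> l; have [ex C] := cz l].
split; last exact: C.
by move=> t x m z tT; have /derivableP := ex t x m z tT.
Qed.

Let C1_u : mfield_C1 T u no_partials.
Proof. exact: C1_0 (me_x me) (me_m me). Qed.
Let C1_x : mfield_C1 T (dx u) no_partials.
Proof. exact: C1_0 (me_xx me) (me_xm me). Qed.
Let C1_m : mfield_C1 T (dm u) (fun l => dz l (dm u)).
Proof. by apply: C1_S (me_mx me) (me_mm me) _ => l; rewrite (ord1 l); exact: me_mz1. Qed.
Let C1_t : mfield_C1 T (dt T u) no_partials.
Proof. exact: C1_0 (me_tx mh) (me_tm mh). Qed.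
Let C1_xx : mfield_C1 T (dx (dx u)) no_partials.
Proof. exact: C1_0 (me_xxx mh) (me_xxm mh). Qed.
Let C1_xm : mfield_C1 T (dm (dx u)) (fun l => dz l (dm (dx u))).
Proof. by apply: C1_S (me_xmx mh) (me_xmm mh) _ => l; rewrite (ord1 l); exact: me_xmz1. Qed.
Let C1_mx : mfield_C1 T (dx (dm u)) (fun l => dz l (dx (dm u))).
Proof. by apply: C1_S (me_mxx mh) (me_mxm mh) _ => l; rewrite (ord1 l); exact: me_mxz1. Qed.
Let C1_mm : mfield_C1 T (dm (dm u)) (fun l => dz l (dm (dm u))).
Proof.
apply: C1_S (me_mmx mh) (me_mmm mh) _ => -[[|[|k]] hk] //.
- by have -> : Ordinal hk = ord0 by [apply/val_inj]; exact: me_mmz1.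
- by have -> : Ordinal hk = ord_max by [apply/val_inj]; exact: me_mmz2.
Qed.
Let C1_mz : mfield_C1 T (dz o1 (dm u)) (fun l => dz l (dz o1 (dm u))).
Proof. by apply: C1_S (me_mz1x mh) (me_mz1m mh) _ => l; rewrite (ord1 l); exact: me_mz1z1. Qed.

(** The projection v^i. In the names below, digits count space derivatives and [t] marks a time
    derivative, in the order in which they are taken; likewise the indices after [i]. *)
Definition vp i : R -> 'rV[R]_n.+1 -> R := pull u i no_index.

Definition vp1 i j : R -> 'rV[R]_n.+1 -> R := fun t x =>
  (i == j)%:R * pull (dx u) i no_index t x + nu * pull (dm u) i (one_index j) t x.

Definition vp2 i j l : R -> 'rV[R]_n.+1 -> R := fun t x =>
  (i == j)%:R * ((i == l)%:R * pull (dx (dx u)) i no_index t x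
                 + nu * pull (dm (dx u)) i (one_index l) t x)
  + nu * ((i == l)%:R * pull (dx (dm u)) i (one_index j) t x
          + nu * pull (dm (dm u)) i (two_indices j l) t x
          + (j == l)%:R * pull (dz o1 (dm u)) i (one_index j) t x).

Definition vp3 i j l p : R -> 'rV[R]_n.+1 -> R := fun t x =>
  (i == j)%:R * ((i == l)%:R * pull_pd (dx (dx u)) no_partials i no_index p t x
     + nu * pull_pd (dm (dx u)) (fun l => dz l (dm (dx u))) i (one_index l) p t x)
  + nu * ((i == l)%:R * pull_pd (dx (dm u)) (fun l => dz l (dx (dm u))) i (one_index j) p t x
     + nu * pull_pd (dm (dm u)) (fun l => dz l (dm (dm u))) i (two_indices j l) p t x
     + (j == l)%:R * pull_pd (dz o1 (dm u)) (fun l => dz l (dz o1 (dm u))) i (one_index j) p t x).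

Definition vpt i : R -> 'rV[R]_n.+1 -> R := pull (dt T u) i no_index.

Definition vpt1 i j : R -> 'rV[R]_n.+1 -> R := pull_pd (dt T u) no_partials i no_index j.

Definition vp1t i j : R -> 'rV[R]_n.+1 -> R := fun t x =>
  (i == j)%:R * pull (dt T (dx u)) i no_index t x
  + nu * pull (dt T (dm u)) i (one_index j) t x.

Lemma derive_vp i j (t : R) x : t \in `[0, T] ->
  is_derive x (delta_mx 0 j) (vp i t) (vp1 i j t x).
Proof.
move=> tT; apply: is_derive_eq (pull_derive i no_index j x tT C1_u) _.
by rewrite /pull_pd big_ord0 addr0.
Qed.

Let pull_0 (F : mfield R 0) i j (t : R) x : t \in `[0, T] -> mfield_C1 T F no_partials ->
  is_derive x (delta_mx 0 j) (pull F i no_index t)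
   ((i == j)%:R * pull (dx F) i no_index t x + nu * pull (dm F) i (one_index j) t x).
Proof.
move=> tT C; apply: is_derive_eq (pull_derive i no_index j x tT C) _.
by rewrite /pull_pd big_ord0 addr0.
Qed.

Let pull_1 (F : mfield R 1) i j l (t : R) x : t \in `[0, T] ->
  mfield_C1 T F (fun l => dz l F) ->
  is_derive x (delta_mx 0 l) (pull F i (one_index j) t)
   ((i == l)%:R * pull (dx F) i (one_index j) t x + nu * pull (dm F) i (two_indices j l) t x
    + (j == l)%:R * pull (dz o1 F) i (one_index j) t x).
Proof.
move=> tT C; apply: is_derive_eq (pull_derive i (one_index j) l x tT C) _.
by rewrite /pull_pd big_ord1 one_indexE.
Qed.

Lemma derive_vp1 i j l (t : R) x : t \in `[0, T] ->
  is_derive x (delta_mx 0 l) (vp1 i j t) (vp2 i j l t x).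
Proof.
move=> tT.
exact: (derive_add (derive_scale _ (pull_0 i l x tT C1_x))
  (derive_scale _ (pull_1 i j l x tT C1_m))).
Qed.

Lemma derive_vp2 i j l p (t : R) x : t \in `[0, T] ->
  is_derive x (delta_mx 0 p) (vp2 i j l t) (vp3 i j l p t x).
Proof.
move=> tT.
have Dxx := pull_derive i no_index p x tT C1_xx.
have Dxm := pull_derive i (one_index l) p x tT C1_xm.
have Dmx := pull_derive i (one_index j) p x tT C1_mx.
have Dmm := pull_derive i (two_indices j l) p x tT C1_mm.
have Dmz := pull_derive i (one_index j) p x tT C1_mz.
exact: (derive_add
  (derive_scale _ (derive_add (derive_scale _ Dxx) (derive_scale _ Dxm)))
  (derive_scale _ (derive_add (derive_add (derive_scale _ Dmx) (derive_scale _ Dmm))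
    (derive_scale _ Dmz)))).
Qed.

Lemma derive_vpt i j (t : R) x : t \in `[0, T] ->
  is_derive x (delta_mx 0 j) (vpt i t) (vpt1 i j t x).
Proof. by move=> tT; apply: pull_derive tT C1_t. Qed.

Let sub_itv (t : R) : t \in `]0, T[ -> t \in `[0, T].
Proof. by rewrite !in_itv/= => /andP[/ltW -> /ltW ->]. Qed.

Let pull_t k (F : mfield R k) i (a : 'I_k -> 'I_n.+1) (t : R) x : t \in `]0, T[ -> ex_dt T F ->
  is_derive t 1 (pull F i a ^~ x) (pull (dt T F) i a t x).
Proof. by move=> tT H; have t1 := sub_itv tT; apply: tderivable_is_derive tT _; apply: H. Qed.

Lemma derive_t_vp i (t : R) x : t \in `]0, T[ -> is_derive t 1 (vp i ^~ x) (vpt i t x).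
Proof. by move=> tT; apply: pull_t tT (me_t me).1. Qed.

Lemma derive_t_vp1 i j (t : R) x : t \in `]0, T[ ->
  is_derive t 1 (vp1 i j ^~ x) (vp1t i j t x).
Proof.
move=> tT; exact: (derive_add (derive_scale _ (pull_t i no_index x tT (me_xt mh).1))
  (derive_scale _ (pull_t i (one_index j) x tT (me_mt mh).1))).
Qed.

Let dom := [set p : R * 'rV[R]_n.+1 | p.1 \in `[0, T]].

Let pull_pd_continuous k (F : mfield R k) Fz i (a : 'I_k -> 'I_n.+1) j : mfield_C1 T F Fz ->
  {within dom, continuous (fun p => pull_pd F Fz i a j p.1 p.2)}.
Proof.
move=> [cx cm cz]; apply: within_add; first apply: within_add.
- by apply: within_mul; [exact: within_cst|exact: pull_continuous cx.2].
- by apply: within_mul; [exact: within_cst|exact: pull_continuous cm.2].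
- apply: within_sum => l _; apply: within_mul; first exact: within_cst.
  exact: pull_continuous (cz l).2.
Qed.

Lemma vp1_continuous i j : {within dom, continuous (fun p => vp1 i j p.1 p.2)}.
Proof.
apply: within_add; apply: within_mul; try exact: within_cst.
  exact: pull_continuous (me_x me).2.
exact: pull_continuous (me_m me).2.
Qed.

Lemma vp2_continuous i j l : {within dom, continuous (fun p => vp2 i j l p.1 p.2)}.
Proof.
apply: within_add; apply: within_mul; try exact: within_cst.
  apply: within_add; apply: within_mul; try exact: within_cst.
    exact: pull_continuous (me_xx me).2.
  exact: pull_continuous (me_xm me).2.
apply: within_add; first apply: within_add; apply: within_mul; try exact: within_cst.
- exact: pull_continuous (me_mx me).2.
- exact: pull_continuous (me_mm me).2.
- exact: pull_continuous (me_mz1 me).2.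
Qed.

Lemma vp3_continuous i j l p : {within dom, continuous (fun q => vp3 i j l p q.1 q.2)}.
Proof.
apply: within_add; apply: within_mul; try exact: within_cst.
  apply: within_add; apply: within_mul; try exact: within_cst.
    exact: pull_pd_continuous C1_xx.
  exact: pull_pd_continuous C1_xm.
apply: within_add; first apply: within_add; apply: within_mul; try exact: within_cst.
- exact: pull_pd_continuous C1_mx.
- exact: pull_pd_continuous C1_mm.
- exact: pull_pd_continuous C1_mz.
Qed.

Lemma vpt1_continuous i j : {within dom, continuous (fun p => vpt1 i j p.1 p.2)}.
Proof. exact: pull_pd_continuous C1_t. Qed.

Lemma vp1t_continuous i j : {within dom, continuous (fun p => vp1t i j p.1 p.2)}.
Proof.
apply: within_add; apply: within_mul; try exact: within_cst.
  exact: pull_continuous (me_xt mh).2.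
exact: pull_continuous (me_mt mh).2.
Qed.

End derivatives_of_the_projection.

Lemma norm_le_sum (R : realDomainType) (r : seq R) (a : R) :
  a \in r -> `|a| <= \sum_(b <- r) `|b|.
Proof. by move=> ar; rewrite (big_rem a)//= lerDl sumr_ge0. Qed.

Definition bounded_by (R : realType) (T K : R) k (F : mfield R k) :=
  forall t x m z, t \in `[0, T] -> `|F t x m z| <= K.

Record fields_bounded_by (R : realType) (T K : R) (u : mfield R 0) : Prop := {
  fb_x : bounded_by T K (dx u) ;
  fb_m : bounded_by T K (dm u) ;
  fb_xx : bounded_by T K (dx (dx u)) ;
  fb_xm : bounded_by T K (dm (dx u)) ;
  fb_mm : bounded_by T K (dm (dm u)) ;
  fb_mz : bounded_by T K (dz ord0 (dm u)) ;
  fb_xxm : bounded_by T K (dm (dx (dx u))) ;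
  fb_xmm : bounded_by T K (dm (dm (dx u))) ;
  fb_xmz : bounded_by T K (dz ord0 (dm (dx u))) ;
  fb_mmm : bounded_by T K (dm (dm (dm u))) ;
  fb_mmz : forall l, bounded_by T K (dz l (dm (dm u))) }.

Lemma exists_fields_bound (R : realType) (T : R) (U : R -> R -> P1 R -> R) :
  master_regularity T U -> master_higher_regularity T U ->
  exists2 K : R, 0 <= K & fields_bounded_by T K (mfield0 U).
Proof.
move=> me mh.
have [k1 H1] := me_x_bounded me; have [k2 H2] := me_m_bounded me.
have [k3 H3] := me_xx_bounded me; have [k4 H4] := me_xm_bounded me.
have [k5 H5] := me_mm_bounded me; have [k6 H6] := me_mz1_bounded mh.
have [k7 H7] := me_xxm_bounded mh; have [k8 H8] := me_xmm_bounded me.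
have [k9 H9] := me_xmz1_bounded mh; have [k10 H10] := me_mmm_bounded mh.
have [k11 H11] := me_mmz1_bounded mh; have [k12 H12] := me_mmz2_bounded mh.
pose r := [:: k1; k2; k3; k4; k5; k6; k7; k8; k9; k10; k11; k12].
exists (\sum_(b <- r) `|b|); first exact: sumr_ge0.
have B k (F : mfield R k) c : c \in r ->
    (forall t x m z, t \in `[0, T] -> `|F t x m z| <= c) ->
    bounded_by T (\sum_(b <- r) `|b|) F.
  move=> cr H t x m z tT; apply: (le_trans (H t x m z tT)).
  by apply: (le_trans (ler_norm c)); exact: norm_le_sum.
split.
- by apply: B H1; rewrite !inE eqxx.
- by apply: B H2; rewrite !inE eqxx ?orbT.
- by apply: B H3; rewrite !inE eqxx ?orbT.
- by apply: B H4; rewrite !inE eqxx ?orbT.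
- by apply: B H5; rewrite !inE eqxx ?orbT.
- by apply: B H6; rewrite !inE eqxx ?orbT.
- by apply: B H7; rewrite !inE eqxx ?orbT.
- by apply: B H8; rewrite !inE eqxx ?orbT.
- by apply: B H9; rewrite !inE eqxx ?orbT.
- by apply: B H10; rewrite !inE eqxx ?orbT.
- case=> [[|[|l]] hl] //.
    have -> : Ordinal hl = ord0 by apply/val_inj.
    by apply: B H11; rewrite !inE eqxx ?orbT.
  have -> : Ordinal hl = ord_max by apply/val_inj.
  by apply: B H12; rewrite !inE eqxx ?orbT.
Qed.

Section second_order_algebra.
Variable R : realFieldType.
Implicit Types (d : bool) (m K : R).

Lemma second_order_same d m K (xx xm mx mm mz : R) : 0 <= m * K -> m * K <= K ->
  `|xx| <= K -> `|m * xm| <= m * K -> `|m * mx| <= m * K -> `|m * (m * mm)| <= m * K ->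
  `|m * mz| <= m * K ->
  `|true%:R * (d%:R * xx + m * xm) + m * (d%:R * mx + m * mm + d%:R * mz)|
  <= 5 * K * (d%:R + m).
Proof.
move=> k0 k1 Bxx Bxm Bmx Bmm Bmz; rewrite mul1r.
case: d; rewrite ?mulr1n ?mulr0n ?mul1r ?mul0r ?add0r ?addr0.
  rewrite !mulrDr !(le_trans (ler_normD _ _))//.
  apply: (le_trans (lerD (ler_normD _ _) (ler_normD _ _))).
  by have := ler_normD (m * mx) (m * (m * mm)); lra.
by rewrite (le_trans (ler_normD _ _))//; lra.
Qed.

Lemma second_order_off m K (xx xm mx mm mz : R) :
  `|m * mx| <= m * K -> `|m * (m * mm)| <= m * K ->
  `|false%:R * (true%:R * xx + m * xm) + m * (true%:R * mx + m * mm + false%:R * mz)|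
  <= 2 * (m * K).
Proof.
move=> Bmx Bmm; rewrite mul1r !mul0r add0r addr0 mul1r mulrDr.
by rewrite (le_trans (ler_normD _ _))//; lra.
Qed.

(** The two mixed terms of the diagonal coincide by symmetry, which is the origin of the factor 2 in
    [residual]. *)
Lemma second_order_diag d m (xx xm xm' mx mm mz : R) : (d -> mx = xm /\ xm' = xm) ->
  d%:R * (d%:R * xx + m * xm) + m * (d%:R * mx + m * mm + true%:R * mz) =
  d%:R * (xx + 2 * (m * xm')) + m * mz + m * (m * mm).
Proof.
by case: d => [[]// -> ->|_]; rewrite ?mulr1n ?mulr0n; ring.
Qed.

End second_order_algebra.

(** * Bounds with explicit powers of 1/N *)

Section bounds.
Variables (R : realType) (T K : R) (n : nat) (U : R -> R -> P1 R -> R).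
Hypotheses (me : master_regularity T U) (mh : master_higher_regularity T U).
Hypotheses (K0 : 0 <= K) (fb : fields_bounded_by T K (mfield0 U)).
Let nu : R := n.+1%:R^-1.
Let u := mfield0 U.
Implicit Types (i j l : 'I_n.+1) (t : R) (x : 'rV[R]_n.+1).
Local Notation no_index := (@no_index n).

Let nu0 : 0 < nu. Proof. by rewrite invr_gt0 ltr0n. Qed.
Let nu1 : nu <= 1. Proof. by rewrite invf_le1 ?ltr0n// ler1n. Qed.

Let sum_nu (c : R) : \sum_(j < n.+1) nu * c = c.
Proof.
by rewrite sumr_const card_ord -mulrnAl -[nu *+ _]mulr_natl mulfV ?mul1r// pnatr_eq0.
Qed.

(** [ap] is the momentum U_x of the master equation at player [j]. [hp] is the part of d_i v^i due
    to the player's own mass in the empirical measure; the two add up to d_i v^i. *)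
Definition ap j : R -> 'rV[R]_n.+1 -> R := pull (dx u) j no_index.
Definition hp i : R -> 'rV[R]_n.+1 -> R := fun t x => nu * pull (dm u) i (one_index i) t x.
Definition ap1 j i : R -> 'rV[R]_n.+1 -> R := fun t x =>
  (j == i)%:R * pull (dx (dx u)) j no_index t x + nu * pull (dm (dx u)) j (one_index i) t x.
Definition hp1 i : R -> 'rV[R]_n.+1 -> R := fun t x =>
  nu * (pull (dx (dm u)) i (one_index i) t x + nu * pull (dm (dm u)) i (two_indices i i) t x
        + pull (dz ord0 (dm u)) i (one_index i) t x).

Lemma vp1_diag i t x : vp1 U i i t x = ap i t x + hp i t x.
Proof. by rewrite /vp1 eqxx mul1r. Qed.

Lemma vp1_off i j t x : i != j -> vp1 U i j t x = nu * pull (dm u) i (one_index j) t x.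
Proof. by rewrite /vp1 => /negPf ->; rewrite mul0r add0r. Qed.

Lemma derive_ap j i t x : t \in `[0, T] ->
  is_derive x (delta_mx 0 i) (ap j t) (ap1 j i t x).
Proof.
move=> tT; have C1_x : mfield_C1 T (dx u) (@no_partials R).
  by split; [exact: (me_xx me)|exact: (me_xm me)|case=> k hk; exfalso; rewrite ltn0 in hk].
apply: is_derive_eq (pull_derive j no_index i x tT C1_x) _.
by rewrite /pull_pd big_ord0 addr0.
Qed.

Let C1_1 (F : mfield R 1) : cdx T F -> cdm T F -> cdz T ord0 F ->
  mfield_C1 T F (fun c => dz c F).
Proof.
move=> cx cm [ex C]; split; [exact: cx|exact: cm|move=> c; rewrite (ord1 c)].
by split; [move=> t x m z tT; have /derivableP := ex t x m z tT|exact: C].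
Qed.

Lemma derive_hp i t x : t \in `[0, T] ->
  is_derive x (delta_mx 0 i) (hp i t) (hp1 i t x).
Proof.
move=> tT; have C := C1_1 (me_mx me) (me_mm me) (me_mz1 me).
apply: derive_scale; apply: is_derive_eq (pull_derive i (one_index i) i x tT C) _.
congr (_ + _ + _); first by rewrite eqxx mul1r.
by rewrite big_ord1 one_indexE eqxx mul1r.
Qed.

Lemma pull_bound k (F : mfield R k) i (a : 'I_k -> 'I_n.+1) t x :
  bounded_by T K F -> t \in `[0, T] -> `|pull F i a t x| <= K.
Proof. by move=> H; apply: H. Qed.

Lemma bounded_mx : bounded_by T K (dx (dm u)).
Proof. by move=> t x m z tT; rewrite -(me_xm_mx me)//; exact: (fb_xm fb). Qed.

(** The bound available is that of U_xxm; the last two derivatives are exchanged to reach it. *)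
Lemma pull_xmx_bound i j t x : t \in `[0, T] ->
  `|pull (dx (dm (dx u))) i (one_index j) t x| <= K.
Proof.
move=> tT; rewrite /pull /one_index select_snoc (dx_dm_emp _ _ _ _ tT).
- exact: (fb_xxm fb).
- exact: (me_xx me).1.
- exact: me_xm.
- exact: me_xxm.
- exact: me_xmx.
Qed.

(** The derivative in x is moved to the front in two exchanges, which leads to the bound on U_xmm.
    The inner exchange takes place under a derivative in the measure, hence as an equality of
    functions of the measure. *)
Lemma pull_mmx_bound i j l t x : t \in `[0, T] ->
  `|pull (dx (dm (dm u))) i (two_indices j l) t x| <= K.
Proof.
move=> tT; rewrite /pull /two_indices select_snoc (dx_dm_emp _ _ _ _ tT).
- rewrite [dm (dx (dm u)) t _ _ _]/dm.
  rewrite (_ : (fun m' => dx (dm u) t (x 0 i) m' _) =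
     fun m' => dm (dx u) t (x 0 i) m' (col' ord_max (rsnoc (select (one_index j) x) (x 0 l)))).
    exact: (fb_xmm fb).
  by apply: funext => m'; rewrite (me_xm_mx me).
- exact: (me_mx me).1.
- exact: me_mm.
- exact: me_mxm.
- exact: me_mmx.
Qed.

Lemma nuM_le a : a <= K -> nu * a <= nu * K.
Proof. by move=> aK; rewrite ler_wpM2l// ltW. Qed.

Let nr a : `|nu * a| = nu * `|a|. Proof. by rewrite normrM gtr0_norm. Qed.

Let nb a : `|a| <= K -> `|nu * a| <= nu * K.
Proof. by rewrite nr; exact: nuM_le. Qed.

Let nuK : 0 <= nu * K. Proof. by rewrite mulr_ge0// ltW. Qed.

Let nuKK : nu * K <= K. Proof. by rewrite ler_piMl. Qed.

Let nb2 a : `|a| <= K -> `|nu * a| <= K.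
Proof. by move=> /nb /le_trans; apply. Qed.

Lemma ap_bound j t x : t \in `[0, T] -> `|ap j t x| <= K.
Proof. by move=> tT; apply: pull_bound (fb_x fb) tT. Qed.

Lemma hp_bound i t x : t \in `[0, T] -> `|hp i t x| <= nu * K.
Proof. by move=> tT; apply: nb; exact: pull_bound (fb_m fb) tT. Qed.

Lemma vp1_off_bound i j t x : i != j -> t \in `[0, T] -> `|vp1 U i j t x| <= nu * K.
Proof. by move=> ij tT; rewrite vp1_off//; apply: nb; exact: pull_bound (fb_m fb) tT. Qed.

Let bnb (d : bool) a : `|a| <= K -> `|d%:R * a| <= K.
Proof. by move=> aK; rewrite normrM normr_nat (le_trans _ aK)// ler_piMl// lern1 leq_b1. Qed.

Let N3 (a b c : R) A B C : `|a| <= A -> `|b| <= B -> `|c| <= C -> `|a + b + c| <= A + B + C.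
Proof.
move=> ha hb hc; rewrite (le_trans (ler_normD _ _))// lerD//.
by rewrite (le_trans (ler_normD _ _))// lerD.
Qed.

Let N2 (a b : R) A B : `|a| <= A -> `|b| <= B -> `|a + b| <= A + B.
Proof. by move=> ha hb; rewrite (le_trans (ler_normD _ _))// lerD. Qed.

Lemma ap1_bound j i t x : t \in `[0, T] -> `|ap1 j i t x| <= K * ((j == i)%:R + nu).
Proof.
move=> tT; rewrite mulrDr [K * nu]mulrC; apply: N2.
  rewrite normrM normr_nat mulrC; apply: ler_wpM2r => //.
  exact: pull_bound (fb_xx fb) tT.
by apply: nb; exact: pull_bound (fb_xm fb) tT.
Qed.

Lemma hp1_bound i t x : t \in `[0, T] -> `|hp1 i t x| <= 3 * (nu * K).
Proof.
move=> tT; rewrite /hp1 nr -[3 * _]mulrCA; apply: ler_wpM2l; first exact: ltW.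
have -> : 3 * K = K + K + K by ring.
apply: N3; [exact: pull_bound bounded_mx tT| |exact: pull_bound (fb_mz fb) tT].
by apply: nb2; exact: pull_bound (fb_mm fb) tT.
Qed.

(** Of the five terms only U_xx lacks a factor [nu], and it occurs for [j = i] alone. *)
Lemma vp2_same_bound j i t x : t \in `[0, T] ->
  `|vp2 U j j i t x| <= 5 * K * ((j == i)%:R + nu).
Proof.
move=> tT; rewrite /vp2 eqxx -/nu -/u.
have Bxx := pull_bound j no_index x (fb_xx fb) tT.
have Bxm := nb (pull_bound j (one_index i) x (fb_xm fb) tT).
have Bmx := nb (pull_bound j (one_index j) x bounded_mx tT).
have Bmm := nb (nb2 (pull_bound j (two_indices j i) x (fb_mm fb) tT)).
have Bmz := nb (pull_bound j (one_index j) x (fb_mz fb) tT).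
exact: (second_order_same (j == i) nuK nuKK Bxx Bxm Bmx Bmm Bmz).
Qed.

Lemma vp2_off_bound i j t x : i != j -> t \in `[0, T] ->
  `|vp2 U i j i t x| <= 2 * (nu * K).
Proof.
move=> ij tT; rewrite /vp2 eqxx (negPf ij) eq_sym (negPf ij) -/nu -/u.
have Bmx := nb (pull_bound i (one_index j) x bounded_mx tT).
have Bmm := nb (nb2 (pull_bound i (two_indices j i) x (fb_mm fb) tT)).
exact: (second_order_off _ _ _ Bmx Bmm).
Qed.

(* The terms of the Laplacian of [vp i] that the master equation does not contain. *)
Definition residual i : R -> 'rV[R]_n.+1 -> R := fun t x =>
  2 * (nu * pull (dm (dx u)) i (one_index i) t x)
  + \sum_j nu * (nu * pull (dm (dm u)) i (two_indices j j) t x).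

Definition residual1 i : R -> 'rV[R]_n.+1 -> R := fun t x =>
  2 * (nu * pull_pd (dm (dx u)) (fun c => dz c (dm (dx u))) i (one_index i) i t x)
  + \sum_j nu * (nu * pull_pd (dm (dm u)) (fun c => dz c (dm (dm u))) i (two_indices j j) i t x).

Lemma laplacian_vp i t x : t \in `[0, T] ->
  \sum_j vp2 U i j j t x = pull (dx (dx u)) i no_index t x
    + nu * (\sum_j pull (dz ord0 (dm u)) i (one_index j) t x) + residual i t x.
Proof.
move=> tT.
have E j : vp2 U i j j t x =
    (i == j)%:R * (pull (dx (dx u)) i no_index t x
       + 2 * (nu * pull (dm (dx u)) i (one_index i) t x))
    + nu * (pull (dz ord0 (dm u)) i (one_index j) t x)
    + nu * (nu * pull (dm (dm u)) i (two_indices j j) t x).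
  rewrite /vp2 eqxx -/nu -/u; apply: second_order_diag => /eqP ->.
  by split=> //; rewrite /pull (me_xm_mx me).
rewrite (eq_bigr _ (fun j _ => E j)) !big_split/= -mulr_suml.
rewrite (bigD1 i)//= eqxx big1 ?addr0 ?mul1r; last first.
  by move=> j /negPf; rewrite eq_sym => ->.
rewrite -mulr_sumr /residual; ring.
Qed.

Let C1_xm : mfield_C1 T (dm (dx u)) (fun c => dz c (dm (dx u))).
Proof. exact: C1_1 (me_xmx mh) (me_xmm mh) (me_xmz1 mh). Qed.

Let C1_mm : mfield_C1 T (dm (dm u)) (fun c => dz c (dm (dm u))).
Proof.
split; [exact: me_mmx|exact: me_mmm|move=> c].
have [ex C] : cdz T c (dm (dm u)).
  case: c => [[|[|k]] hk] //.
  - by have -> : Ordinal hk = ord0 by [apply/val_inj]; exact: me_mmz1.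
  - by have -> : Ordinal hk = ord_max by [apply/val_inj]; exact: me_mmz2.
by split; [move=> t x m z tT; have /derivableP := ex t x m z tT|exact: C].
Qed.

Lemma derive_residual i t x : t \in `[0, T] ->
  is_derive x (delta_mx 0 i) (residual i t) (residual1 i t x).
Proof.
move=> tT; have D1 := pull_derive i (one_index i) i x tT C1_xm.
have D2 j := pull_derive i (two_indices j j) i x tT C1_mm.
exact: (derive_add (derive_scale 2 (derive_scale nu D1))
  (derive_sum _ (fun j _ => derive_scale nu (derive_scale nu (D2 j))))).
Qed.

Lemma residual_bound i t x : t \in `[0, T] -> `|residual i t x| <= 3 * (nu * K).
Proof.
move=> tT; have -> : 3 * (nu * K) = 2 * (nu * K) + nu * K by ring.
apply: N2.
  rewrite normrM normr_nat ler_pM2l//.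
  by apply: nb; exact: pull_bound (fb_xm fb) tT.
rewrite -mulr_sumr nr ler_pM2l// (le_trans (ler_norm_sum _ _ _))//.
apply: le_trans (_ : \sum_(j < n.+1) nu * K <= _); last first.
  by rewrite sum_nu.
by apply: ler_sum => j _; apply: nb; exact: pull_bound (fb_mm fb) tT.
Qed.

(** [10 = 2 * 3 + 4]: three terms in the chain rule for U_xm, and four for U_mm, which has two space
    arguments. *)
Lemma residual1_bound i t x : t \in `[0, T] -> `|residual1 i t x| <= 10 * (nu * K).
Proof.
move=> tT; have -> : 10 * (nu * K) = 2 * (nu * (3 * K)) + nu * (4 * K) by ring.
apply: N2.
  rewrite normrM normr_nat ler_pM2l// nr ler_pM2l//.
  have -> : 3 * K = K + K + K by ring.
  apply: N3; first exact: bnb (pull_xmx_bound _ _ _ tT).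
    by apply: nb2; exact: pull_bound (fb_xmm fb) tT.
  by rewrite big_ord1; apply: bnb; exact: pull_bound (fb_xmz fb) tT.
rewrite -mulr_sumr nr ler_pM2l// (le_trans (ler_norm_sum _ _ _))//.
apply: le_trans (_ : \sum_(j < n.+1) nu * (4 * K) <= _); last first.
  by rewrite sum_nu.
apply: ler_sum => j _; rewrite nr ler_pM2l//.
have -> : 4 * K = K + K + \sum_(c < 2) K by rewrite sumr_const card_ord; ring.
apply: N3; first exact: bnb (pull_mmx_bound _ _ _ _ tT).
  by apply: nb2; exact: pull_bound (fb_mmm fb) tT.
apply: (le_trans (ler_norm_sum _ _ _)); apply: ler_sum => c _.
by apply: bnb; exact: pull_bound (fb_mmz fb c) tT.
Qed.

End bounds.

Section projection_estimates.
Variables (R : realType) (T K : R) (n : nat) (U : R -> R -> P1 R -> R).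
Hypotheses (me : master_regularity T U) (fb : fields_bounded_by T K (mfield0 U)).
Hypothesis K0 : 0 <= K.
Let u := mfield0 U.
Implicit Types (i j l : 'I_n.+1) (t : R) (x : 'rV[R]_n.+1).

Lemma row0_eq (z w : 'rV[R]_0) : z = w.
Proof. by apply/rowP => -[k hk]; exfalso; rewrite ltn0 in hk. Qed.

Lemma select_one j x : select (one_index j) x = const_mx (x 0 j).
Proof. by apply/rowP => l; rewrite !mxE one_indexE. Qed.

Lemma vp_Lipschitz i t x y : t \in `[0, T] ->
  `|vp U i t y - vp U i t x| <= 2 * K * `|y - x|.
Proof.
move=> tT; rewrite /vp /pull (row0_eq (select _ x) 0) (row0_eq (select _ y) 0).
have -> : u t (y 0 i) (emp y) 0 - u t (x 0 i) (emp x) 0 =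
  (u t (y 0 i) (emp y) 0 - u t (x 0 i) (emp y) 0)
  + (u t (x 0 i) (emp y) 0 - u t (x 0 i) (emp x) 0) by ring.
have c k : `|y 0 k - x 0 k| <= `|y - x|.
  by have := mx_norm_coord (y - x) k; rewrite !mxE.
have -> : 2 * K * `|y - x| = K * `|y - x| + K * `|y - x| by ring.
rewrite (le_trans (ler_normD _ _))// lerD//.
  have Dx (s : R) : is_derive s 1 (fun s => u t s (emp y) 0) (dx u t s (emp y) 0).
    by have /derivableP := (me_x me).1 t s (emp y) 0 tT; rewrite -derive1E.
  have [s _ ->] := mean_value (fun s (_ : `|s - x 0 i| <= `|y 0 i - x 0 i|) => Dx s).
  by rewrite normrM ler_pM//; exact: (fb_x fb).
have H m z : `|mderive (fun m => u t (x 0 i) m 0) m z| <= K.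
  have := fb_m fb (t := t) (x 0 i) m (const_mx z) tT.
  by rewrite /dm mxE.
have E := @emp_Lipschitz R n (fun m => u t (x 0 i) m 0) ((me_m me).1 t (x 0 i) 0 tT) K x y H.
apply: (le_trans E).
apply: ler_wpM2l => //; apply: le_trans (_ : n.+1%:R^-1 * \sum_(k < n.+1) `|y - x| <= _).
  by rewrite ler_pM2l ?invr_gt0 ?ltr0n//; apply: ler_sum.
by rewrite sumr_const card_ord -[`|_| *+ _]mulr_natr mulrCA mulVf ?mulr1// pnatr_eq0.
Qed.

(** Joint continuity of [U] is not among its stated properties; it is recovered from continuity in
    time at a fixed point and a Lipschitz bound in space uniform in time. *)
Lemma vp_continuous i :
  {within [set p : R * 'rV[R]_n.+1 | p.1 \in `[0, T]], continuous (fun p => vp U i p.1 p.2)}.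
Proof.
apply/subspace_continuousP => -[t x] /= tT.
have Ht : tderivable T (fun s => vp U i s x) t by exact: (me_t me).1.
have C := tderivable_cvg Ht.
apply/cvgrPdist_le => e e0; have e20 : 0 < e / 2 by rewrite divr_gt0.
have N : \forall s \near t, `[0, T]%classic s -> `|vp U i t x - vp U i s x| <= e / 2.
  exact: (@cvgr_dist_le _ _ _ _ _ _ _ C _ e20).
have [d d0 H] := iffLR (nbhs_ballP _ _) N.
have K1 : 0 < 2 * K + 1 by rewrite ltr_wpDl// mulr_ge0.
rewrite near_withinE; apply/nbhs_ballP.
exists (Num.min d (e / 2 / (2 * K + 1))); first by rewrite /= lt_min d0 divr_gt0.
move=> [s y] [/= st yx] sT.
move: st; rewrite /ball/= lt_min => /andP[st _].
move: yx; rewrite mx_norm_ball /ball_/= lt_min => /andP[_ yx].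
have A := H s st sT; have B := vp_Lipschitz i x y sT.
have -> : vp U i t x - vp U i s y = (vp U i t x - vp U i s x) - (vp U i s y - vp U i s x) by ring.
rewrite (le_trans (ler_normB _ _))// [e]splitr lerD// (le_trans B)//.
rewrite distrC in yx; move: yx; rewrite ltr_pdivlMr// => yx; apply: le_trans (ltW yx).
by rewrite mulrC ler_wpM2l// lerDl.
Qed.

Lemma norm_le_rho x : `|x| <= rho x.
Proof.
apply: mx_norm_le => [|l]; first by rewrite (le_trans ler01)// rho_ge1.
have := sqr_le_rho x l; have := rho_ge1 x.
rewrite /rho (bigD1 l)//=; set s := \sum_(i < _ | _) _.
have s0 : 0 <= s by apply: sumr_ge0 => k _; exact: sqr_ge0.
have := sqr_ge0 (`|x 0 l| - 1); rewrite sqrrB1 real_normK ?num_real//.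
by have := normr_ge0 (x 0 l); lra.
Qed.

Lemma vp_growth : exists C : R, forall i t x, t \in `[0, T] -> `|vp U i t x| <= C * rho x.
Proof.
have [T0|T0] := ltP T 0.
  by exists 0 => i t x; rewrite in_itv/= => /andP[/le_trans/[apply]]; rewrite leNgt T0.
pose f t := `|vp U (ord0 : 'I_n.+1) t 0|.
have cf : {within `[0, T], continuous f}.
  apply/subspace_continuousP => t tT; apply: cvg_norm.
  by apply: tderivable_cvg; exact: (me_t me).1.
have [c _ H] := EVT_max T0 cf.
exists (2 * K + f c) => i t x tT.
(* At the origin all players see the same state, so one maximum over time serves every [i]. *)
have E : vp U i t 0 = vp U (ord0 : 'I_n.+1) t 0 by rewrite /vp /pull !mxE.
have A := vp_Lipschitz i 0 x tT; rewrite subr0 in A.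
have -> : vp U i t x = (vp U i t x - vp U i t 0) + vp U i t 0 by rewrite subrK.
rewrite (le_trans (ler_normD _ _))// mulrDl lerD//.
  by rewrite (le_trans A)// ler_wpM2l ?norm_le_rho// mulr_ge0.
rewrite E; apply: (le_trans (H t tT)).
by rewrite ler_peMr ?rho_ge1// normr_ge0.
Qed.

End projection_estimates.

Lemma master_equation_algebra (R : realFieldType) (a h c d nu S1 S2 S2' Z : R) :
  nu * S1 = Z -> S2 = S2' ->
  a + h + c * d + nu * S1 + c * (nu * S2) = a + h + c * (d + nu * S2') + Z.
Proof. by move=> -> ->; ring. Qed.

(** * The master equation at empirical measures *)

Section master_at_empirical_measures.
Variables (R : realType) (T sigma : R) (n : nat) (V : set R).
Variables (b f : R -> P1 R -> R -> R) (g : R -> P1 R -> R) (vhat : R -> P1 R -> R -> R).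
Variable U : R -> R -> P1 R -> R.
Let bhat := optimized vhat b.
Let fhat := optimized vhat f.
Let u := mfield0 U.
Let nu : R := n.+1%:R^-1.
Hypotheses (vmin : is_minimizer V b f vhat) (cr : coef_regularity bhat fhat).
Hypotheses (meq : master_equation T sigma V b f bhat g U) (me : master_regularity T U).

Let cont_m t xi (m : P1 R) (F : mfield R 1) : mfield_continuous T F -> t \in `[0, T] ->
  continuous (fun z : R => F t xi m (const_mx z)).
Proof.
move=> C tT z.
have := @mfield_cvg_fixed _ _ _ F _ (nbhs z) _ (fun=> xi) (fun=> m) (fun z : R => const_mx z)
  t xi m (const_mx z) C tT.
apply; [exact: cvg_cst|exact: cvg_cst|].
by apply: cvg_row => l; rewrite mxE; under eq_fun do rewrite mxE; exact: cvg_id.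
Qed.

(** The integrals turn into averages over the players. Measurability of the integrands comes from
    their continuity, for [bhat] through its Lipschitz bound. *)
Lemma master_at_emp i (t : R) (x : 'rV[R]_n.+1) : t \in `[0, T] ->
  0 = vpt T U i t x + hamiltonian b f vhat (x 0 i) (emp x) (ap U i t x)
    + sigma ^+ 2 / 2 * (pull (dx (dx u)) i (@no_index n) t x
        + nu * \sum_j pull (dz ord0 (dm u)) i (one_index j) t x)
    + \sum_j nu * pull (dm u) i (one_index j) t x * bhat (x 0 j) (emp x) (ap U j t x).
Proof.
move=> tT; have [/(_ t (x 0 i) (emp x) tT) + _] := meq.
rewrite (min_hamiltonianE vmin).
have m2 : measurable_fun setT (fun z : R => dz ord0 (dm u) t (x 0 i) (emp x) (const_mx z)).
  by apply: continuous_measurable_fun; apply: cont_m tT; exact: (me_mz1 me).2.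
have cx : continuous (fun z : R => dx u t z (emp x) 0).
  move=> z.
  have := @mfield_cvg_fixed _ _ _ (dx u) _ (nbhs z) _ id (fun=> emp x) (fun=> 0)
    t z (emp x) 0 (me_x me).2 tT.
  by apply; [exact: cvg_id|exact: cvg_cst|exact: cvg_cst].
have [L L0 HL] := bhat_Lipschitz cr.
have cb : continuous (fun z : R => bhat z (emp x) (dx u t z (emp x) 0)).
  move=> z; apply/cvgrPdist_le => e e0.
  have L1 : 0 < 2 * L + 1 by rewrite ltr_wpDl// mulr_ge0.
  have d0 : 0 < e / (2 * L + 1) by rewrite divr_gt0.
  have N1 : \forall y \near z, `|dx u t z (emp x) 0 - dx u t y (emp x) 0| <= e / (2 * L + 1).
    exact: (@cvgr_dist_le _ _ _ _ _ _ _ (cx z) _ d0).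
  have N2 : \forall y \near z, `|z - y| <= e / (2 * L + 1).
    by apply/nbhs_ballP; exists (e / (2 * L + 1)) => // y; rewrite /ball/= => /ltW.
  move: N1 N2; apply: filterS2 => y A B.
  apply: (le_trans (HL n z y x x _ _)).
  rewrite big1 ?mulr0 ?addr0; last by move=> k _; rewrite subrr normr0.
  apply: le_trans (_ : L * (e / (2 * L + 1) + e / (2 * L + 1)) <= _).
    by rewrite ler_wpM2l// lerD.
  have -> : L * (e / (2 * L + 1) + e / (2 * L + 1)) = e * (2 * L) / (2 * L + 1).
    by field; rewrite gt_eqF.
  by rewrite ler_pdivrMr// ler_pM2l// lerDl.
have cm : continuous (fun z : R =>
    dm u t (x 0 i) (emp x) (const_mx z) * bhat z (emp x) (dx u t z (emp x) 0)).
  move=> z; exact: (cvgM (@cont_m t (x 0 i) (emp x) (dm u) (me_m me).2 tT z) (cb z)).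
have m1 := continuous_measurable_fun cm.
rewrite !emp_integral// => E; rewrite [LHS]E.
rewrite /vpt /ap /pull (row0_eq (select _ x) 0) -/nu.
apply: master_equation_algebra.
  by rewrite mulr_sumr; apply: eq_bigr => k _; rewrite select_one mulrA.
by apply: eq_bigr => k _; rewrite select_one.
Qed.

End master_at_empirical_measures.

(** * Size and variation of the drift terms *)

(** A common upper bound for all coefficients in [drift_value] and [drift_slope], free of N: [L * M]
    stems from the term quadratic in w, [K * s2] from the residual, the others from products of a
    bound on [U] with the Lipschitz constant [L]. *)
Definition drift_constant (R : realType) (s2 K L M : R) : R :=
  2 * (L * M) + L * (6 + 17 * K) + K * L * (6 + 27 * K) + 10 * (K * s2).

Section drift.
Variables (R : realType) (n : nat) (i : 'I_n.+1) (s2 K L M : R).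
Hypotheses (s20 : 0 <= s2) (K0 : 0 <= K) (L0 : 0 <= L) (M0 : 0 <= M).
Let nu : R := n.+1%:R^-1.
Let C := drift_constant s2 K L M.
Variables W E q : 'I_n.+1 -> R.
Hypotheses (W0 : forall j, 0 <= W j) (E0 : forall j, 0 <= E j) (q0 : forall j, 0 <= q j).

Let nu0 : 0 < nu. Proof. by rewrite invr_gt0 ltr0n. Qed.
Let nu1 : nu <= 1. Proof. by rewrite invf_le1 ?ltr0n// ler1n. Qed.
Let sum_nu (c : R) : \sum_(j < n.+1) nu * c = c.
Proof.
by rewrite sumr_const card_ord -mulrnAl -[nu *+ _]mulr_natl mulfV ?mul1r// pnatr_eq0.
Qed.

Let KL0 : 0 <= K * L. Proof. exact: mulr_ge0. Qed.
Let KKL0 : 0 <= K * (K * L). Proof. exact: mulr_ge0. Qed.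
Let LM0 : 0 <= L * M. Proof. exact: mulr_ge0. Qed.
Let Ks0 : 0 <= K * s2. Proof. exact: mulr_ge0. Qed.
Let CE : C = 2 * (L * M) + 6 * L + 23 * (K * L) + 27 * (K * (K * L)) + 10 * (K * s2).
Proof. by rewrite /C /drift_constant; ring. Qed.

Let le_C c : c <= 2 * (L * M) + 6 * L + 23 * (K * L) + 27 * (K * (K * L)) + 10 * (K * s2) ->
  forall a, 0 <= a -> c * a <= C * a.
Proof. by move=> h a a0; rewrite ler_wpM2r// CE. Qed.

Let sum_i (c : R) : 0 <= c -> c * (nu * q i) <= \sum_j c * (nu * q j).
Proof.
move=> c0; rewrite (bigD1 i)//= lerDl sumr_ge0// => j _.
by rewrite !mulr_ge0// ltW.
Qed.

Let sum_off (F G : 'I_n.+1 -> R) : (forall j, j != i -> F j <= G j) ->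
  (forall j, 0 <= G j) -> \sum_(j | j != i) F j <= \sum_j G j.
Proof.
move=> FG G0; rewrite big_mkcond/=; apply: ler_sum => j _.
by case: ifPn => // /FG.
Qed.

(** [W j] stands for |w^j|. With the true drift as transport coefficient the products with [d1 j]
    vanish; every other term carries a factor [nu] except the square [W i ^+ 2], which [W i <= M]
    makes linear. *)
Lemma drift_value (w h B res : R) (d1 v1 b ba : 'I_n.+1 -> R) :
  `|w| = W i -> `|h| <= nu * K -> `|B - b i| <= 2 * L * (W i + nu * K) ->
  `|B - ba i| <= L * (W i + nu * K) -> W i <= M ->
  (forall j, `|b j - ba j| <= L * (W j + nu * K)) ->
  (forall j, j != i -> `|v1 j| <= nu * K) -> `|res| <= 3 * (nu * K) ->
  `|w * (B - b i) + h * (B - ba i)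
    + \sum_(j | j != i) (d1 j * (b j - b j) + v1 j * (b j - ba j)) + s2 * res|
  <= C * \sum_j nu * (nu + W i + W j).
Proof.
move=> ww hh HB HBa WM Hb Hv Hr.
have A1 : `|w * (B - b i)| <= W i * (2 * L * (W i + nu * K)) by rewrite normrM ww ler_wpM2l.
have A2 : `|h * (B - ba i)| <= nu * K * (L * (W i + nu * K)) by rewrite normrM ler_pM.
have A3 : `|\sum_(j | j != i) (d1 j * (b j - b j) + v1 j * (b j - ba j))| <=
    \sum_j nu * K * (L * (W j + nu * K)).
  apply: (le_trans (ler_norm_sum _ _ _)); apply: sum_off => j => [ji|].
    by rewrite subrr mulr0 add0r normrM ler_pM// Hv.
  by rewrite !mulr_ge0 ?addr_ge0 ?mulr_ge0// ltW.
have A4 : `|s2 * res| <= s2 * (3 * (nu * K)) by rewrite normrM ger0_norm// ler_wpM2l.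
have nW : nu * W i <= W i by rewrite ler_piMl.
have nn : nu * nu <= nu by rewrite ler_piMl// ltW.
have T1 : `|w * (B - b i)| <= \sum_(j < n.+1) nu * ((2 * (L * M) + 2 * (K * L)) * W i).
  rewrite sum_nu; apply: (le_trans A1).
  have R1 := ler_wpM2l (mulr_ge0 L0 (W0 i)) WM; have R2 := ler_wpM2l KL0 nW.
  by lra.
have T2 : `|h * (B - ba i)| <=
    \sum_(j < n.+1) nu * (K * L * W i + K * (K * L) * nu).
  rewrite sum_nu; apply: (le_trans A2).
  have -> : nu * K * (L * (W i + nu * K)) = K * L * (nu * W i) + K * (K * L) * (nu * nu) by ring.
  by apply: lerD; rewrite ler_wpM2l.
have T4 : `|s2 * res| <= \sum_(j < n.+1) nu * (3 * (K * s2) * nu).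
  by rewrite sum_nu; apply: (le_trans A4); rewrite le_eqVlt; apply/orP; left; apply/eqP; ring.
rewrite (le_trans (ler_normD _ _))//.
apply: le_trans (lerD (le_trans (ler_normD _ _) (lerD (le_trans (ler_normD _ _) (lerD T1 T2)) A3)) T4) _.
rewrite -!big_split/= mulr_sumr; apply: ler_sum => j _.
have -> : C * (nu * (nu + W i + W j)) = nu * (C * nu + C * W i + C * W j) by ring.
have -> : nu * ((2 * (L * M) + 2 * (K * L)) * W i) + nu * (K * L * W i + K * (K * L) * nu)
   + nu * K * (L * (W j + nu * K)) + nu * (3 * (K * s2) * nu) =
  nu * ((2 * (K * (K * L)) + 3 * (K * s2)) * nu + (2 * (L * M) + 3 * (K * L)) * W i
    + K * L * W j) by ring.
rewrite ler_pM2l//; apply: lerD; first apply: lerD; apply: le_C => //; try exact: ltW.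
- by move: LM0 L0 KL0 KKL0 Ks0; lra.
- by move: LM0 L0 KL0 KKL0 Ks0; lra.
- by move: LM0 L0 KL0 KKL0 Ks0; lra.
Qed.

(** Here [E j] stands for |d_j D^i| and [q j] for |d_i w^j|. The coefficients are frozen at [b j 0],
    so [d1 j] is multiplied by an increment vanishing at 0: its slope [c j] disappears from the
    bound, and only [E j] times the slope of [b j] remains. *)
Lemma drift_slope (w h B res : R -> R) (d1 v1 b ba : 'I_n.+1 -> R -> R) (c : 'I_n.+1 -> R) :
  `|w 0| = W i -> slope w (q i) -> `|h 0| <= nu * K -> slope h (3 * (nu * K)) ->
  slope B (L * (2 + 14 * K + q i)) ->
  `|B 0 - b i 0| <= 2 * L * (W i + nu * K) -> `|B 0 - ba i 0| <= L * (W i + nu * K) ->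
  (forall j, slope (b j) (L * ((1 + 5 * K) * ((j == i)%:R + nu) + q j))) ->
  (forall j, slope (ba j) (L * ((1 + K) * ((j == i)%:R + nu)))) ->
  (forall j, `|b j 0 - ba j 0| <= L * (W j + nu * K)) ->
  (forall j, `|d1 j 0| = E j) -> (forall j, slope (d1 j) (c j)) ->
  (forall j, j != i -> `|v1 j 0| <= nu * K) -> (forall j, j != i -> slope (v1 j) (2 * (nu * K))) ->
  slope res (10 * (nu * K)) ->
  slope (fun s => w s * (B s - b i 0) + h s * (B s - ba i s)
    + \sum_(j | j != i) (d1 j s * (b j s - b j 0) + v1 j s * (b j s - ba j s)) + s2 * res s)
  (C * (W i * q i)
   + C * \sum_j (nu * (nu + W i + W j) + E j * (nu + q j) + nu * q j)).
Proof.
move=> ww Sw hh Sh SB HB HBa Sb Sba Hb Hd Sd Hv Sv Sr.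
have S1 := slopeM Sw (slopeB SB (slope_cst (b i 0))).
have S2 := slopeM Sh (slopeB SB (Sba i)).
have S3 := slope_sum (index_enum _) (fun j (ji : j != i) =>
  slopeD (slopeM (Sd j) (slopeB (Sb j) (slope_cst (b j 0)))) (slopeM (Sv j ji) (slopeB (Sb j) (Sba j)))).
have S4 := slopeM (slope_cst s2) Sr.
apply: slope_le (slopeD (slopeD (slopeD S1 S2) S3) S4).
rewrite ww eqxx mulr1n addr0 mul0r addr0 (ger0_norm s20).
have nW : nu * W i <= W i by rewrite ler_piMl.
have nn : nu * nu <= nu by rewrite ler_piMl// ltW.
have T1 : W i * (L * (2 + 14 * K + q i)) + q i * `|B 0 - b i 0| <=
    3 * L * (W i * q i) + \sum_(j < n.+1) nu * ((2 * L + 14 * (K * L)) * W i)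
    + \sum_j 2 * (K * L) * (nu * q j).
  rewrite sum_nu; apply: (le_trans (lerD (lexx _) (ler_wpM2l (q0 i) HB))).
  have := sum_i (mulr_ge0 (ler0n _ 2) KL0); lra.
have T2 : `|h 0| * (L * (2 + 14 * K + q i) + L * ((1 + K) * (1 + nu))) + 3 * (nu * K) * `|B 0 - ba i 0| <=
    \sum_(j < n.+1) nu * (3 * (K * L) * W i + (4 * (K * L) + 19 * (K * (K * L))) * nu)
    + \sum_j K * L * (nu * q j).
  have P0 : 0 <= L * (2 + 14 * K + q i) + L * ((1 + K) * (1 + nu)).
    by rewrite addr_ge0// mulr_ge0 ?mulr_ge0 ?addr_ge0 ?mulr_ge0// ltW.
  have nK3 : 0 <= 3 * (nu * K) by rewrite !mulr_ge0// ltW.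
  rewrite sum_nu.
  apply: (le_trans (lerD (ler_wpM2r P0 hh) (ler_wpM2l nK3 HBa))).
  have Q := sum_i KL0.
  have R1 : K * L * (nu * W i) <= K * L * W i by rewrite ler_wpM2l.
  have R2 : K * (K * L) * (nu * nu) <= K * (K * L) * nu by rewrite ler_wpM2l.
  have R3 : K * L * (nu * nu) <= K * L * nu by rewrite ler_wpM2l.
  lra.
have T3 : \sum_(j | j != i) (`|d1 j 0| * (L * ((1 + 5 * K) * ((j == i)%:R + nu) + q j) + 0)
       + c j * `|b j 0 - b j 0| + (`|v1 j 0| * (L * ((1 + 5 * K) * ((j == i)%:R + nu) + q j)
       + L * ((1 + K) * ((j == i)%:R + nu))) + 2 * (nu * K) * `|b j 0 - ba j 0|)) <=
   \sum_j (nu * (2 * (K * L) * W j + (2 * (K * L) + 8 * (K * (K * L))) * nu)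
      + ((L + 5 * (K * L)) * (E j * nu) + L * (E j * q j)) + K * L * (nu * q j)).
  apply: sum_off => [j ji|j].
    rewrite (negPf ji) mulr0n !add0r subrr normr0 mulr0 !addr0 Hd.
    have P0 : 0 <= L * ((1 + 5 * K) * nu + q j) + L * ((1 + K) * nu).
      by rewrite addr_ge0// mulr_ge0// ?addr_ge0 ?mulr_ge0 ?addr_ge0 ?mulr_ge0// ltW.
    have nK2 : 0 <= 2 * (nu * K) by rewrite !mulr_ge0// ltW.
    have A := ler_wpM2r P0 (Hv j ji); have B' := ler_wpM2l nK2 (Hb j).
    by lra.
  have N0 := ltW nu0; by rewrite !(addr_ge0, mulr_ge0).
have T4 : s2 * (10 * (nu * K)) <= \sum_(j < n.+1) nu * (10 * (K * s2) * nu).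
  by rewrite sum_nu; lra.
apply: (le_trans (lerD (lerD (lerD T1 T2) T3) T4)).
have AC (a1 a2 a3 a4 a5 a6 a7 : R) :
  a1 + a2 + a3 + (a4 + a5) + a6 + a7 = a1 + (a2 + a3 + (a4 + a5) + a6 + a7) by ring.
rewrite AC.
apply: lerD.
  by apply: le_C; [move: LM0 L0 KL0 KKL0 Ks0; lra|exact: mulr_ge0].
rewrite -!big_split/= mulr_sumr; apply: ler_sum => j _.
have N0 : 0 <= nu by exact: ltW.
have X1 : (6 * L + 20 * (K * L)) * (nu * W i) <= C * (nu * W i).
  by apply: le_C; [move: LM0 L0 KL0 KKL0 Ks0; lra|exact: mulr_ge0].
have X2 : (2 * (K * L)) * (nu * W j) <= C * (nu * W j).
  by apply: le_C; [move: LM0 L0 KL0 KKL0 Ks0; lra|exact: mulr_ge0].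
have X3 : (6 * (K * L) + 27 * (K * (K * L)) + 10 * (K * s2)) * (nu * nu) <= C * (nu * nu).
  by apply: le_C; [move: LM0 L0 KL0 KKL0 Ks0; lra|exact: mulr_ge0].
have X4 : (6 * L + 20 * (K * L)) * (E j * nu) <= C * (E j * nu).
  by apply: le_C; [move: LM0 L0 KL0 KKL0 Ks0; lra|exact: mulr_ge0].
have X5 : (L) * (E j * q j) <= C * (E j * q j).
  by apply: le_C; [move: LM0 L0 KL0 KKL0 Ks0; lra|exact: mulr_ge0].
have X6 : (4 * (K * L)) * (nu * q j) <= C * (nu * q j).
  by apply: le_C; [move: LM0 L0 KL0 KKL0 Ks0; lra|exact: mulr_ge0].
have Y1 := mulr_ge0 L0 (mulr_ge0 N0 (W0 i)).
have Y2 := mulr_ge0 KL0 (mulr_ge0 N0 (W0 i)).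
have Y3 := mulr_ge0 L0 (mulr_ge0 (E0 j) N0).
have Y4 := mulr_ge0 KL0 (mulr_ge0 (E0 j) N0).
have Y5 := mulr_ge0 KL0 (mulr_ge0 N0 (q0 j)).
move: LM0 L0 KL0 KKL0 Ks0; lra.
Qed.

End drift.

(** * The difference of the two systems *)

(** The linear term accounts for the displacement of the state and of the measure, the other two for
    the momenta. *)
Lemma slope_Lip2 (R : realType) (f g1 g2 : R -> R) (A k1 k2 c1 c2 : R) :
  0 <= A -> 0 <= k1 -> 0 <= k2 -> slope g1 c1 -> slope g2 c2 ->
  (forall s, `|f s - f 0| <= A * `|s| + k1 * `|g1 s - g1 0| + k2 * `|g2 s - g2 0|) ->
  slope f (A + k1 * c1 + k2 * c2).
Proof.
move=> A0 k10 k20 S1 S2 H.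
have Sid : slope (fun s : R => s) 1.
  have := is_derive_slope (is_derive_id (0 : R) (1 : R)); by rewrite normr1.
pose k (i : nat) : R := match i with 0 => A | 1 => k1 | _ => k2 end.
pose F (i : nat) : R -> R := match i with 0 => id | 1 => g1 | _ => g2 end.
pose c (i : nat) : R := match i with 0 => 1 | 1 => c1 | _ => c2 end.
have := @slope_Lip R nat [:: 0; 1; 2]%N k F c f.
rewrite !big_cons big_nil /= addr0 mulr1 addrA; apply.
- by case=> [|[|?]].
- by case=> [|[|?]].
- by move=> s; rewrite !big_cons big_nil /= addr0 subr0 addrA.
Qed.

Lemma difference_algebra (R : realFieldType) (I : finType) (i : I)
    (ut vt hp ha s lu lv X r w h B : R) (ud m v1 d1 bp ba be : I -> R) :
  0 = ut + hp + \sum_(j | j != i) ud j * bp j + s * lu ->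
  0 = vt + ha + s * X + \sum_j m j * ba j ->
  lv = X + r -> hp - ha = (w + h) * B -> m i = h -> d1 i = w ->
  (forall j, j != i -> m j = v1 j) -> (forall j, d1 j = ud j - v1 j) ->
  ut - vt + s * (lu - lv) + \sum_j be j * d1 j =
  - (w * (B - be i) + h * (B - ba i)
     + \sum_(j | j != i) (d1 j * (bp j - be j) + v1 j * (bp j - ba j)) + s * r).
Proof.
move=> E1 E2 -> EH mi di mv dd.
rewrite (bigD1 i)//= di; rewrite (bigD1 i)//= mi in E2.
have {}mv : \sum_(j | j != i) m j * ba j = \sum_(j | j != i) v1 j * ba j.
  by apply: eq_bigr => j /mv ->.
rewrite mv in E2.
have -> : \sum_(j | j != i) (d1 j * (bp j - be j) + v1 j * (bp j - ba j)) =
  \sum_(j | j != i) ud j * bp j - \sum_(j | j != i) v1 j * ba j - \sum_(j | j != i) be j * d1 j.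
  by rewrite -!sumrB; apply: eq_bigr => j _; rewrite dd; ring.
move: (\sum_(j | j != i) ud j * bp j) (\sum_(j | j != i) v1 j * ba j) (\sum_(j | j != i) be j * d1 j)
  E1 E2 => S1 S2 S3 E1 E2.
have {}EH : hp = ha + (w + h) * B by rewrite -EH; ring.
rewrite EH in E1; move: E1 E2; lra.
Qed.

Section continuous_on.
Variables (R : realType) (n : nat) (D : interval R) (G : R -> 'rV[R]_n.+1 -> R).
Hypothesis C : continuous_on D G.

Lemma continuous_on_near (t : R) (x : 'rV[R]_n.+1) (e : R) : t \in D -> 0 < e ->
  exists2 r, 0 < r & forall s y, ball t r s -> ball x r y -> s \in D -> `|G t x - G s y| <= e.
Proof.
move=> tD e0; move/subspace_continuousP : C => /(_ (t, x) tD) /cvgrPdist_le /(_ e e0).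
rewrite near_withinE => /nbhs_ballP[r /= r0 N].
by exists r => // s y ts xy sD; exact: (N (s, y)).
Qed.

Lemma continuous_on_row (t : R) : t \in D -> continuous (G t).
Proof.
move=> tD x; apply/(@cvgrPdist_le _ _ _ _ (nbhs_filter x)) => e e0; have [r r0 N] := continuous_on_near x tD e0.
by apply/nbhs_ballP; exists r => // y xy; apply: N => //; exact: ballxx.
Qed.

Lemma continuous_on_interior (t : R) (x : 'rV[R]_n.+1) (d : R) : 0 < d ->
  (forall s, ball t d s -> s \in D) -> {for (t, x), continuous (fun p => G p.1 p.2)}.
Proof.
move=> d0 HD; apply/cvgrPdist_le => e e0.
have [r r0 N] := continuous_on_near x (HD t (ballxx t d0)) e0.
refine (iffRL (@nbhs_ballP R (R * 'rV[R]_n.+1)%type (t, x) _) _); exists (Num.min r d); first by rewrite /= lt_min r0.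
move=> [s y] [/= ts xy]; apply: N.
- by apply: le_ball ts; rewrite ge_min lexx.
- by apply: le_ball xy; rewrite ge_min lexx.
- by apply: HD; apply: le_ball ts; rewrite ge_min lexx orbT.
Qed.

End continuous_on.

Section difference.
Variables (R : realType) (T sigma : R) (n : nat) (V : set R).
Variables (b f : R -> P1 R -> R -> R) (g : R -> P1 R -> R) (vhat : R -> P1 R -> R -> R).
Variable U : R -> R -> P1 R -> R.
Variable Un : 'I_n.+1 -> R -> 'rV[R]_n.+1 -> R.
Let bhat := optimized vhat b.
Let fhat := optimized vhat f.
Let nu : R := n.+1%:R^-1.
Hypotheses (vmin : is_minimizer V b f vhat) (cr : coef_regularity bhat fhat).
Hypotheses (np : nplayer_solution T sigma V b f bhat g Un) (nh : nplayer_higher_regularity T Un).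
Hypotheses (meq : master_equation T sigma V b f bhat g U).
Hypotheses (me : master_regularity T U) (mh : master_higher_regularity T U).
Variables K L M : R.
Hypotheses (K0 : 0 <= K) (fb : fields_bounded_by T K (mfield0 U)).
Hypotheses (L0 : 0 <= L) (HL : forall n x x' (y y' : 'rV[R]_n.+1) p p',
  `|bhat x (emp y) p - bhat x' (emp y') p'| <=
  L * (`|x - x'| + n.+1%:R^-1 * (\sum_k `|y 0 k - y' 0 k|) + `|p - p'|)).
Implicit Types (i j l : 'I_n.+1) (t : R) (x : 'rV[R]_n.+1).

Definition bp j : R -> 'rV[R]_n.+1 -> R := fun t x => bhat (x 0 j) (emp x) (pd j (Un j) t x).
Definition bap j : R -> 'rV[R]_n.+1 -> R := fun t x => bhat (x 0 j) (emp x) (ap U j t x).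
(* Mean slope of the Hamiltonian between the momenta of the two systems. *)
Definition Bbar i : R -> 'rV[R]_n.+1 -> R := fun t x =>
  secant (hamiltonian b f vhat (x 0 i) (emp x)) (bhat (x 0 i) (emp x)) (pd i (Un i) t x) (ap U i t x).

Definition Dn i : R -> 'rV[R]_n.+1 -> R := fun t x => Un i t x - vp U i t x.
Definition Dnt i : R -> 'rV[R]_n.+1 -> R := fun t x => pt T (Un i) t x - vpt T U i t x.
Definition Dn1 i j : R -> 'rV[R]_n.+1 -> R := fun t x => pd j (Un i) t x - vp1 U i j t x.
Definition Dn2 i j l : R -> 'rV[R]_n.+1 -> R := fun t x => pd l (pd j (Un i)) t x - vp2 U i j l t x.
Definition Dn3 i j l p : R -> 'rV[R]_n.+1 -> R := fun t x =>
  pd p (pd l (pd j (Un i))) t x - vp3 U i j l p t x.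
Definition Dn1t i : R -> 'rV[R]_n.+1 -> R := fun t x =>
  pt T (pd i (Un i)) t x - vp1t T U i i t x.

Let sub1 t : t \in `]0, T] -> t \in `[0, T].
Proof. by rewrite !in_itv/= => /andP[/ltW -> ->]. Qed.

(** The numbers [be j] are free: the drift at (t, x) gives the equation for D^i, while values frozen
    at another point give an identity along a line whose left-hand side is differentiable. The
    Hamiltonians enter through [secantE], with momentum gap w^i + h^i. *)
Lemma difference_equation i t x (be : 'I_n.+1 -> R) : t \in `]0, T] ->
  Dnt i t x + sigma ^+ 2 / 2 * (\sum_j Dn2 i j j t x) + \sum_j be j * Dn1 i j t x =
  - (Dn1 i i t x * (Bbar i t x - be i) + hp U i t x * (Bbar i t x - bap i t x)
     + \sum_(j | j != i) (Dn1 i j t x * (bp j t x - be j) + vp1 U i j t x * (bp j t x - bap j t x))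
     + sigma ^+ 2 / 2 * residual U i t x).
Proof.
move=> tT; have tT' := sub1 tT.
have E1 := np_pde np i x tT; rewrite (min_hamiltonianE vmin) in E1.
have E2 := master_at_emp vmin cr meq me i x tT'.
rewrite /Dn2 sumrB.
apply: (difference_algebra _ E1 E2 (laplacian_vp me i x tT') _ _ _ _).
- have -> : Dn1 i i t x + hp U i t x = pd i (Un i) t x - ap U i t x.
    by rewrite /Dn1 vp1_diag; ring.
  exact: secantE.
- by [].
- by [].
- by move=> j ji; rewrite vp1_off// eq_sym.
- by [].
Qed.

Let derive_Un1 i j t x : t \in `[0, T] -> is_derive x (delta_mx 0 j) (Un i t) (pd j (Un i) t x).
Proof. by move=> tT; have /derivableP := (np_x np i j).1 t x tT. Qed.

Let derive_Un2 i j l t x : t \in `[0, T] ->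
  is_derive x (delta_mx 0 l) (pd j (Un i) t) (pd l (pd j (Un i)) t x).
Proof. by move=> tT; have /derivableP := (np_xx np i j l).1 t x tT. Qed.

Let derive_Un3 i j l p t x : t \in `[0, T] ->
  is_derive x (delta_mx 0 p) (pd l (pd j (Un i)) t) (pd p (pd l (pd j (Un i))) t x).
Proof. by move=> tT; have /derivableP := (np_xxx nh i j l p).1 t x tT. Qed.

Lemma derive_Dn i j t x : t \in `[0, T] -> is_derive x (delta_mx 0 j) (Dn i t) (Dn1 i j t x).
Proof. by move=> tT; exact: (derive_sub (derive_Un1 i j x tT) (derive_vp me i j x tT)). Qed.

Lemma derive_Dn1 i j l t x : t \in `[0, T] ->
  is_derive x (delta_mx 0 l) (Dn1 i j t) (Dn2 i j l t x).
Proof. by move=> tT; exact: (derive_sub (derive_Un2 i j l x tT) (derive_vp1 me i j l x tT)). Qed.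

Lemma derive_Dn2 i j l p t x : t \in `[0, T] ->
  is_derive x (delta_mx 0 p) (Dn2 i j l t) (Dn3 i j l p t x).
Proof. by move=> tT; exact: (derive_sub (derive_Un3 i j l p x tT) (derive_vp2 mh i j l p x tT)). Qed.

Lemma Dn2_continuous i j l : continuous_on `[0, T] (Dn2 i j l).
Proof.
apply: within_add; first exact: (np_xx np i j l).2.
by apply: within_opp; exact: (vp2_continuous me).
Qed.

Lemma Dn3_continuous i j l p : continuous_on `[0, T] (Dn3 i j l p).
Proof.
apply: within_add; first exact: (np_xxx nh i j l p).2.
by apply: within_opp; exact: (vp3_continuous mh).
Qed.

Lemma Dn_commute t : t \in `[0, T] ->
  (forall i j l x, Dn2 l i j t x = Dn2 l j i t x) /\
  (forall i j l x, Dn3 l j j i t x = Dn3 l i j j t x).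
Proof.
move=> tT; have H l := third_derivatives_commute (fun j y => derive_Dn l j y tT)
  (fun j p y => derive_Dn1 l j p y tT) (fun j p q y => derive_Dn2 l j p q y tT)
  (fun j p => continuous_on_row (@Dn2_continuous l j p) tT)
  (fun j p q => continuous_on_row (@Dn3_continuous l j p q) tT).
by split=> [i j l x|i j l x]; [exact: (H l).1|exact: (H l).2].
Qed.

Lemma derive_t_Dn i t x : t \in `]0, T[ ->
  is_derive t 1 (Dn i ^~ x) (Dnt i t x) /\ is_derive t 1 (Dn1 i i ^~ x) (Dn1t i t x).
Proof.
move=> tT; have tT' : t \in `]0, T] by move: tT; rewrite !in_itv/= => /andP[-> /ltW ->].
split.
- exact: (derive_sub (tderivable_is_derive tT ((np_t np i).1 t x tT')) (derive_t_vp me i x tT)).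
- exact: (derive_sub (tderivable_is_derive tT ((np_xt nh i i).1 t x tT')) (derive_t_vp1 mh i i x tT)).
Qed.

(** Time and space derivatives of D^i commute; a ball of times inside []0, T[] makes Schwarz's
    theorem applicable. *)
Lemma derive_Dnt i t x : t \in `]0, T[ -> is_derive x (delta_mx 0 i) (Dnt i t) (Dn1t i t x).
Proof.
move=> tT; have tT' : t \in `]0, T] by move: tT; rewrite !in_itv/= => /andP[-> /ltW ->].
pose F (s : R) (y : 'rV[R]_n.+1) := pd i (pt T (Un i)) s y - vpt1 T U i i s y.
have dF (s : R) (y : 'rV[R]_n.+1) : s \in `]0, T] ->
    is_derive y (delta_mx 0 i) (Dnt i s) (F s y).
  move=> sT; have /derivableP A := (np_tx nh i i).1 s y sT.
  exact: (derive_sub A (derive_vpt mh i i y (sub1 sT))).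
rewrite -(_ : F t x = Dn1t i t x); first exact: dF.
move: (tT); rewrite in_itv/= => /andP[t0 t1].
pose d := Num.min t (T - t).
have d0 : 0 < d by rewrite lt_min t0 subr_gt0.
have I (s : R) : `|s - t| < d -> s \in `]0, T[.
  by rewrite lt_min !ltr_norml in_itv/=; lra.
have I1 (s : R) : `|s - t| < d -> s \in `]0, T].
  by move=> /I; rewrite !in_itv/= => /andP[-> /ltW ->].
have I2 (s : R) : ball t d s -> s \in `]0, T] by rewrite /ball/= distrC; exact: I1.
have wI (F1 F2 : R -> 'rV[R]_n.+1 -> R) : continuous_on `]0, T] F1 -> continuous_on `[0, T] F2 ->
    continuous_on `]0, T] (fun t x => F1 t x - F2 t x).
  move=> C1 C2; apply: within_add C1 _; apply: within_opp.
  by apply: continuous_subspaceW C2 => -[s y] /=; exact: sub1.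
apply: (@schwarz_time R n (Dn i) (Dnt i) (Dn1 i i) F (Dn1t i) i d t x d0).
- by move=> s y /I sT; exact: (derive_t_Dn i y sT).1.
- by move=> s y /I1 /sub1 sT; exact: derive_Dn.
- by move=> s y /I1; exact: dF.
- by move=> s y /I sT; exact: (derive_t_Dn i y sT).2.
- apply: (continuous_on_interior _ d0 I2); apply: wI; first exact: (np_tx nh i i).2.
  exact: (vpt1_continuous mh).
- apply: (continuous_on_interior _ d0 I2); apply: wI; first exact: (np_xt nh i i).2.
  exact: (vp1t_continuous mh).
Qed.

Let bhat_Lip_y (xi : R) x (y y' : R) : `|bhat xi (emp x) y - bhat xi (emp x) y'| <= L * `|y - y'|.
Proof.
have := HL xi xi x x y y'; rewrite subrr normr0 big1 ?mulr0 ?addr0 ?add0r//.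
by move=> k _; rewrite subrr normr0.
Qed.

Let dH (xi : R) x (y : R) :
  is_derive y 1 (hamiltonian b f vhat xi (emp x)) (bhat xi (emp x) y).
Proof. exact: (derive_hamiltonian vmin y (bhat_Lip_y xi x)). Qed.

Let p_bound j t x : t \in `[0, T] ->
  `|pd j (Un j) t x - ap U j t x| <= `|Dn1 j j t x| + nu * K.
Proof.
move=> tT; have -> : pd j (Un j) t x - ap U j t x = Dn1 j j t x + hp U j t x.
  by rewrite /Dn1 vp1_diag; ring.
by rewrite (le_trans (ler_normD _ _))// lerD2l; exact: (hp_bound fb).
Qed.

Lemma bp_bap j t x : t \in `[0, T] ->
  `|bp j t x - bap j t x| <= L * (`|Dn1 j j t x| + nu * K).
Proof. by move=> tT; apply: (le_trans (bhat_Lip_y _ _ _ _)); rewrite ler_wpM2l// p_bound. Qed.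

Let Bbar_bp i t x : t \in `[0, T] ->
  `|Bbar i t x - bp i t x| <= 2 * L * (`|Dn1 i i t x| + nu * K).
Proof.
(* [bhat] is a mean slope over a degenerate segment, so [secant_Lip] compares it with [Bbar]; here
   the end point [a] moves, which costs the factor 2. *)
move=> tT; rewrite /bp -(secant_cst (hamiltonian b f vhat (x 0 i) (emp x)) (bhat (x 0 i) (emp x))).
apply: le_trans (_ : 0 + L * (2 * `|ap U i t x - pd i (Un i) t x|
   + `|pd i (Un i) t x - pd i (Un i) t x|) <= _).
  by apply: secant_Lip => // y y'; rewrite add0r; exact: bhat_Lip_y.
rewrite subrr normr0 addr0 add0r [2 * L]mulrC -mulrA ler_wpM2l// ler_pM2l// distrC.
exact: p_bound.
Qed.

Let Bbar_bap i t x : t \in `[0, T] ->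
  `|Bbar i t x - bap i t x| <= L * (`|Dn1 i i t x| + nu * K).
Proof.
move=> tT; rewrite /bap -(secant_cst (hamiltonian b f vhat (x 0 i) (emp x)) (bhat (x 0 i) (emp x))).
apply: le_trans (_ : 0 + L * (2 * `|ap U i t x - ap U i t x|
   + `|pd i (Un i) t x - ap U i t x|) <= _).
  by apply: secant_Lip => // y y'; rewrite add0r; exact: bhat_Lip_y.
by rewrite subrr normr0 mulr0 !add0r ler_wpM2l// p_bound.
Qed.

Hypotheses (M0 : 0 <= M)
  (w_bound : forall i t x, t \in `]0, T] -> `|Dn1 i i t x| <= M).
Let C := drift_constant (sigma ^+ 2 / 2) K L M.
Let s20 : 0 <= sigma ^+ 2 / 2. Proof. by rewrite divr_ge0// sqr_ge0. Qed.

Lemma difference_drift i t x : t \in `]0, T[ ->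
  `|Dnt i t x + sigma ^+ 2 / 2 * (\sum_j Dn2 i j j t x) + \sum_j bp j t x * Dn1 i j t x|
  <= C * \sum_j nu * (nu + `|Dn1 i i t x| + `|Dn1 j j t x|).
Proof.
move=> tT; have tT1 : t \in `]0, T] by move: tT; rewrite !in_itv/= => /andP[-> /ltW ->].
have tT0 := sub1 tT1.
rewrite (difference_equation i x (fun j => bp j t x) tT1) normrN.
apply: (@drift_value R n i (sigma ^+ 2 / 2) K L M s20 K0 L0 M0 (fun j => `|Dn1 j j t x|)
  _ _ _ _ _ (Dn1 i ^~ t ^~ x) (vp1 U i ^~ t ^~ x) (bp ^~ t ^~ x) (bap ^~ t ^~ x)) => //.
- exact: (hp_bound fb).
- exact: Bbar_bp.
- exact: Bbar_bap.
- exact: w_bound.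
- by move=> j; exact: bp_bap.
- by move=> j ji; apply: (vp1_off_bound fb) => //; rewrite eq_sym.
- exact: (residual_bound fb).
Qed.

Section along_a_line.
Variables (i : 'I_n.+1) (t : R) (x : 'rV[R]_n.+1).
Hypothesis tT : t \in `]0, T[.
Let xs (s : R) : 'rV[R]_n.+1 := x + s *: delta_mx 0 i.
Let tT1 : t \in `]0, T]. Proof. by move: tT; rewrite !in_itv/= => /andP[-> /ltW ->]. Qed.
Let tT0 : t \in `[0, T]. Proof. exact: sub1. Qed.

Let xs0 : xs 0 = x. Proof. by rewrite /xs scale0r addr0. Qed.

Let slope_xs (F : 'rV[R]_n.+1 -> R) (l : R) : is_derive x (delta_mx 0 i) F l ->
  slope (fun s => F (xs s)) `|l|.
Proof. by move=> H; apply: is_derive_slope; exact: (iffLR (is_derive_line0 _ _ _ _) H). Qed.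

Let slope_le_xs (F : 'rV[R]_n.+1 -> R) (l c : R) : is_derive x (delta_mx 0 i) F l -> `|l| <= c ->
  slope (fun s => F (xs s)) c.
Proof. by move=> H lc; exact: (slope_le lc (slope_xs H)). Qed.

(** Displacing [x_i] by [s] moves the state of [j] only when [j = i] and the empirical measure by
    [|s| / N]; hence the factor [(j == i)%:R + nu]. *)
Let bhat_xs j s p p' : `|bhat (xs s 0 j) (emp (xs s)) p - bhat (x 0 j) (emp x) p'| <=
  L * (((j == i)%:R + nu) * `|s| + `|p - p'|).
Proof.
have E k : `|xs s 0 k - x 0 k| = (k == i)%:R * `|s|.
  rewrite !mxE eqxx/= addrAC subrr add0r normrM mulrC.
  by case: eqP; rewrite ?mulr1n ?mulr0n ?normr1 ?normr0.
apply: (le_trans (HL _ _ _ _ _ _)); rewrite E (eq_bigr _ (fun k _ => E k)).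
rewrite (bigD1 i)//= eqxx mul1r big1 ?addr0; last by move=> k /negPf ->; rewrite mul0r.
by rewrite -mulrDl.
Qed.

Let nu0 : 0 <= nu. Proof. by rewrite invr_ge0 ler0n. Qed.
Let nu1 : nu <= 1. Proof. by rewrite invf_le1 ?ltr0n// ler1n. Qed.

Let q j : R := `|Dn2 j j i t x|.

Let slope_p j : slope (fun s => pd j (Un j) t (xs s)) (5 * K * ((j == i)%:R + nu) + q j).
Proof.
have /slope_le_xs : is_derive x (delta_mx 0 i) (pd j (Un j) t) (vp2 U j j i t x + Dn2 j j i t x).
  apply: is_derive_eq (derive_Un2 j j i x tT0) _.
  by rewrite /Dn2 addrC subrK.
by apply; rewrite (le_trans (ler_normD _ _))// lerD2r; exact: (vp2_same_bound me K0 fb).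
Qed.

Let slope_ap j : slope (fun s => ap U j t (xs s)) (K * ((j == i)%:R + nu)).
Proof. by apply: slope_le_xs (derive_ap me j i x tT0) _; exact: (ap1_bound fb). Qed.

Let slope_bhat j (F : 'rV[R]_n.+1 -> R) (c : R) : slope (fun s => F (xs s)) c ->
  slope (fun s => bhat (xs s 0 j) (emp (xs s)) (F (xs s))) (L * ((j == i)%:R + nu + c)).
Proof.
move=> S; have A0 : 0 <= L * ((j == i)%:R + nu) by rewrite mulr_ge0// addr_ge0.
have := slope_Lip2 A0 L0 (lexx 0) S S; rewrite mul0r addr0 -mulrDr; apply.
move=> s; rewrite xs0 mul0r addr0; apply: (le_trans (bhat_xs _ _ _ _)).
by rewrite mulrDr mulrA.
Qed.

(** The Lipschitz constant is [L ((1 + nu)(1 + 2 K + 5 K) + q i)], with [2 K] from [ap] and [5 K]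
    from the momentum of the game; then [nu <= 1]. *)
Let slope_Bbar : slope (fun s => Bbar i t (xs s)) (L * (2 + 14 * K + q i)).
Proof.
have A0 : 0 <= L * (1 + nu) by rewrite mulr_ge0// addr_ge0.
have L2 : 0 <= 2 * L by rewrite mulr_ge0.
have H := slope_Lip2 A0 L2 L0 (slope_ap i) (slope_p i).
apply: slope_le (H _ _).
  rewrite eqxx mulr1n.
  have N0 : 0 <= 1 - nu by rewrite subr_ge0.
  have P1 := mulr_ge0 L0 N0; have P2 := mulr_ge0 L0 (mulr_ge0 K0 N0); lra.
move=> s; rewrite xs0 /Bbar.
apply: le_trans (_ : L * ((1 + nu) * `|s|) + L * (2 * `|ap U i t (xs s) - ap U i t x| +
   `|pd i (Un i) t (xs s) - pd i (Un i) t x|) <= _).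
  apply: secant_Lip => // y y'.
  by apply: (le_trans (bhat_xs _ _ _ _)); rewrite eqxx mulr1n mulrDr.
by rewrite le_eqVlt; apply/orP; left; apply/eqP; ring.
Qed.

(** The left-hand side is the derivative along [x_i] of that of [difference_equation] with frozen
    coefficients; the right-hand side has a slope, and [slope_derive_le] transfers the bound. *)
Lemma gradient_drift :
  `|Dn1t i t x + sigma ^+ 2 / 2 * (\sum_j Dn3 i i j j t x) + \sum_j bp j t x * Dn2 i i j t x|
  <= C * (`|Dn1 i i t x| * `|Dn2 i i i t x|) +
  C * \sum_j (nu * (nu + `|Dn1 i i t x| + `|Dn1 j j t x|)
              + `|Dn1 i j t x| * (nu + `|Dn2 j j i t x|) + nu * `|Dn2 j j i t x|).
Proof.
have [S2 S3] := Dn_commute tT0.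
(* The derivative along [x_i] is made the last one taken, as required to differentiate the
   equation. *)
have -> : \sum_j Dn3 i i j j t x = \sum_j Dn3 i j j i t x by apply: eq_bigr => j _; rewrite S3.
have -> : \sum_j bp j t x * Dn2 i i j t x = \sum_j bp j t x * Dn2 i j i t x.
  by apply: eq_bigr => j _; rewrite S2.
(* [bp] is evaluated at [x], not at [y]: this is the freezing. *)
pose Q y := Dnt i t y + sigma ^+ 2 / 2 * (\sum_j Dn2 i j j t y) + \sum_j bp j t x * Dn1 i j t y.
have dQ : is_derive x (delta_mx 0 i) Q (Dn1t i t x + sigma ^+ 2 / 2 * (\sum_j Dn3 i j j i t x)
    + \sum_j bp j t x * Dn2 i j i t x).
  exact: (derive_add (derive_add (derive_Dnt i x tT)
    (derive_scale _ (derive_sum _ (fun j _ => derive_Dn2 i j j i x tT0))))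
    (derive_sum _ (fun j _ => derive_scale _ (derive_Dn1 i j i x tT0)))).
apply: (slope_derive_le (iffLR (is_derive_line0 _ _ _ _) dQ)).
have -> : (fun r : R => Q (x + r *: delta_mx 0 i)) = fun s => - (Dn1 i i t (xs s) * (Bbar i t (xs s) - bp i t (xs 0))
     + hp U i t (xs s) * (Bbar i t (xs s) - bap i t (xs s))
     + \sum_(j | j != i) (Dn1 i j t (xs s) * (bp j t (xs s) - bp j t (xs 0))
          + vp1 U i j t (xs s) * (bp j t (xs s) - bap j t (xs s)))
     + sigma ^+ 2 / 2 * residual U i t (xs s)).
  by apply/funext => s; rewrite xs0 /Q (difference_equation i _ (fun j => bp j t x) tT1).
apply: slopeN.
have H1 : `|Dn1 i i t (xs 0)| = `|Dn1 i i t x| by rewrite xs0.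
have H2 := slope_xs (derive_Dn1 i i i x tT0).
have H3 := hp_bound fb i (xs 0) tT0.
have H4 := slope_le_xs (derive_hp me i x tT0) (hp1_bound me K0 fb i x tT0).
have H5 : `|Bbar i t (xs 0) - bp i t (xs 0)| <= 2 * L * (`|Dn1 i i t x| + nu * K).
  by rewrite xs0; exact: Bbar_bp.
have H6 : `|Bbar i t (xs 0) - bap i t (xs 0)| <= L * (`|Dn1 i i t x| + nu * K).
  by rewrite xs0; exact: Bbar_bap.
have H7 j : slope (fun s => bp j t (xs s)) (L * ((1 + 5 * K) * ((j == i)%:R + nu) + q j)).
  apply: slope_le (slope_bhat j (slope_p j)).
  have AC (a c : R) : a + (5 * K * a + c) = (1 + 5 * K) * a + c by ring.
  by rewrite AC.
have H8 j : slope (fun s => bap j t (xs s)) (L * ((1 + K) * ((j == i)%:R + nu))).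
  apply: slope_le (slope_bhat j (slope_ap j)).
  have AC (a : R) : a + K * a = (1 + K) * a by ring.
  by rewrite AC.
have H9 j : `|bp j t (xs 0) - bap j t (xs 0)| <= L * (`|Dn1 j j t x| + nu * K).
  by rewrite xs0; exact: bp_bap.
have H10 j : `|Dn1 i j t (xs 0)| = `|Dn1 i j t x| by rewrite xs0.
have H11 j := slope_xs (derive_Dn1 i j i x tT0).
have H12 j : j != i -> `|vp1 U i j t (xs 0)| <= nu * K.
  by move=> ji; apply: (vp1_off_bound fb) => //; rewrite eq_sym.
have H13 j : j != i -> slope (fun s => vp1 U i j t (xs s)) (2 * (nu * K)).
  move=> ji; apply: slope_le_xs (derive_vp1 me i j i x tT0) _.
  by apply: (vp2_off_bound me K0 fb) => //; rewrite eq_sym.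
have H14 := slope_le_xs (derive_residual mh i x tT0) (residual1_bound me mh K0 fb i x tT0).
exact: (@drift_slope R n i (sigma ^+ 2 / 2) K L M s20 K0 L0 M0 (fun j => `|Dn1 j j t x|)
  (fun j => `|Dn1 i j t x|) q (fun=> normr_ge0 _) (fun=> normr_ge0 _) (fun=> normr_ge0 _)
  (fun s => Dn1 i i t (xs s)) (fun s => hp U i t (xs s))
  (fun s => Bbar i t (xs s)) (fun s => residual U i t (xs s)) (fun j s => Dn1 i j t (xs s))
  (fun j s => vp1 U i j t (xs s)) (fun j s => bp j t (xs s)) (fun j s => bap j t (xs s))
  (fun j => `|Dn2 i j i t x|) H1 H2 H3 H4 slope_Bbar H5 H6 H7 H8 H9 H10 H11 H12 H13 H14).
Qed.

End along_a_line.

End difference.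

Lemma drift_constant_ge0 (R : realType) (s2 K L M : R) :
  0 <= s2 -> 0 <= K -> 0 <= L -> 0 <= M -> 0 <= drift_constant s2 K L M.
Proof.
by move=> s20 K0 L0 M0; rewrite /drift_constant !(addr_ge0, mulr_ge0).
Qed.

(** * The gradient estimate for the game and the theorem *)

Section nash_gradients.
Variables (R : realType) (T sigma : R) (n : nat) (V : set R).
Variables (b f : R -> P1 R -> R -> R) (g : R -> P1 R -> R) (vhat : R -> P1 R -> R -> R).
Variable U : R -> R -> P1 R -> R.
Variable Un : 'I_n.+1 -> R -> 'rV[R]_n.+1 -> R.
Let bhat := optimized vhat b.
Let fhat := optimized vhat f.
Let nu : R := n.+1%:R^-1.
Hypotheses (T0 : 0 < T) (sigma0 : 0 < sigma).
Hypotheses (vmin : is_minimizer V b f vhat) (cr : coef_regularity bhat fhat).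
Hypotheses (np : nplayer_solution T sigma V b f bhat g Un) (nh : nplayer_higher_regularity T Un).
Hypothesis ng : nplayer_growth T Un.
Hypotheses (meq : master_equation T sigma V b f bhat g U).
Hypotheses (me : master_regularity T U) (mh : master_higher_regularity T U).
Variables K L P : R.
Hypotheses (K0 : 0 <= K) (fb : fields_bounded_by T K (mfield0 U)).
Hypotheses (L0 : 0 <= L) (HL : forall n x x' (y y' : 'rV[R]_n.+1) p p',
  `|bhat x (emp y) p - bhat x' (emp y') p'| <=
  L * (`|x - x'| + n.+1%:R^-1 * (\sum_k `|y 0 k - y' 0 k|) + `|p - p'|)).
Hypotheses (P0 : 0 <= P)
  (HP : forall i t x, t \in `[0, T] -> `|pd i (Un i) t x| <= P).
Implicit Types (i j l : 'I_n.+1) (t : R) (x : 'rV[R]_n.+1).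
Local Notation w i := (Dn1 U Un i i).

(** [P] for the momentum of the game, [K] for [ap] and [K] for [hp]; independent of N. *)
Let M := P + 2 * K.
Let M0 : 0 <= M. Proof. by rewrite addr_ge0// mulr_ge0. Qed.
Let C := drift_constant (sigma ^+ 2 / 2) K L M.
Let C0 : 0 <= C.
Proof. by apply: drift_constant_ge0 => //; rewrite divr_ge0// sqr_ge0. Qed.

Let sub1 t : t \in `]0, T] -> t \in `[0, T].
Proof. by rewrite !in_itv/= => /andP[/ltW -> ->]. Qed.
Let sub2 t : t \in `]0, T[ -> t \in `[0, T].
Proof. by rewrite !in_itv/= => /andP[/ltW -> /ltW ->]. Qed.
Let nu0 : 0 <= nu. Proof. by rewrite invr_ge0 ler0n. Qed.
Let nu1 : nu <= 1. Proof. by rewrite invf_le1 ?ltr0n// ler1n. Qed.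

Let w_bound i t x : t \in `[0, T] -> `|w i t x| <= M.
Proof.
move=> tT; rewrite /Dn1 vp1_diag (le_trans (ler_normB _ _))// lerD ?HP//.
have A := ap_bound fb i x tT; have H := hp_bound fb i x tT.
rewrite (le_trans (ler_normD _ _))// mulr_natl mulr2n lerD// (le_trans H)//.
by rewrite ler_piMl.
Qed.

Let Dn_cont i : continuous_on `[0, T] (Dn U Un i).
Proof.
apply: within_add; first exact: np_continuous np i.
by apply: within_opp; exact: (vp_continuous me fb K0).
Qed.

Let w_cont i : continuous_on `[0, T] (w i).
Proof.
apply: within_add; first exact: (np_x np i i).2.
by apply: within_opp; exact: (vp1_continuous me).
Qed.

Let Dn_growth : exists2 c : R, 0 <= c &
  forall i t x, t \in `[0, T] -> `|Dn U Un i t x| <= c * rho x.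
Proof.
have [k k0 Hk] := ng; have [c Hc] := vp_growth n me fb K0.
exists (k + `|c|); first by rewrite addr_ge0// ltW.
move=> i t x tT; rewrite mulrDl (le_trans (ler_normB _ _))// lerD//.
  exact: (Hk i i t x tT).2.
apply: (le_trans (Hc i t x tT)); rewrite ler_wpM2r ?ler_norm//.
by rewrite (le_trans ler01)// rho_ge1.
Qed.

(** Linear growth from the Lipschitz bound centred at the origin; the 2 counts the player's own
    state and the average over all states, each at most [sqrt rho]. *)
Let bp_growth : exists2 c : R, 0 <= c &
  forall j t x, t \in `[0, T] -> bp b vhat Un j t x ^+ 2 <= c * rho x.
Proof.
pose B := `|bhat 0 (emp (0 : 'rV[R]_n.+1)) 0|; pose c := B + L * (2 + P).
exists (c ^+ 2) => [|j t x tT]; first exact: sqr_ge0.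
have r1 : 1 <= rho x := rho_ge1 x.
have r0 : 0 <= rho x by rewrite (le_trans ler01).
pose r := Num.sqrt (rho x).
have rE : r ^+ 2 = rho x by rewrite sqr_sqrtr.
have r1' : 1 <= r by rewrite -[X in X <= _]sqrtr1 ler_sqrt.
have xr k : `|x 0 k| <= r.
  by rewrite -sqrtr_sqr ler_sqrt// sqr_le_rho.
have A := HL (x 0 j) 0 x 0 (pd j (Un j) t x) 0.
have S : n.+1%:R^-1 * (\sum_k `|x 0 k - (0 : 'rV[R]_n.+1) 0 k|) <= r.
  rewrite ler_pdivrMl ?ltr0n// mulr_natl.
  apply: le_trans (_ : \sum_(k < n.+1) r <= _); last by rewrite sumr_const card_ord.
  by apply: ler_sum => k _; rewrite mxE subr0.
rewrite !subr0 in A.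
have Bc : `|bp b vhat Un j t x| <= c * r.
  rewrite /bp -[X in `|X|](subrK (bhat 0 (emp (0 : 'rV[R]_n.+1)) 0)).
  rewrite (le_trans (ler_normD _ _))// /c mulrDl addrC lerD//.
    by rewrite ler_peMr.
  apply: (le_trans A); rewrite -mulrA ler_wpM2l//.
  rewrite mulrDl mulr_natl mulr2n; apply: lerD; first by apply: lerD.
  by apply: (le_trans (HP j x tT)); rewrite ler_peMr.
have B0 : 0 <= B := normr_ge0 _.
have c0 : 0 <= c by apply: addr_ge0 => //; apply: mulr_ge0 => //; exact: addr_ge0.
have cr0 : 0 <= c * r by apply: mulr_ge0 => //; exact: sqrtr_ge0.
by rewrite -rE -exprMn -real_normK ?num_real// ler_sqr ?nnegrE.
Qed.

(** The two terminal data agree at every point, so the difference is identically zero in space and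
    so is its gradient. *)
Let Dn_T i x : Dn U Un i T x = 0 /\ w i T x = 0.
Proof.
have TT : T \in `[0, T] by rewrite in_itv/= lexx (ltW T0).
have E : Dn U Un i T = fun=> 0.
  by apply/funext => y; rewrite /Dn (np_terminal np) /vp /pull /mfield0 meq.2 subrr.
split; first by rewrite E.
have A := derive_Dn np me i i x TT; rewrite E in A.
by rewrite -(@derive_val _ _ _ _ _ _ _ A) (@derive_val _ _ _ _ _ _ _ (derive_cst _ _ _)).
Qed.

Lemma nash_gradient_estimate t x : t \in `]0, T] ->
  \sum_i w i t x ^+ 2 <= energy_bound T sigma C M / n.+1%:R.
Proof.
have [c1 c10 H1] := Dn_growth; have [c2 c20 H2] := bp_growth.
have c0 : 0 <= c1 + c2 by exact: addr_ge0.
have r0 y : 0 <= rho y :> R by rewrite (le_trans ler01)// rho_ge1.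
have subs : [set p : R * 'rV[R]_n.+1 | p.1 \in `]0, T]] `<=` [set p | p.1 \in `[0, T]].
  by move=> [s y] /=; exact: sub1.
apply: (@gradient_estimate R n T sigma C M (c1 + c2) sigma0 C0 M0 c0 (bp b vhat Un)
  (Dn U Un) (Dnt T U Un) (fun i => w i) (Dn1t T U Un) (Dn1 U Un)
  (fun i j => Dn2 U Un i j j) (fun i j => Dn2 U Un i i j) (fun i j => Dn3 U Un i i j j)).
- by move=> i; exact: continuous_subspaceW subs (@Dn_cont i).
- by move=> i; exact: continuous_subspaceW subs (@w_cont i).
- by move=> i s y sT; exact: (derive_t_Dn np nh me mh i y sT).
- move=> i j s y /sub2 sT; split; first exact: (derive_Dn np me i j y sT).
  exact: (derive_Dn1 np me i i j y sT).
- move=> i j s y /sub2 sT; split; first exact: (derive_Dn1 np me i j j y sT).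
  exact: (derive_Dn2 nh mh i i j j y sT).
- move=> i s y /sub1 sT; apply: (le_trans (H1 i s y sT)).
  by rewrite ler_wpM2r// lerDl.
- by move=> i s y /sub1; exact: w_bound.
- move=> j s y /sub2 sT; apply: (le_trans (H2 j s y sT)).
  by rewrite ler_wpM2r// lerDr.
- exact: Dn_T.
- move=> i s y sT.
  by apply: (difference_drift vmin cr np meq me K0 fb L0 HL M0 _ i y sT) => k r z /sub1; exact: w_bound.
- move=> i s y sT.
  exact: (gradient_drift vmin cr np nh meq me mh K0 fb L0 HL M0 i y sT).
Qed.

(** The time derivatives of the game are given on []0, T]]; the initial time is reached by
    continuity of the gradients. *)
Lemma nash_gradient_estimate_closed t x : t \in `[0, T] ->
  \sum_i w i t x ^+ 2 <= energy_bound T sigma C M / n.+1%:R.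
Proof.
move=> tT; have [t0|t0] := eqVneq t 0; last first.
  apply: nash_gradient_estimate; move: tT; rewrite !in_itv/= => /andP[].
  by rewrite le_eqVlt eq_sym (negPf t0)/= => -> ->.
have G : continuous_on `[0, T] (fun t x => \sum_i w i t x ^+ 2).
  by apply: within_sum => i _; apply: within_sqr; exact: w_cont.
apply/ler_addgt0Pr => e e0; have [r r0 H] := continuous_on_near G x tT e0.
pose s := Num.min (r / 2) T.
have s0 : 0 < s by rewrite lt_min divr_gt0.
have sT : s \in `]0, T] by rewrite in_itv/= s0 ge_min lexx orbT.
have ts : ball t r s.
  rewrite /ball/= t0 sub0r normrN gtr0_norm// gt_min.
  by rewrite ltr_pdivrMr// ltr_pMr// ltr1n.
have F := le_trans (ler_norm _) (H s x ts (ballxx x r0) (sub1 sT)).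
rewrite -(subrK (\sum_i w i s x ^+ 2) (\sum_i w i t x ^+ 2)) addrC.
by apply: lerD => //; exact: nash_gradient_estimate.
Qed.

(** The momentum gap is w^i + h^i: the squares of w^i are already summable, and N terms of size
    [(K / N)^2] from h^i add [K ^+ 2 / N]. The absolute value spares the sign of [energy_bound], and
    the added 1 makes the constant positive. *)
Lemma nash_drift_estimate t x : t \in `[0, T] ->
  \sum_i (bhat (x 0 i) (emp x) (pd i (Un i) t x)
          - bhat (x 0 i) (emp x) (dx (mfield0 U) t (x 0 i) (emp x) 0)) ^+ 2 <=
  (2 * L ^+ 2 * (`|energy_bound T sigma C M| + K ^+ 2) + 1) / n.+1%:R.
Proof.
move=> tT; set EB := energy_bound T sigma C M.
have E := nash_gradient_estimate_closed x tT; rewrite -/EB in E.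
have B i : (bhat (x 0 i) (emp x) (pd i (Un i) t x)
          - bhat (x 0 i) (emp x) (dx (mfield0 U) t (x 0 i) (emp x) 0)) ^+ 2 <=
    2 * L ^+ 2 * (w i t x ^+ 2 + nu * nu * K ^+ 2).
  have -> : dx (mfield0 U) t (x 0 i) (emp x) 0 = ap U i t x.
    by rewrite /ap /pull (row0_eq (select _ x) 0).
  have A := bp_bap Un fb L0 HL i x tT.
  rewrite /bp /bap in A.
  rewrite -real_normK ?num_real//.
  apply: le_trans (_ : (L * (`|w i t x| + nu * K)) ^+ 2 <= _).
    have r0 : 0 <= L * (`|w i t x| + nu * K) by rewrite mulr_ge0// addr_ge0// mulr_ge0.
    by rewrite ler_sqr ?nnegrE.
  rewrite exprMn -mulrA [2 * _]mulrCA ler_wpM2l ?sqr_ge0//.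
  rewrite -[w i t x ^+ 2]real_normK ?num_real//.
  have := sqr_ge0 (`|w i t x| - nu * K); lra.
apply: (le_trans (ler_sum _ (fun i _ => B i))).
rewrite -mulr_sumr big_split/= sumr_const card_ord.
have -> : nu * nu * K ^+ 2 *+ n.+1 = nu * K ^+ 2.
  have nN : n.+1%:R * nu = 1 by rewrite mulfV// pnatr_eq0.
  by rewrite -mulr_natl !mulrA nN mul1r.
apply: le_trans (_ : 2 * L ^+ 2 * ((`|EB| + K ^+ 2) / n.+1%:R) <= _).
  rewrite ler_wpM2l ?mulr_ge0 ?sqr_ge0// mulrDl lerD//.
    by apply: (le_trans E); rewrite ler_pM2r ?invr_gt0 ?ltr0n// ler_norm.
  by rewrite mulrC.
by rewrite mulrA ler_pM2r ?invr_gt0 ?ltr0n// lerDl.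
Qed.

End nash_gradients.

Theorem theorem2p7 (R : realType) (T : R) (d : measure_display)
    (Omega : measurableType d) (P : probability Omega R)
    (Ft : R -> set (set Omega)) (V : set R)
    (b f : R -> P1 R -> R -> R) (g : R -> P1 R -> R)
    (vhat : R -> P1 R -> R -> R) (sigma : R)
    (mu0 : P1 R) (X0 : nat -> Omega -> R) (W : nat -> R -> Omega -> R)
    (UN : forall n : nat, 'I_n.+1 -> R -> 'rV[R]_n.+1 -> R)
    (U : R -> R -> P1 R -> R)
    (X : forall n : nat, R -> Omega -> 'rV[R]_n.+1) :
  let bhat := optimized vhat b in
  let fhat := optimized vhat f in
  let Ux t x m := dx (mfield0 U) t x m 0 in
  0 < T -> is_filtration T Ft -> noise_setting T P Ft mu0 X0 W ->
  is_minimizer V b f vhat ->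
  finite_moment_above4 mu0 ->
  0 < sigma ->
  coef_regularity bhat fhat ->
  (forall n, nplayer_solution T sigma V b f bhat g (UN n) /\
    nplayer_growth T (UN n)) ->
  master_equation T sigma V b f bhat g U -> master_regularity T U ->
  coef_higher_regularity bhat fhat ->
  (forall n, nplayer_higher_regularity T (UN n)) ->
  (exists K : R, forall n i t x, t \in `[0, T] ->
    `|pd i (UN n i) t x| <= K) ->
  master_higher_regularity T U ->
  (forall n, nash_states T P Ft sigma bhat X0 W (UN n) (X n)) ->
  exists2 C : R, 0 < C &
    {ae P, forall w, forall t, t \in `[0, T] -> forall n : nat,
      let Xt := X n t w in
      let mu := emp Xt in
      \sum_(i < n.+1)
        (bhat (Xt 0 i) mu (pd i (UN n i) t Xt)
         - bhat (Xt 0 i) mu (Ux t (Xt 0 i) mu)) ^+ 2 <= C / n.+1%:R}.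
Proof.
move=> bhat fhat Ux T0 _ _ vmin _ sigma0 cr npg meq me _ nh [p Hp] mh _.
have [K K0 fb] := exists_fields_bound me mh; have [L L0 HL] := bhat_Lipschitz cr.
have TT : T \in `[0, T] by rewrite in_itv/= lexx (ltW T0).
have p0 : 0 <= p := le_trans (normr_ge0 _) (Hp 0 ord0 T 0 TT).
(* [K], [L] and [p] are fixed before the number of players, so the constant is uniform in N. *)
exists (2 * L ^+ 2 * (`|energy_bound T sigma (drift_constant (sigma ^+ 2 / 2) K L (p + 2 * K))
    (p + 2 * K)| + K ^+ 2) + 1).
  by rewrite ltr_wpDl// mulr_ge0 ?addr_ge0 ?mulr_ge0 ?sqr_ge0.
apply: aeW => w t tT n /=; have [np ng] := npg n.
exact: (nash_drift_estimate T0 sigma0 vmin cr np (nh n) ng meq me mh K0 fb L0 HL p0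
  (@Hp n) (X n t w) tT).
Qed.
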